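(* The $st$-polygon decomposition of an $n$-vertex outerplanar $st$-digraph $G$ can be computed in $O(n)$ time.
   Context: An $st$-digraph is a finite acyclic digraph with exactly one source $s$ and one sink $t$. An outerplanar $st$-digraph is an $st$-digraph with a fixed upward planar embedding in which all vertices lie on the external face; its external boundary consists of two directed paths from $s$ to $t$, its left and right sides ($s$ and $t$ are considered to lie on both sides). An $st$-polygon is an outerplanar $st$-digraph in which each side contains at least one vertex other than its source and sink, and no edge joins an inner vertex of the left side to an inner vertex of the right side (it may or may not contain the edge from its source to its sink). An $st$-polygon of $G$ is a subgraph of $G$ that, with the embedding inherited from $G$, is an $st$-polygon and contains every vertex and edge of $G$ lying in the region enclosed by its external boundary; it is maximal if it is not properly contained in another $st$-polygon of $G$. Let $\mathcal{R}(G)$ be the set of maximal $st$-polygons of $G$ and $\mathcal{F}(G)$ the set of free vertices, i.e., vertices of $G$ belonging to no maximal $st$-polygon. The representative $r(R)$ of $R\in\mathcal{R}(G)$ is its source, and $r(v)=v$ for $v\in\mathcal{F}(G)$. For distinct $x,y\in\mathcal{R}(G)\cup\mathcal{F}(G)$, $x\angle_p y$ iff $G$ has a directed path from $r(x)$ to $r(y)$. The $st$-polygon decomposition $\mathcal{D}(G)$ of $G$ is the sequence of the elements of $\mathcal{R}(G)\cup\mathcal{F}(G)$ in the total order induced by $\angle_p$. *)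

(* Defs.v *)
From HB Require Import structures.
From mathcomp Require Import all_boot all_order all_algebra.
From mathcomp Require Import all_classical all_reals all_analysis.

Set Implicit Arguments.
Unset Strict Implicit.
Unset Printing Implicit Defensive.

Import Order.TTheory GRing.Theory Num.Theory.
Import numFieldNormedType.Exports.

(* A random access machine, presented as structured while-programs over
   finitely many registers and finitely many zero-initialised arrays (a program
   is a finite text in which register and array names are literals, whereas
   array indices are computed), with an append-only output tape.  Every
   operator occurrence that is evaluated and every executed command costs one
   step.  The only operation that can increase a value is the successor, so
   after T steps all the values and addresses are O(T) plus the largest input
   value: a linear time run only handles words of O(log n) bits, and the unit
   cost measure is legitimate. *)

Inductive aexp : Type :=
| ALit (k : nat)
| AReg (r : nat)
| AGet (a : nat) (e : aexp)
| ASucc (e : aexp)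
| ASub (e1 e2 : aexp) (* truncated subtraction *)
| ALt (e1 e2 : aexp)
| AEq (e1 e2 : aexp).

Inductive com : Type :=
| CSkip
| CAssign (r : nat) (e : aexp)
| CStore (a : nat) (e1 e2 : aexp) (* array a at index e1 := e2 *)
| CWrite (e : aexp)
| CSeq (c1 c2 : com)
| CIf (e : aexp) (c1 c2 : com)
| CWhile (e : aexp) (c : com).

Record state : Type := State {
  reg : nat -> nat;
  arr : nat -> nat -> nat;
  out : seq nat }.

Fixpoint aeval (st : state) (e : aexp) : nat :=
  match e with
  | ALit k => k
  | AReg r => reg st r
  | AGet a e1 => arr st a (aeval st e1)
  | ASucc e1 => (aeval st e1).+1
  | ASub e1 e2 => aeval st e1 - aeval st e2
  | ALt e1 e2 => nat_of_bool (aeval st e1 < aeval st e2)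
  | AEq e1 e2 => nat_of_bool (aeval st e1 == aeval st e2)
  end.

Fixpoint acost (e : aexp) : nat :=
  match e with
  | ALit _ | AReg _ => 1
  | AGet _ e1 | ASucc e1 => (acost e1).+1
  | ASub e1 e2 | ALt e1 e2 | AEq e1 e2 => (acost e1 + acost e2).+1
  end.

Definition set_reg (st : state) (r v : nat) : state :=
  State (fun r' => if r' == r then v else reg st r') (arr st) (out st).

Definition set_arr (st : state) (a i v : nat) : state :=
  State (reg st)
        (fun a' i' => if (a' == a) && (i' == i) then v else arr st a' i')
        (out st).

Definition add_out (st : state) (v : nat) : state :=
  State (reg st) (arr st) (rcons (out st) v).

(* exec c st k st' : started in st, the program c halts in st' after exactly k
   steps.  Conditions are expressions, true when nonzero. *)
Inductive exec : com -> state -> nat -> state -> Prop :=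
| exec_skip st : exec CSkip st 1 st
| exec_assign st r e :
    exec (CAssign r e) st (acost e).+1 (set_reg st r (aeval st e))
| exec_store st a e1 e2 :
    exec (CStore a e1 e2) st (acost e1 + acost e2).+1
         (set_arr st a (aeval st e1) (aeval st e2))
| exec_write st e :
    exec (CWrite e) st (acost e).+1 (add_out st (aeval st e))
| exec_seq st st1 st2 c1 c2 k1 k2 :
    exec c1 st k1 st1 -> exec c2 st1 k2 st2 ->
    exec (CSeq c1 c2) st (k1 + k2).+1 st2
| exec_if_true st st1 e c1 c2 k :
    aeval st e != 0 -> exec c1 st k st1 ->
    exec (CIf e c1 c2) st (acost e + k).+1 st1
| exec_if_false st st1 e c1 c2 k :
    aeval st e = 0 -> exec c2 st k st1 ->
    exec (CIf e c1 c2) st (acost e + k).+1 st1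
| exec_while_false st e c :
    aeval st e = 0 -> exec (CWhile e c) st (acost e).+1 st
| exec_while_true st st1 st2 e c k1 k2 :
    aeval st e != 0 -> exec c st k1 st1 -> exec (CWhile e c) st1 k2 st2 ->
    exec (CWhile e c) st (acost e + k1 + k2).+1 st2.

(* The input word is stored in array 0. *)
Definition init_state (w : seq nat) : state :=
  State (fun _ => 0) (fun a i => if a == 0 then nth 0 w i else 0) [::].

(* Digraphs on subsets of the vertex names 0, ..., n-1, as a vertex set and an
   edge set. *)

Definition digraph (n : nat) : Type :=
  ({set 'I_n} * {set 'I_n * 'I_n})%type.

Definition verts (n : nat) (H : digraph n) : {set 'I_n} := H.1.
Definition edges (n : nat) (H : digraph n) : {set 'I_n * 'I_n} := H.2.

Definition arc (n : nat) (H : digraph n) : rel 'I_n :=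
  fun u v => (u, v) \in edges H.

Definition wf_digraph (n : nat) (H : digraph n) : Prop :=
  forall u v, arc H u v -> u \in verts H /\ v \in verts H.

Definition sub_digraph (n : nat) (H G : digraph n) : Prop :=
  verts H \subset verts G /\ edges H \subset edges G.

Definition sources (n : nat) (H : digraph n) : {set 'I_n} :=
  [set v in verts H | [forall u, ~~ arc H u v]]%SET.

Definition sinks (n : nat) (H : digraph n) : {set 'I_n} :=
  [set v in verts H | [forall u, ~~ arc H v u]]%SET.

Definition acyclic (n : nat) (H : digraph n) : Prop :=
  forall u v, arc H u v -> ~~ connect (arc H) v u.

Definition st_digraph (n : nat) (H : digraph n) (s t : 'I_n) : Prop :=
  [/\ wf_digraph H, acyclic H, sources H = [set s]%SET & sinks H = [set t]%SET].

(* p lists the vertices of a directed path of H from s to t. *)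
Definition dpath (n : nat) (H : digraph n) (s t : 'I_n) (p : seq 'I_n) : Prop :=
  exists p', [/\ p = s :: p', path (arc H) s p' & last s p' = t].

Local Open Scope classical_set_scope.
Local Open Scope ring_scope.

(* In an upward drawing every edge is a curve strictly monotone in the vertical
   direction, i.e. the graph x = xcurve e y of a continuous function of the
   height y between the heights of its end vertices. *)
Record drawing (R : realType) (n : nat) : Type := Drawing {
  xpos : 'I_n -> R;
  ypos : 'I_n -> R;
  xcurve : 'I_n * 'I_n -> R -> R }.

Definition pos (R : realType) (n : nat) (d : drawing R n) (v : 'I_n) : R * R :=
  (xpos d v, ypos d v).

Definition spans (R : realType) (n : nat) (d : drawing R n)
    (e : 'I_n * 'I_n) (y : R) : Prop :=
  ypos d e.1 <= y <= ypos d e.2.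

Definition curve (R : realType) (n : nat) (d : drawing R n)
    (e : 'I_n * 'I_n) : set (R * R) :=
  [set z | spans d e z.2 /\ z.1 = xcurve d e z.2].

Definition endpoint (n : nat) (e : 'I_n * 'I_n) (w : 'I_n) : Prop :=
  w = e.1 \/ w = e.2.

Definition upward_planar (R : realType) (n : nat) (d : drawing R n)
    (H : digraph n) : Prop :=
  [/\ {in verts H &, injective (pos d)},
      forall e, e \in edges H ->
        [/\ ypos d e.1 < ypos d e.2,
            {within `[ypos d e.1, ypos d e.2], continuous (xcurve d e)},
            xcurve d e (ypos d e.1) = xpos d e.1 &
            xcurve d e (ypos d e.2) = xpos d e.2],
      forall e w, e \in edges H -> w \in verts H ->
        curve d e (pos d w) -> endpoint e w &
      forall e f z, e \in edges H -> f \in edges H -> e <> f ->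
        curve d e z -> curve d f z ->
        exists w, [/\ endpoint e w, endpoint f w & z = pos d w]].

Definition drawn (R : realType) (n : nat) (d : drawing R n)
    (H : digraph n) : set (R * R) :=
  [set z | (exists2 v, v \in verts H & z = pos d v) \/
           (exists2 e, e \in edges H & curve d e z)].

(* The external face: the unbounded component of the complement. *)
Definition external_face (R : realType) (n : nat) (d : drawing R n)
    (H : digraph n) : set (R * R) :=
  [set z | ~ drawn d H z /\
           ~ bounded_set (connected_component (~` drawn d H) z)].

Definition outerplanar_st (R : realType) (n : nat) (d : drawing R n)
    (H : digraph n) : Prop :=
  [/\ exists s t, st_digraph H s t,
      upward_planar d H &
      forall v, v \in verts H -> closure (external_face d H) (pos d v)].

Definition path_trace (R : realType) (n : nat) (d : drawing R n)
    (p : seq 'I_n) : set (R * R) :=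
  [set z | (exists2 v, v \in p & z = pos d v) \/
           (exists2 e, e \in zip p (behead p) & curve d e z)].

(* The external boundary of H is made of its left side p and right side q. *)
Definition sides (R : realType) (n : nat) (d : drawing R n) (H : digraph n)
    (s t : 'I_n) (p q : seq 'I_n) : Prop :=
  [/\ dpath H s t p, dpath H s t q,
      closure (external_face d H) `\` external_face d H =
        path_trace d p `|` path_trace d q &
      forall x x' y, path_trace d p (x, y) -> path_trace d q (x', y) ->
        x <= x'].

Definition inner (n : nat) (s t : 'I_n) (p : seq 'I_n) : seq 'I_n :=
  [seq v <- p | (v != s) && (v != t)].

(* Only s and t lie on both sides of an st-polygon; without this requirement a
   bare path s, v, t, whose two sides coincide, would qualify. *)
Definition st_polygon (R : realType) (n : nat) (d : drawing R n)
    (H : digraph n) : Prop :=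
  outerplanar_st d H /\
  exists s t p q,
    [/\ st_digraph H s t, sides d H s t p q,
        inner s t p <> [::] /\ inner s t q <> [::] &
        forall u v, u \in inner s t p -> v \in inner s t q ->
          [/\ u <> v, ~~ arc H u v & ~~ arc H v u]].

Definition polygon_of (R : realType) (n : nat) (d : drawing R n)
    (G H : digraph n) : Prop :=
  [/\ sub_digraph H G, st_polygon d H,
      forall v, v \in verts G -> ~ external_face d H (pos d v) ->
        v \in verts H &
      forall e, e \in edges G -> curve d e `<=` ~` external_face d H ->
        e \in edges H].

Definition maximal_polygon (R : realType) (n : nat) (d : drawing R n)
    (G H : digraph n) : Prop :=
  polygon_of d G H /\
  forall H', polygon_of d G H' -> sub_digraph H H' -> H' = H.

Definition free_vertex (R : realType) (n : nat) (d : drawing R n)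
    (G : digraph n) (v : 'I_n) : Prop :=
  v \in verts G /\ forall H, maximal_polygon d G H -> v \notin verts H.

Definition element (n : nat) : Type := (digraph n + 'I_n)%type.

Definition is_element (R : realType) (n : nat) (d : drawing R n)
    (G : digraph n) (x : element n) : Prop :=
  match x with
  | inl H => maximal_polygon d G H
  | inr v => free_vertex d G v
  end.

Definition representative (n : nat) (x : element n) (v : 'I_n) : Prop :=
  match x with
  | inl H => sources H = [set v]%SET
  | inr u => u = v
  end.

(* Only used between distinct elements, so trivial paths are harmless. *)
Definition angle_p (n : nat) (G : digraph n) (x y : element n) : Prop :=
  exists u v,
    [/\ representative x u, representative y v & connect (arc G) u v].

Definition st_polygon_decomposition (R : realType) (n : nat) (d : drawing R n)
    (G : digraph n) (D : seq (element n)) : Prop :=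
  [/\ uniq D,
      forall x, x \in D <-> is_element d G x &
      pairwise (fun x y => `[< angle_p G x y >]) D].

(* Input.  The algorithm sees the embedding only through the left-to-right
   lists of out-neighbours and in-neighbours around each vertex. *)

Definition left_to_right (n : nat) (S : pred 'I_n)
    (lt : 'I_n -> 'I_n -> Prop) (l : seq 'I_n) : Prop :=
  [/\ uniq l, forall v, (v \in l) = S v & pairwise (fun a b => `[< lt a b >]) l].

Definition rotation (R : realType) (n : nat) (d : drawing R n) (G : digraph n)
    (outs ins : 'I_n -> seq 'I_n) : Prop :=
  forall v,
    left_to_right (fun w => arc G v w)
      (fun a b => \forall y \near (ypos d v)^'+,
         xcurve d (v, a) y < xcurve d (v, b) y) (outs v) /\
    left_to_right (fun w => arc G w v)
      (fun a b => \forall y \near (ypos d v)^'-,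
         xcurve d (a, v) y < xcurve d (b, v) y) (ins v).

Definition list_word (n : nat) (l : seq 'I_n) : seq nat :=
  size l :: [seq nat_of_ord v | v <- l].

Definition input_word (n : nat) (outs ins : 'I_n -> seq 'I_n) : seq nat :=
  n :: flatten [seq list_word (outs v) ++ list_word (ins v) | v <- enum 'I_n].

(* Output.  A free vertex is written as 0 followed by its name; a maximal
   st-polygon is written as 1 followed by its left and its right side, listed
   from its source to its sink.  The sides determine the st-polygon, since it
   contains everything of G in the region that they enclose. *)
Definition element_word (R : realType) (n : nat) (d : drawing R n)
    (x : element n) (w : seq nat) : Prop :=
  match x with
  | inl H => exists s t p q,
      [/\ st_digraph H s t, sides d H s t p q &
          w = 1%N :: list_word p ++ list_word q]
  | inr v => w = [:: 0%N; nat_of_ord v]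
  end.

Fixpoint output_word (R : realType) (n : nat) (d : drawing R n)
    (D : seq (element n)) (w : seq nat) : Prop :=
  match D with
  | [::] => w = [::]
  | x :: D' => exists w1 w2,
      [/\ element_word d x w1, output_word d D' w2 & w = w1 ++ w2]
  end.

(* Main.v *)
(* In an upward planar st-digraph the complement of the external face is the
   horizontal hull of the drawing, so a vertex lies on the external face iff no
   edge passes to its left or none to its right; the vertices of the first kind form
   the left side L, those of the second kind the right side R.  The maximal
   st-polygons turn out to be the intervals [u, v] of the reachability order whose
   inner vertices meet both sides but contain no left and right vertex that coincide
   or are adjacent.  Any two incomparable vertices lie inside such intervals, the
   sources of these intervals form a chain, and their sets of inner vertices are
   disjoint.  Hence every linear extension of the reachability order lists the
   decomposition.

   The algorithm only needs the first and the last out- and in-neighbours of each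
   vertex.  A vertex u is the source of a polygon iff its first out-neighbour a and
   its last out-neighbour b differ, u is the last in-neighbour of a and u is the first
   in-neighbour of b; sinks are recognised by the dual test, and the sides between
   them are followed along first, respectively last, out-neighbours.  Merging the two
   sides of G gives a linear extension.  The cost is linear because the polygons have
   disjoint interiors and G has at most 4n edges. *)
Require Import Defs.
From mathcomp Require Import all_boot all_order all_algebra.
From mathcomp Require Import all_classical all_reals all_analysis.
From mathcomp Require Import zify lra.
(* Imported again because [path.arc] shadows [Defs.arc]. *)
Require Import Defs.

Set Implicit Arguments.
Unset Strict Implicit.
Unset Printing Implicit Defensive.

(** * Combinatorics of two-sided acyclic digraphs *)

(** Every edge is the graph of a function of the height, so planarity enters only through the
    intermediate value theorem: two edges keep their left-to-right order at all common heights and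
    meet at most in a common end. This takes the place of the Jordan curve theorem. The external
    face is computed once, as the complement of the horizontal hull; from then on sides, boundary
    vertices and enclosed regions are compared height by height.

    On the combinatorial side the obstacle is maximality, which quantifies over all subgraphs. It is
    disposed of by three facts: every st-polygon is contained in a good interval, every good
    interval is an st-polygon, and no good interval contains another. Maximal st-polygons and good
    intervals are then the same thing, and the algorithm has nothing to maximise: a source is
    recognised from its immediate neighbourhood, because any violation of the local test would force
    two arcs to conflict. *)

Definition before (T : eqType) (l : seq T) (a b : T) : bool :=
  (b \in l) && (index a l < index b l).

Lemma before_mem (T : eqType) (l : seq T) a b :
  before l a b -> [/\ a \in l, b \in l & a != b].
Proof.
case/andP=> bl lt_ab; split=> //; first by rewrite -index_mem (ltn_trans lt_ab) ?index_mem.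
by apply: contraTneq lt_ab => ->; rewrite ltnn.
Qed.

Lemma before_rev (T : eqType) (l : seq T) a b :
  uniq l -> before (rev l) a b -> before l b a.
Proof.
move=> Ul ltab; have [al bl nab] := before_mem ltab; rewrite !mem_rev in al bl.
have Hr x : x \in l -> index x (rev l) = size l - (index x l).+1.
  move=> xl; have lx : index x l < size l by rewrite index_mem.
  have lt' : size l - (index x l).+1 < size l by rewrite ltn_subrL (leq_ltn_trans _ lx).
  have E : nth x (rev l) (size l - (index x l).+1) = x.
    by rewrite nth_rev // subnSK // subKn ?nth_index // ltnW.
  by rewrite -{1}E index_uniq ?rev_uniq ?size_rev.
case/andP: ltab => _; rewrite !Hr // /before al ltn_sub2lE ?index_mem // ltnS => ->.
Qed.

Lemma head_before (T : eqType) (l : seq T) x a :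
  a \in l -> a != head x l -> before l (head x l) a.
Proof.
by case: l => // y l al /= ay; rewrite /before al /= eqxx eq_sym (negbTE ay).
Qed.

Lemma head_mem (T : eqType) (l : seq T) x a : a \in l -> head x l \in l.
Proof. by case: l => //= y l _; rewrite mem_head. Qed.

Lemma last_rev (T : Type) (l : seq T) x : last x l = head x (rev l).
Proof. by elim/last_ind: l => // l y _; rewrite last_rcons rev_rcons. Qed.

(** * Strict reachability in an acyclic digraph *)

Section Order.
Variables (V : finType) (e : rel V).
Hypothesis acy : forall u v, e u v -> ~~ connect e v u.
Notation le := (connect e).
Definition ltc (u v : V) := (u != v) && connect e u v.
Notation lt := ltc.

Lemma connect_anti u v : le u v -> le v u -> u = v.
Proof.
case/connectP=> -[|w p] /= => [_ -> //|/andP[uw wp] ->] vu.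
have /negP[] := acy uw; apply: connect_trans vu.
by apply/connectP; exists p.
Qed.

Lemma ltc_irr u : ~~ lt u u. Proof. by rewrite /ltc eqxx. Qed.
Lemma ltcW u v : lt u v -> le u v. Proof. by case/andP. Qed.
Lemma le_eqVltc u v : le u v = (u == v) || lt u v.
Proof. by rewrite /ltc; case: eqVneq => //= ->; rewrite connect0. Qed.
Lemma ltc_le_trans v u w : lt u v -> le v w -> lt u w.
Proof.
case/andP=> nuv uv vw; rewrite /ltc (connect_trans uv vw) andbT.
by apply: contraNneq nuv => eq_uw; rewrite -eq_uw in vw; apply/eqP/connect_anti.
Qed.
Lemma le_ltc_trans v u w : le u v -> lt v w -> lt u w.
Proof.
move=> uv /andP[nvw vw]; rewrite /ltc (connect_trans uv vw) andbT.
by apply: contraNneq nvw => eq_uw; rewrite eq_uw in uv; apply/eqP/connect_anti.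
Qed.
Lemma ltc_trans v u w : lt u v -> lt v w -> lt u w.
Proof. by move=> uv /ltcW; apply: ltc_le_trans. Qed.
Lemma ltc_leF u v : lt u v -> le v u = false.
Proof.
by move=> uv; apply: contraNF (ltc_irr u) => vu; apply: ltc_le_trans vu.
Qed.
Lemma ltc_ltF u v : lt u v -> lt v u = false.
Proof. by move=> uv; apply: contraNF (ltc_irr u) => vu; apply: ltc_trans vu. Qed.
Lemma arc_ltc u v : e u v -> lt u v.
Proof.
move=> uv; rewrite /ltc connect1 // andbT.
by apply: contraTneq (acy uv) => ->; rewrite connect0.
Qed.
Lemma ltc_neq u v : lt u v -> u != v. Proof. by case/andP. Qed.

Lemma first_step u w : lt u w -> exists2 c, e u c & le c w.
Proof.
case/andP=> nuw /connectP[[|c p] /= up lp]; first by rewrite lp eqxx in nuw.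
by case/andP: up => uc cp; exists c => //; apply/connectP; exists p.
Qed.

Lemma last_step u w : lt u w -> exists2 c, e c w & le u c.
Proof.
case/andP=> nuw /connectP[p]; elim/last_ind: p => [|p c _] /=.
  by move=> _ lp; rewrite lp eqxx in nuw.
rewrite last_rcons rcons_path => /andP[up lc] ->; exists (last u p) => //.
by apply/connectP; exists p.
Qed.

(** Minimise the number of vertices below; acyclicity makes this number drop strictly along [lt]. *)
Lemma ex_minimal (P : pred V) x : P x ->
  exists2 m, P m & (forall w, P w -> ~~ lt w m).
Proof.
move=> Px; pose f m := #|[pred w | le w m]|.
have [m Pm mP] := arg_minnP f Px; exists m => // w Pw; apply/negP => wm.
have := mP w Pw; rewrite leqNgt => /negP[]; apply: proper_card; apply/properP.
split; first by apply/fintype.subsetP=> z; rewrite !inE => zw; apply: connect_trans (ltcW wm).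
by exists m; rewrite !inE ?connect0 // ltc_leF.
Qed.

Lemma ex_maximal (P : pred V) x : P x ->
  exists2 m, P m & (forall w, P w -> ~~ lt m w).
Proof.
move=> Px; pose f m := #|[pred w | le m w]|.
have [m Pm mP] := arg_minnP f Px; exists m => // w Pw; apply/negP => wm.
have := mP w Pw; rewrite leqNgt => /negP[]; apply: proper_card; apply/properP.
split; first by apply/fintype.subsetP=> z; rewrite !inE => zw; apply: connect_trans (ltcW wm) _.
by exists m; rewrite !inE ?connect0 // ltc_leF.
Qed.
End Order.

(** * Two-sided digraphs and their symmetries *)

Definition edge (V : Type) (e : rel V) u v := e u v || e v u.

(* All that is used of an outerplanar drawing.  [inL] and [inR] are the vertices on
   the left and on the right side, [outs] and [ins] the neighbours from left to
   right.  [ts_cross], [ts_chordL], [ts_nestL] and [ts_cut] say that two arcs do not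
   cross and that no arc passes outside a boundary vertex.  Reflecting the drawing
   and reversing the arcs preserve the record, which saves half of each argument. *)
Record two_sided (V : finType) (e : rel V) (s t : V) (inL inR : pred V)
    (outs ins : V -> seq V) : Prop := TwoSided {
  ts_acy : forall u v, e u v -> ~~ connect e v u;
  ts_sL : inL s; ts_sR : inR s; ts_tL : inL t; ts_tR : inR t;
  ts_src : forall v, connect e s v;
  ts_snk : forall v, connect e v t;
  ts_cover : forall v, inL v || inR v;
  ts_chainL : forall u v, inL u -> inL v -> connect e u v || connect e v u;
  ts_chainR : forall u v, inR u -> inR v -> connect e u v || connect e v u;
  ts_consL : forall u v, inL u -> inL v -> ltc e u v ->
    (forall w, inL w -> ltc e u w -> ltc e w v -> False) -> e u v;
  ts_consR : forall u v, inR u -> inR v -> ltc e u v ->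
    (forall w, inR w -> ltc e u w -> ltc e w v -> False) -> e u v;
  ts_cross : forall l r l' r', inL l -> inR r -> inL l' -> inR r' ->
    edge e l r -> edge e l' r' -> ltc e l l' -> ltc e r' r -> l != r' -> r != l' -> False;
  ts_chordL : forall w m z r, inL w -> inL m -> inL z -> inR r ->
    e w z -> ltc e w m -> ltc e m z -> edge e m r -> r != w -> r != z -> False;
  ts_chordR : forall w m z l, inR w -> inR m -> inR z -> inL l ->
    e w z -> ltc e w m -> ltc e m z -> edge e m l -> l != w -> l != z -> False;
  ts_nestL : forall w m z m', inL w -> inL m -> inL z -> inL m' ->
    e w z -> e m m' -> ltc e w m -> ltc e m z -> ltc e z m' -> False;
  ts_nestR : forall w m z m', inR w -> inR m -> inR z -> inR m' ->
    e w z -> e m m' -> ltc e w m -> ltc e m z -> ltc e z m' -> False;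
  ts_cut : forall u m v, inL m -> inR m -> e u v -> ltc e u m -> ltc e m v -> False;
  ts_outs_uniq : forall v, uniq (outs v);
  ts_ins_uniq : forall v, uniq (ins v);
  ts_outs : forall v w, (w \in outs v) = e v w;
  ts_ins : forall v w, (w \in ins v) = e w v;
  ts_outRL : forall u a b, before (outs u) a b -> inR a -> inL b -> False;
  ts_outLL : forall u a b, before (outs u) a b -> inL a -> inL b -> connect e a b;
  ts_outRR : forall u a b, before (outs u) a b -> inR a -> inR b -> connect e b a;
  ts_inRL : forall v a b, before (ins v) a b -> inR a -> inL b -> False;
  ts_inLL : forall v a b, before (ins v) a b -> inL a -> inL b -> connect e b a;
  ts_inRR : forall v a b, before (ins v) a b -> inR a -> inR b -> connect e a b }.

(** In [ts_cross] the exchange of left and right also exchanges the roles of the two arcs; the lists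
    of neighbours are reversed. *)
Lemma ts_mirror V e s t inL inR outs ins : @two_sided V e s t inL inR outs ins ->
  two_sided e s t inR inL (fun v => rev (outs v)) (fun v => rev (ins v)).
Proof.
move=> W; split=> /=; try by case: W.
- by move=> v; rewrite orbC (ts_cover W).
- move=> l r l' r' lR rL lR' rL'; rewrite /edge orbC => lr; rewrite orbC => lr' ll rr n1 n2.
  by apply: (ts_cross W rL' lR' rL lR lr' lr rr ll); rewrite eq_sym.
- by move=> u m v mR mL; exact: (ts_cut W mL mR).
- by move=> v; rewrite rev_uniq (ts_outs_uniq W).
- by move=> v; rewrite rev_uniq (ts_ins_uniq W).
- by move=> v w; rewrite mem_rev (ts_outs W).
- by move=> v w; rewrite mem_rev (ts_ins W).
- by move=> u a b /(before_rev (ts_outs_uniq W u)) H aL bR; exact: (ts_outRL W H bR aL).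
- by move=> u a b /(before_rev (ts_outs_uniq W u)) H aL bR; exact: (ts_outRR W H bR aL).
- by move=> u a b /(before_rev (ts_outs_uniq W u)) H aL bR; exact: (ts_outLL W H bR aL).
- by move=> u a b /(before_rev (ts_ins_uniq W u)) H aL bR; exact: (ts_inRL W H bR aL).
- by move=> u a b /(before_rev (ts_ins_uniq W u)) H aL bR; exact: (ts_inRR W H bR aL).
- by move=> u a b /(before_rev (ts_ins_uniq W u)) H aL bR; exact: (ts_inLL W H bR aL).
Qed.

Definition rev_rel (V : Type) (e : rel V) : rel V := fun u v => e v u.

Lemma lt_rev (V : finType) (e : rel V) u v : ltc (rev_rel e) u v = ltc e v u.
Proof. by rewrite /ltc eq_sym /rev_rel connect_rev. Qed.

(** Turning the drawing upside down keeps left and right, so the in-lists and out-lists are swapped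
    but not reversed. *)
Lemma ts_dual V e s t inL inR outs ins : @two_sided V e s t inL inR outs ins ->
  two_sided (rev_rel e) t s inL inR ins outs.
Proof.
move=> W; have cr u v : connect (rev_rel e) u v = connect e v u by rewrite connect_rev.
have lr' u v : ltc (rev_rel e) u v = ltc e v u by exact: lt_rev.
split=> /=; try by case: W.
- by move=> u v uv; rewrite cr (ts_acy W).
- by move=> v; rewrite cr (ts_snk W).
- by move=> v; rewrite cr (ts_src W).
- by move=> u v uL vL; rewrite !cr orbC (ts_chainL W).
- by move=> u v uL vL; rewrite !cr orbC (ts_chainR W).
- move=> u v uL vL; rewrite lr' => vu H; apply: (ts_consL W vL uL vu) => w wL vw wu.
  by apply: (H w); rewrite ?lr'.
- move=> u v uL vL; rewrite lr' => vu H; apply: (ts_consR W vL uL vu) => w wL vw wu.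
  by apply: (H w); rewrite ?lr'.
- move=> l r l' r' lL rR lL' rR'; rewrite /edge orbC => x1; rewrite orbC => x2.
  rewrite !lr' => ll rr n1 n2.
  by apply: (ts_cross W lL' rR' lL rR x2 x1 ll rr); rewrite eq_sym.
- move=> w m z r wL mL zL rR zw; rewrite !lr' => mw zm; rewrite /edge orbC => mr n1 n2.
  exact: (ts_chordL W zL mL wL rR zw zm mw mr n2 n1).
- move=> w m z r wL mL zL rR zw; rewrite !lr' => mw zm; rewrite /edge orbC => mr n1 n2.
  exact: (ts_chordR W zL mL wL rR zw zm mw mr n2 n1).
- move=> w m z m' wL mL zL mL' wz mm; rewrite !lr' => n1 n2 n3.
  exact: (ts_nestL W mL' zL mL wL mm wz n3 n2 n1).
- move=> w m z m' wL mL zL mL' wz mm; rewrite !lr' => n1 n2 n3.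
  exact: (ts_nestR W mL' zL mL wL mm wz n3 n2 n1).
- by move=> u m v mL mR vu; rewrite !lr' => n1 n2; apply: (ts_cut W mL mR vu n2 n1).
- by move=> v a b; rewrite cr; exact: (@ts_inLL _ _ _ _ _ _ _ _ W v a b).
- by move=> v a b; rewrite cr; exact: (@ts_inRR _ _ _ _ _ _ _ _ W v a b).
- by move=> v a b; rewrite cr; exact: (@ts_outLL _ _ _ _ _ _ _ _ W v a b).
- by move=> v a b; rewrite cr; exact: (@ts_outRR _ _ _ _ _ _ _ _ W v a b).
Qed.

(** The default is [v] itself: a vertex without neighbours is its own first and last neighbour,
    which makes the local tests below fail for it. *)
Definition fst_nbr (V : Type) (l : V -> seq V) (v : V) := head v (l v).
Definition lst_nbr (V : Type) (l : V -> seq V) (v : V) := last v (l v).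

Lemma fst_rev (V : Type) (l : V -> seq V) v : fst_nbr (fun v => rev (l v)) v = lst_nbr l v.
Proof. by rewrite /lst_nbr last_rev. Qed.
Lemma lst_rev (V : Type) (l : V -> seq V) v : lst_nbr (fun v => rev (l v)) v = fst_nbr l v.
Proof. by rewrite /lst_nbr last_rev revK. Qed.

(** * The boundary chains *)

Section LeftSide.
Variables (V : finType) (e : rel V) (s t : V) (inL inR : pred V) (outs ins : V -> seq V).
Hypothesis W : two_sided e s t inL inR outs ins.
Notation le := (connect e).
Notation lt := (ltc e).
Let acy := ts_acy W.

Lemma chainL_lt u v : inL u -> inL v -> [\/ lt u v, u = v | lt v u].
Proof.
move=> uL vL; case: (eqVneq u v) => [->|nuv]; first by constructor 2.
case/orP: (ts_chainL W uL vL) => uv; first by constructor 1; rewrite /ltc nuv.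
by constructor 3; rewrite /ltc eq_sym nuv.
Qed.

Lemma chainL_ltNge u v : inL u -> inL v -> ~~ le u v -> lt v u.
Proof.
move=> uL vL nuv; case: (chainL_lt uL vL) => // [/ltcW|eq_uv]; first by rewrite (negbTE nuv).
by rewrite eq_uv connect0 in nuv.
Qed.

Lemma notL_R v : ~~ inL v -> inR v.
Proof. by have := ts_cover W v; case: (inL v). Qed.

Lemma arc_out_lo u c : e u c -> e u (fst_nbr outs u).
Proof. by rewrite -!(ts_outs W); apply: head_mem. Qed.

Lemma arc_in_li v c : e c v -> e (fst_nbr ins v) v.
Proof. by rewrite -!(ts_ins W); apply: head_mem. Qed.

(** No right vertex precedes a left one in [outs u], so the list starts on the left as soon as it
    contains a left vertex, and its left vertices are increasing. *)
Lemma lo_le u c : e u c -> inL c -> inL (fst_nbr outs u) && le (fst_nbr outs u) c.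
Proof.
rewrite -(ts_outs W) => uc cL; case: (eqVneq c (fst_nbr outs u)) => [<-|ne].
  by rewrite cL connect0.
have bef := head_before uc ne.
have loL : inL (fst_nbr outs u).
  by have := ts_cover W (fst_nbr outs u); case: (boolP (inR _)) => [aR|_];
    [have := ts_outRL W bef aR cL | rewrite orbF].
by rewrite loL (ts_outLL W bef).
Qed.

(** The successor of [u] on the left side is an out-neighbour of [u] by [ts_consL], and [lo_le] puts
    the first out-neighbour at or below it. *)
Lemma lo_next u : inL u -> u != t ->
  [/\ e u (fst_nbr outs u), inL (fst_nbr outs u) &
      forall w, inL w -> lt u w -> le (fst_nbr outs u) w].
Proof.
move=> uL nut; have ut : lt u t by rewrite /ltc nut (ts_snk W).
have [m /andP[mL um] mP] := @ex_minimal _ _ acy (fun w => inL w && lt u w) t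
  (introT andP (conj (ts_tL W) ut)).
have uem : e u m.
  by apply: (ts_consL W uL mL um) => w wL uw wm; move: (mP w); rewrite wL uw wm => /(_ isT).
have /andP[loL lom] := lo_le uem mL; split=> //; first exact: arc_out_lo uem.
move=> w wL uw; apply: connect_trans lom _; apply: contraT => nmw.
by have := mP w; rewrite wL uw (chainL_ltNge mL wL nmw) => /(_ isT).
Qed.

(** A path from the left to the right side has to change sides: after a maximal left vertex between
    [x] and [z] the next step leaves the left side, unless that vertex is [z] itself, which is then
    on both sides. *)
Lemma bridge x z : inL x -> inR z -> le x z ->
  exists l r, [/\ inL l, inR r, le x l, le r z & (e l r \/ l = r)].
Proof.
move=> xL zR xz.
have [l /and3P[lL xl lz] lP] := @ex_maximal _ _ acy (fun w => [&& inL w, le x w & le w z]) x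
  (introT and3P (And3 xL (connect0 _ _) xz)).
move: lz; rewrite le_eqVltc => /orP[/eqP ez|lz].
  by exists l, l; split=> //; rewrite ?ez //; right.
have [c lc cz] := first_step lz; exists l, c; split=> //; last by left.
apply: notL_R; apply/negP => cL; have := lP c; rewrite cL cz (arc_ltc acy lc).
by rewrite (connect_trans xl (connect1 lc)) => /(_ isT).
Qed.

Lemma cut_comparable m w : inL m -> inR m -> le m w || le w m.
Proof. by move=> mL mR; case/orP: (ts_cover W w) => ?; [apply: ts_chainL W _ _ _ _|apply: ts_chainR W _ _ _ _]. Qed.
End LeftSide.

(** * Good intervals *)

Section BothSides.
Variables (V : finType) (e : rel V) (s t : V) (inL inR : pred V) (outs ins : V -> seq V).
Hypothesis W : two_sided e s t inL inR outs ins.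
Notation le := (connect e).
Notation lt := (ltc e).
Notation lo := (fst_nbr outs).
Notation ro := (lst_nbr outs).
Notation ri := (lst_nbr ins).
Let acy := ts_acy W.

Lemma chainR_lt u v : inR u -> inR v -> [\/ lt u v, u = v | lt v u].
Proof. exact: chainL_lt (ts_mirror W) u v. Qed.
Lemma chainR_ltNge u v : inR u -> inR v -> ~~ le u v -> lt v u.
Proof. exact: chainL_ltNge (ts_mirror W) u v. Qed.
Lemma notR_L v : ~~ inR v -> inL v.
Proof. exact: notL_R (ts_mirror W) v. Qed.
Lemma arc_out_ro u c : e u c -> e u (ro u).
Proof. by move=> /(arc_out_lo (ts_mirror W)); rewrite fst_rev. Qed.
Lemma ro_le u c : e u c -> inR c -> inR (ro u) && le (ro u) c.
Proof. by move=> uc cR; have := lo_le (ts_mirror W) uc cR; rewrite fst_rev. Qed.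
Lemma ro_next u : inR u -> u != t ->
  [/\ e u (ro u), inR (ro u) & forall w, inR w -> lt u w -> le (ro u) w].
Proof. by move=> uR ut; have := lo_next (ts_mirror W) uR ut; rewrite fst_rev. Qed.
Lemma ri_ge v c : e c v -> inR c -> inR (ri v) && le c (ri v).
Proof. by move=> cv cL; have := lo_le (ts_mirror (ts_dual W)) cv cL; rewrite fst_rev connect_rev. Qed.
Lemma arc_in_ri v c : e c v -> e (ri v) v.
Proof. by move=> cv; have := arc_out_lo (ts_mirror (ts_dual W)) cv; rewrite fst_rev. Qed.
Lemma bridgeR x z : inR x -> inL z -> le x z ->
  exists l r, [/\ inR l, inL r, le x l, le r z & (e l r \/ l = r)].
Proof. exact: bridge (ts_mirror W) x z. Qed.

Definition inside u v w := lt u w && lt w v.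

(* The st-polygons of the digraph turn out to be its intervals [u, v] with [good u v]. *)
Definition good u v :=
  [/\ exists2 a, inside u v a & inL a,
      exists2 b, inside u v b & inR b &
      forall a b, inside u v a -> inL a -> inside u v b -> inR b ->
        [/\ a <> b, ~~ e a b & ~~ e b a]].

Definition parallel x y := ~~ le x y && ~~ le y x.

(** Each side is a chain, so incomparable vertices have no side in common, while every vertex has a
    side. *)
Lemma parallel_sides x y : parallel x y ->
  (inL x && ~~ inR x) && (inR y && ~~ inL y) || (inR x && ~~ inL x) && (inL y && ~~ inR y).
Proof.
case/andP=> nxy nyx.
have := ts_cover W x; have := ts_cover W y.
have := @ts_chainL _ _ _ _ _ _ _ _ W x y; have := @ts_chainR _ _ _ _ _ _ _ _ W x y.
rewrite (negbTE nxy) (negbTE nyx) /=.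
by case: (inL x) (inR x) (inL y) (inR y) => [] [] [] [] //= H1 H2; rewrite ?H1 ?H2.
Qed.

(** [good] excludes only coincidence and adjacency, but a path between the two sides stays inside
    the interval, where [bridge] would find a forbidden pair on it. *)
Lemma good_parallel u v a b : good u v ->
  inside u v a -> inL a -> inside u v b -> inR b -> parallel a b.
Proof.
case=> _ _ H ai aL bi bR; apply/andP; split; apply/negP => ab.
  have [l [r [lL rR al rb lr]]] := bridge W aL bR ab.
  case/andP: ai => ua av; case/andP: bi => ub bv.
  have lrle : le l r by case: lr => [/connect1|->].
  have li' : inside u v l.
    by rewrite /inside (ltc_le_trans acy ua al) (le_ltc_trans acy (connect_trans lrle rb) bv).
  have ri' : inside u v r.
    by rewrite /inside (ltc_le_trans acy ua (connect_trans al lrle)) (le_ltc_trans acy rb bv).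
  by have [n1 n2 n3] := H l r li' lL ri' rR; case: lr => // lr; rewrite lr in n2.
have [r [l [rR lL al rb lr]]] := bridgeR bR aL ab.
case/andP: ai => ua av; case/andP: bi => ub bv.
have lrle : le r l by case: lr => [/connect1|->].
have ri' : inside u v r.
  by rewrite /inside (ltc_le_trans acy ub al) (le_ltc_trans acy (connect_trans lrle rb) av).
have li' : inside u v l.
  by rewrite /inside (ltc_le_trans acy ub (connect_trans al lrle)) (le_ltc_trans acy rb av).
by have [n1 n2 n3] := H l r li' lL ri' rR; case: lr => // lr; [rewrite lr in n3|rewrite lr in n1].
Qed.

(** The first step from [u] towards [a] is comparable with [a], hence not on the right; then [lo_le]
    applies. *)
Lemma good_lo u v a : good u v -> inside u v a -> inL a ->
  [/\ e u (lo u), inL (lo u), inside u v (lo u) & le (lo u) a].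
Proof.
move=> guv ai aL; case/andP: (ai) => ua av.
have [c uc ca] := first_step ua.
have ci : inside u v c by rewrite /inside (arc_ltc acy uc) (le_ltc_trans acy ca av).
have cL : inL c.
  apply: contraT => /(notL_R W) cR; have := good_parallel guv ai aL ci cR.
  by rewrite /parallel ca andbF.
have /andP[loL loc] := lo_le W uc cL.
have uelo := arc_out_lo W uc.
split=> //; last exact: connect_trans ca.
by rewrite /inside (arc_ltc acy) //= (le_ltc_trans acy loc) //; case/andP: ci.
Qed.
End BothSides.

Lemma good_mirror (V : finType) (e : rel V) (inL inR : pred V) u v :
  good e inL inR u v -> good e inR inL u v.
Proof.
case=> Ha Hb H; split=> // a b ai aR bi bL.
by have [n1 n2 n3] := H b a bi bL ai aR; split=> // ?; apply: n1.
Qed.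

Lemma inside_rev (V : finType) (e : rel V) u v w :
  inside (rev_rel e) v u w = inside e u v w.
Proof. by rewrite /inside [LHS]andbC (lt_rev e v w) (lt_rev e w u). Qed.

Lemma good_dual (V : finType) (e : rel V) (inL inR : pred V) u v :
  good e inL inR u v -> good (rev_rel e) inL inR v u.
Proof.
have ir := inside_rev e u v.
case=> [[a ai aL] [b bi bR]] H; split; [by exists a; rewrite ?ir|by exists b; rewrite ?ir|].
move=> x y; rewrite !ir => xi xL yi yR.
by have [n1 n2 n3] := H x y xi xL yi yR.
Qed.

Definition is_src (V : eqType) (outs ins : V -> seq V) (u : V) :=
  [&& fst_nbr outs u != lst_nbr outs u, lst_nbr ins (fst_nbr outs u) == u
    & fst_nbr ins (lst_nbr outs u) == u].

(** * Local recognition of sources and uniqueness of sinks *)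

Section GoodEnds.
Variables (V : finType) (e : rel V) (s t : V) (inL inR : pred V) (outs ins : V -> seq V).
Hypothesis W : two_sided e s t inL inR outs ins.
Notation le := (connect e).
Notation lt := (ltc e).
Notation lo := (fst_nbr outs).
Notation ro := (lst_nbr outs).
Notation li := (fst_nbr ins).
Notation ri := (lst_nbr ins).
Notation inside := (inside e).
Notation good := (good e inL inR).
Notation parallel := (parallel e).
Let acy := ts_acy W.

Lemma good_ro u v b : good u v -> inside u v b -> inR b ->
  [/\ e u (ro u), inR (ro u), inside u v (ro u) & le (ro u) b].
Proof.
move=> /good_mirror guv bi bR.
by have := good_lo (ts_mirror W) guv bi bR; rewrite fst_rev.
Qed.

Lemma good_li u v a : good u v -> inside u v a -> inL a ->
  [/\ e (li v) v, inL (li v), inside u v (li v) & le a (li v)].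
Proof.
move=> /good_dual guv; rewrite -inside_rev => ai aL.
have := good_lo (ts_dual W) guv ai aL.
by rewrite inside_rev connect_rev.
Qed.

Lemma good_ri u v b : good u v -> inside u v b -> inR b ->
  [/\ e (ri v) v, inR (ri v), inside u v (ri v) & le b (ri v)].
Proof.
move=> /good_dual /good_mirror guv; rewrite -inside_rev => ai aL.
have := good_lo (ts_mirror (ts_dual W)) guv ai aL.
by rewrite inside_rev fst_rev connect_rev.
Qed.

Lemma good_ends u v : good u v ->
  [/\ e u (lo u), inL (lo u), inside u v (lo u), e u (ro u) & inR (ro u) /\ inside u v (ro u)].
Proof.
move=> guv; case: (guv) => [[a ai aL] [b bi bR] _].
have [h1 h2 h3 _] := good_lo W guv ai aL.
by have [k1 k2 k3 _] := good_ro guv bi bR.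
Qed.

Lemma good_par u v : good u v -> parallel (lo u) (ro u).
Proof.
by move=> guv; have [_ aL ai _ [bR bi]] := good_ends guv; exact: (good_parallel W guv ai aL bi bR).
Qed.

(** An earlier in-neighbour [x] of [ro u] is excluded according to the sides of [x] and [u]: its arc
    would cross or enclose the arc from [u] to [lo u], or contradict the order of the in-neighbours,
    or [x] would lie between [u] and the next vertex of their side. *)
Lemma good_li_ro u v : good u v -> li (ro u) = u.
Proof.
move=> guv; have [ua aL ai ub [bR bi]] := good_ends guv.
have /andP[nab nba] := good_par guv.
have xb := arc_in_li W ub; apply/eqP; apply: contraT => nxu.
have bef : before (ins (ro u)) (li (ro u)) u.
  by apply: head_before; rewrite 1?eq_sym // (ts_ins W).
set x := li (ro u) in xb nxu bef *; set a := lo u in ua aL ai nab nba *.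
set b := ro u in ub bR bi nab nba xb bef *.
have nab' : a != b by apply: contraNneq nab => ->; rewrite connect0.
have xnb : le x b by exact: connect1.
have ub' := arc_ltc acy ub; have ua' := arc_ltc acy ua.
have [xL|xnL] := boolP (inL x).
  have xa : lt x a.
    by apply: (chainL_ltNge W aL xL); apply: contraNN nab => ax; apply: connect_trans ax _.
  have [uR|unR] := boolP (inR u).
    have [] := ts_cross W xL bR aL uR _ _ xa ub' nxu.
    - by rewrite /edge xb.
    - by rewrite /edge ua orbT.
    - by rewrite eq_sym.
  have uL := notR_L W unR.
  case: (chainL_lt W uL xL) => [ux|eux|xu].
  - have ut : u != t by apply: (ltc_neq (e := e)); exact: (ltc_le_trans acy ub' (ts_snk W _)).
    have [_ _ /(_ x xL ux)] := lo_next W uL ut.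
    by rewrite -/a ltc_leF.
  - by rewrite eux eqxx in nxu.
  - by have := ts_inLL W bef xL uL; rewrite ltc_leF.
have xR := notL_R W xnL.
have [uR|unR] := boolP (inR u); last first.
  by have := ts_inRL W bef xR (notR_L W unR).
case: (chainR_lt W uR xR) => [ux|eux|xu].
- have ut : u != t by apply: (ltc_neq (e := e)); exact: (ltc_le_trans acy ub' (ts_snk W _)).
  have [_ _ /(_ x xR ux)] := ro_next W uR ut.
  by rewrite -/b ltc_leF // arc_ltc.
- by rewrite eux eqxx in nxu.
- have [] := ts_chordR W xR uR bR aL xb xu ub' _ _ nab'.
    by rewrite /edge ua.
  by apply: contraTneq ua' => ->; rewrite ltc_ltF.
Qed.
End GoodEnds.

Section LocalSource.
Variables (V : finType) (e : rel V) (s t : V) (inL inR : pred V) (outs ins : V -> seq V).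
Hypothesis W : two_sided e s t inL inR outs ins.
Notation le := (connect e).
Notation lt := (ltc e).
Notation lo := (fst_nbr outs).
Notation ro := (lst_nbr outs).
Notation good := (good e inL inR).
Let acy := ts_acy W.

Lemma good_src u v : good u v -> is_src outs ins u.
Proof.
move=> guv; rewrite /is_src (good_li_ro W guv) eqxx andbT.
have := good_li_ro (ts_mirror W) (good_mirror guv).
rewrite fst_rev lst_rev => ->; rewrite eqxx andbT.
have /andP[nab _] := good_par W guv.
by apply: contraNneq nab => ->; rewrite connect0.
Qed.

(* A path from [lo u] to [ro u] would enter [ro u] to the left of the arc from [u]. *)
Lemma src_nle u : is_src outs ins u -> ~~ le (lo u) (ro u).
Proof.
case/and3P=> nab _ /eqP lib; apply/negP => ab.
have ab' : lt (lo u) (ro u) by rewrite /ltc nab.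
have uout : exists c, e u c.
  case E : (outs u) => [|c l]; first by rewrite /fst_nbr /lst_nbr E eqxx in nab.
  by exists c; rewrite -(ts_outs W) E mem_head.
have [c0 uc0] := uout.
have ua := arc_out_lo W uc0; have ub := arc_out_ro W uc0.
have ua' := arc_ltc acy ua; have ub' := arc_ltc acy ub.
have bef : before (outs u) (lo u) (ro u).
  by apply: head_before; rewrite 1?eq_sym // (ts_outs W).
have [x xb ax] := last_step ab'.
have ux := ltc_le_trans acy ua' ax.
have befi : before (ins (ro u)) u x.
  have xi : x \in ins (ro u) by rewrite (ts_ins W).
  have := @head_before _ (ins (ro u)) (ro u) x xi; rewrite -/(fst_nbr ins (ro u)) lib.
  by apply; rewrite eq_sym (ltc_neq ux).
set a := lo u in nab ab ab' ua ua' ax bef *.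
set b := ro u in nab lib ab ab' ub ub' bef xb befi *.
have nut : u != t by apply: ltc_neq (ltc_le_trans acy ux (ts_snk W _)).
have xbl := arc_ltc acy xb.
have xnL : ~~ inL x.
  apply/negP => xL; have unL : ~~ inL u.
    by apply/negP => uL; have := ts_inLL W befi uL xL; rewrite ltc_leF.
  exact: (ts_inRL W befi (notL_R W unL) xL).
have xR := notL_R W xnL.
(* The path from [lo u] to the right vertex [x] has to change sides strictly between [u] and [ro u],
   where the arc from [u] to [ro u] leaves no room for it. Here this excludes that [ro u] is on the
   left only; below it gives the final contradiction. *)
have bR : inR b.
  apply: contraT => bnR; have bL := notR_L W bnR.
  have uL : inL u.
    apply: contraT => /(notL_R W) uR; have [_] := ro_next W uR nut.
    by rewrite (negbTE bnR).
  have anR : ~~ inR a by apply/negP => aR; exact: (ts_outRL W bef aR bL).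
  have [l [r [lL rR al rx lr]]] := bridge W (notR_L W anR) xR ax.
  have lrle : le l r by case: lr => [/connect1|->].
  have ul := ltc_le_trans acy ua' al.
  have lb := le_ltc_trans acy (connect_trans lrle rx) xbl.
  case: lr => [lr|elr]; last by case: (ts_cut W lL _ ub ul lb); rewrite elr.
  case: (ts_chordL W uL lL bL rR ub ul lb) => //; first by rewrite /edge lr.
    by rewrite eq_sym; apply: ltc_neq (ltc_le_trans acy ul lrle).
  exact: ltc_neq (le_ltc_trans acy rx xbl).
have anR : ~~ inR a.
  by apply/negP => aR; have := ro_le W ua aR; rewrite -/b ltc_leF ?andbF.
have [l [r [lL rR al rx lr]]] := bridge W (notR_L W anR) xR ax.
have lrle : le l r by case: lr => [/connect1|->].
have ul := ltc_le_trans acy ua' al.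
have ur := ltc_le_trans acy ul lrle.
have rb := le_ltc_trans acy rx xbl.
have lb := le_ltc_trans acy lrle rb.
case: lr => [lr|elr]; last by case: (ts_cut W lL _ ub ul lb); rewrite elr.
have [uL|unL] := boolP (inL u).
  case: (ts_cross W uL bR lL rR _ _ ul rb).
  - by rewrite /edge ub.
  - by rewrite /edge lr.
  - exact: ltc_neq ur.
  - by rewrite eq_sym; exact: ltc_neq lb.
have uR := notL_R W unL.
case: (ts_chordR W uR rR bR lL ub ur rb).
- by rewrite /edge lr orbT.
- by rewrite eq_sym; exact: ltc_neq ul.
- exact: ltc_neq lb.
Qed.
End LocalSource.

Lemma is_src_mirror (V : eqType) (outs ins : V -> seq V) u :
  is_src (fun v => rev (outs v)) (fun v => rev (ins v)) u = is_src outs ins u.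
Proof. by rewrite /is_src !fst_rev !lst_rev eq_sym; congr (_ && _); apply: andbC. Qed.

Section SourceGood.
Variables (V : finType) (e : rel V) (s t : V) (inL inR : pred V) (outs ins : V -> seq V).
Hypothesis W : two_sided e s t inL inR outs ins.
Notation le := (connect e).
Notation lt := (ltc e).
Notation lo := (fst_nbr outs).
Notation ro := (lst_nbr outs).
Notation li := (fst_nbr ins).
Notation ri := (lst_nbr ins).
Notation inside := (inside e).
Notation good := (good e inL inR).
Notation parallel := (parallel e).
Let acy := ts_acy W.

Lemma src_parallel u : is_src outs ins u ->
  [/\ e u (lo u), e u (ro u), parallel (lo u) (ro u), inL (lo u) & inR (ro u)].
Proof.
move=> su; have nab := src_nle W su.
have := src_nle (ts_mirror W) (u := u); rewrite is_src_mirror fst_rev lst_rev => /(_ su) nba.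
case/and3P: su => ne _ _.
have uout : exists c, e u c.
  case E : (outs u) => [|c l]; first by rewrite /fst_nbr /lst_nbr E eqxx in ne.
  by exists c; rewrite -(ts_outs W) E mem_head.
have [c uc] := uout; have ua := arc_out_lo W uc; have ub := arc_out_ro W uc.
have par : parallel (lo u) (ro u) by rewrite /parallel nab nba.
have bef : before (outs u) (lo u) (ro u).
  by apply: head_before; rewrite 1?eq_sym // (ts_outs W).
case/orP: (parallel_sides W par) => /andP[/andP[aL _] /andP[bR _]] //.
by have := ts_outRL W bef aL bR.
Qed.

(** The sink is a minimal common upper bound of [lo u] and [ro u]. A vertex above [u] is above one
    of these two, and inside the interval none is above both, so the inner vertices split into two
    parts with no arc between left and right. *)
Lemma parallel_good u : e u (lo u) -> e u (ro u) -> parallel (lo u) (ro u) ->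
  inL (lo u) -> inR (ro u) -> exists v, good u v.
Proof.
move=> ua ub par aL bR.
have [v /andP[av bv] vP] := @ex_minimal _ _ acy (fun w => le (lo u) w && le (ro u) w) t
  (introT andP (conj (ts_snk W _) (ts_snk W _))).
have above w : lt u w -> le (lo u) w || le (ro u) w.
  move=> uw; have [c uc cw] := first_step uw; case/orP: (ts_cover W c) => cS.
    by have /andP[_ h] := lo_le W uc cS; rewrite (connect_trans h cw).
  by have /andP[_ h] := ro_le W uc cS; rewrite (connect_trans h cw) orbT.
have not2 w : inside u v w -> le (lo u) w -> le (ro u) w -> False.
  by case/andP=> _ wv h1 h2; have := vP w; rewrite h1 h2 wv => /(_ isT).
case/andP: (par) => nab nba.
have aL' w : inside u v w -> inL w -> le (lo u) w.
  move=> wi wL; have /orP[//|bw] := above w (proj1 (andP wi)).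
  case: (chainL_lt W aL wL) => [/ltcW //|eqw|/ltcW wa]; first by rewrite eqw connect0.
  by rewrite (connect_trans bw wa) in nba.
have bR' w : inside u v w -> inR w -> le (ro u) w.
  move=> wi wL; have /orP[aw|//] := above w (proj1 (andP wi)).
  case: (chainR_lt W bR wL) => [/ltcW //|eqw|/ltcW wa]; first by rewrite eqw connect0.
  by rewrite (connect_trans aw wa) in nab.
exists v; split.
- exists (lo u) => //; rewrite /inside (arc_ltc acy ua) /ltc av andbT.
  by apply: contraNneq nba => ->.
- exists (ro u) => //; rewrite /inside (arc_ltc acy ub) /ltc bv andbT.
  by apply: contraNneq nab => ->.
move=> a b ai aiL bi biR; have h1 := aL' a ai aiL; have h2 := bR' b bi biR; split.
- by move=> eab; apply: (not2 a) => //; rewrite eab.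
- by apply/negP => /connect1 ab; apply: (not2 b bi) => //; apply: connect_trans ab.
- by apply/negP => /connect1 ba; apply: (not2 a ai) => //; apply: connect_trans ba.
Qed.

Lemma src_good u : is_src outs ins u -> exists v, good u v.
Proof. by case/src_parallel=> *; apply: parallel_good. Qed.

(** [v] would be an inner vertex of the interval from [u] to [w] lying above both [lo u] and [ro u],
    against the incomparability of its two sides. *)
Lemma good_no_nest u v w : good u v -> good u w -> lt v w -> False.
Proof.
move=> guv guw vw; have [_ aL ai _ [bR bi]] := good_ends W guv.
have [_ _ ai' _ [_ bi']] := good_ends W guw.
have vi : inside u w v by rewrite /inside vw andbT; case/andP: ai => h /(ltc_trans acy h).
case/orP: (ts_cover W v) => vS.
  have := good_parallel W guw vi vS bi' bR.
  by case/andP: bi => _ /ltcW bv; rewrite /parallel bv andbF.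
have := good_parallel W guw ai' aL vi vS.
by case/andP: ai => _ /ltcW bv; rewrite /parallel bv.
Qed.

(** The arc from [li w] to [w] and the arc from [ri v] to [v] would cross. *)
Lemma good_no_cross u v w : good u v -> good u w -> inL v -> inR w ->
  ~~ inR v -> ~~ inL w -> parallel v w -> False.
Proof.
move=> guv guw vL wR vnR wnL /andP[nvw nwv].
have [a ai aL] := let: And3 h _ _ := guw in h; have [b bi bR] := let: And3 _ h _ := guv in h.
have [cw cL ci _] := good_li W guw ai aL; have [dv dR di _] := good_ri W guv bi bR.
have cv : lt (li w) v.
  by apply: (chainL_ltNge W vL cL); apply: contraNN nvw => h; apply: connect_trans h (connect1 cw).
have dw : lt (ri v) w.
  by apply: (chainR_ltNge W wR dR); apply: contraNN nwv => h; apply: connect_trans h (connect1 dv).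
apply: (ts_cross W cL wR vL dR _ _ cv dw).
- by rewrite /edge cw.
- by rewrite /edge dv orbT.
- apply/eqP => cd; rewrite cd in cL; have := good_parallel W guv di cL di dR.
  by rewrite /parallel connect0.
- by apply: contraNneq nvw => ->; rewrite connect0.
Qed.
End SourceGood.

Section GoodSides.
Variables (V : finType) (e : rel V) (s t : V) (inL inR : pred V) (outs ins : V -> seq V).
Hypothesis W : two_sided e s t inL inR outs ins.
Notation le := (connect e).
Notation lt := (ltc e).
Notation ri := (lst_nbr ins).
Notation inside := (inside e).
Notation good := (good e inL inR).
Notation parallel := (parallel e).
Let acy := ts_acy W.

Lemma good_snk_uniq u v w : good u v -> good u w -> v = w.
Proof.
move=> guv guw; case: (eqVneq v w) => // nvw.
have nlt1 : ~~ le v w.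
  by apply/negP => vw; apply: (good_no_nest W guv guw); rewrite /ltc nvw.
have nlt2 : ~~ le w v.
  by apply/negP => vw; apply: (good_no_nest W guw guv); rewrite /ltc eq_sym nvw.
have par : parallel v w by rewrite /parallel nlt1.
case/orP: (parallel_sides W par) => /andP[/andP[vS nv] /andP[wS nw]].
  by case: (good_no_cross W guv guw).
by case: (good_no_cross (ts_mirror W) (good_mirror guv) (good_mirror guw)).
Qed.

(** An arc from [w] out of the interval conflicts with one of the arcs from [li v] and [ri v] into
    [v]. The left inner vertex [w'] above [w] serves to place [w] strictly below [li v]. *)
Lemma good_closedL u v w w' z : good u v -> inside u v w -> inL w ->
  inside u v w' -> inL w' -> lt w w' -> e w z -> z = v \/ inside u v z && inL z.
Proof.
move=> guv wi wL wi' wL' ww' wz.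
have [b bi bR] := let: And3 _ h _ := guv in h.
have [cv cL ci w'c] := good_li W guv wi' wL'; have [dv dR di _] := good_ri W guv bi bR.
have wc := ltc_le_trans acy ww' w'c; have uw : lt u w by case/andP: wi.
have wv : lt w v by case/andP: wi.
have uz := ltc_trans acy uw (arc_ltc acy wz).
have cv' := arc_ltc acy cv; have dv' := arc_ltc acy dv; have wz' := arc_ltc acy wz.
have wd : ri v != w.
  apply/eqP => eq_wd; have := good_parallel W guv wi wL di dR.
  by rewrite -eq_wd /parallel connect0.
have [zL|znL] := boolP (inL z).
  case: (chainL_lt W zL cL) => [zc|->|cz].
  - by right; rewrite /inside uz (ltc_trans acy zc cv').
  - by right; rewrite ci.
  have [vL|vnL] := boolP (inL v).
    case: (chainL_lt W zL vL) => [zv|->|vz]; [by right; rewrite /inside uz zv|by left|].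
    case: (ts_chordL W wL vL zL dR wz wv vz) => //; first by rewrite /edge dv orbT.
    by apply: contraTneq vz => <-; rewrite ltc_ltF.
  case: (ts_chordL W wL cL zL (notL_R W vnL) wz wc cz); first by rewrite /edge cv.
    by rewrite eq_sym; exact: ltc_neq wv.
  by apply: contraNneq vnL => ->.
have zR := notL_R W znL.
have done z' : z' = z -> inside u v z' -> False.
  move=> -> zi; have := good_parallel W guv wi wL zi zR.
  by rewrite /parallel (connect1 wz).
have [vR|vnR] := boolP (inR v).
  case: (chainR_lt W zR vR) => [zv|->|vz]; [|by left|].
    by case: (done z erefl); rewrite /inside uz zv.
  case: (ts_cross W wL zR cL vR _ _ wc vz).
  - by rewrite /edge wz.
  - by rewrite /edge cv.
  - exact: ltc_neq wv.
  - by apply: contraNneq znL => ->.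
have vL := notR_L W vnR.
case: (chainR_lt W zR dR) => [zd|zd|dz].
- by case: (done z erefl); rewrite /inside uz (ltc_trans acy zd dv').
- by case: (done z erefl); rewrite zd.
- case: (ts_cross W wL zR vL dR _ _ wv dz).
  + by rewrite /edge wz.
  + by rewrite /edge dv orbT.
  + by rewrite eq_sym.
  + by apply: contraNneq znL => ->.
Qed.

Lemma goodL_notR u v w : good u v -> inside u v w -> inL w -> ~~ inR w.
Proof.
move=> guv wi wL; apply/negP => wR; have := good_parallel W guv wi wL wi wR.
by rewrite /parallel connect0.
Qed.

Lemma goodL_chain u v x y : good u v -> inside u v x -> inside u v y -> le x y -> inL x = inL y.
Proof.
move=> guv xi yi xy; apply/idP/idP => h; apply: contraT => /(notL_R W) h'.
  by have := good_parallel W guv xi h yi h'; rewrite /parallel xy.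
by have := good_parallel W guv yi h xi h'; rewrite /parallel xy andbF.
Qed.
End GoodSides.

(** * Incomparable vertices lie inside good intervals *)

Section ParallelCover.
Variables (V : finType) (e : rel V) (s t : V) (inL inR : pred V) (outs ins : V -> seq V).
Hypothesis W : two_sided e s t inL inR outs ins.
Notation le := (connect e).
Notation lt := (ltc e).
Notation lo := (fst_nbr outs).
Notation ro := (lst_nbr outs).
Notation li := (fst_nbr ins).
Notation inside := (inside e).
Notation good := (good e inL inR).
Notation parallel := (parallel e).
Let acy := ts_acy W.

(** If [v] is on the left, the chain decides. If [v] is on the right only and incomparable with [x],
    the arc from [li v] to [v] leaves the left side below [x], which the last hypothesis
    excludes. *)
Lemma inside_above u v x : good u v -> inL x -> le (lo u) x -> ~~ le (ro u) x ->
  (forall c, inR v -> parallel x v -> inL c -> e c v -> lt c x -> lt u c -> False) ->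
  inside u v x.
Proof.
move=> guv xL ax nbx H; have [ua aL ai ub [bR bi]] := good_ends W guv.
rewrite /inside (ltc_le_trans acy (arc_ltc acy ua) ax) /=.
have nvx : ~~ le v x.
  by apply: contraNN nbx => vx; apply: connect_trans vx; case/andP: bi => _ /ltcW.
have nxv : x != v by apply: contraNneq nvx => ->; rewrite connect0.
rewrite /ltc nxv /=; apply: contraT => nle.
have par : parallel x v by rewrite /parallel nle.
have [vL|vnL] := boolP (inL v).
  by have := ts_chainL W xL vL; rewrite (negbTE nle) (negbTE nvx).
have [cv cL ci _] := good_li W guv ai aL.
case: (H (li v) (notL_R W vnL) par cL cv) => //; last by case/andP: ci.
by apply: (chainL_ltNge W xL cL); apply: contraNN nle => h; apply: connect_trans h (connect1 cv).
Qed.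

(** The source is sought below [x]. If arcs lead from left vertices below [x] to vertices
    incomparable with [x], the highest one is taken: first its upper end [y] is maximised, then its
    lower end [u]. If there is none, [u] is the last right vertex below [x]. A link between the
    sides above [u] that made [lo u] and [ro u] comparable, or let [x] escape past the sink, would
    contradict this choice. *)
Lemma parallel_insideL x y : inL x -> parallel x y -> exists u v, good u v /\ inside u v x.
Proof.
move=> xL par.
have parR z : parallel x z -> ~~ inL z /\ inR z.
  case/andP=> n1 n2; have nL : ~~ inL z.
    by apply/negP => zL; have := ts_chainL W xL zL; rewrite (negbTE n1) (negbTE n2).
  by rewrite nL (notL_R W nL).
have xnR : ~~ inR x.
  apply/negP => xR; have := cut_comparable W y xL xR; case/andP: par => n1 n2.
  by rewrite (negbTE n1) (negbTE n2).
pose S y := parallel x y && [exists l, [&& inL l, lt l x & e l y]].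
have [y0 Sy0|noS] := pickP S.
  have [{par}y /andP[par /existsP[l0 Pl0]] yP] := @ex_maximal _ _ acy S y0 Sy0.
  have [u /and3P[uL ux uy] uP] :=
    @ex_maximal _ _ acy (fun l => [&& inL l, lt l x & e l y]) l0 Pl0.
  have [_ yR] := parR _ par; case/andP: par => nxy nyx.
  have ut : u != t by apply: ltc_neq (ltc_le_trans acy ux (ts_snk W _)).
  have [ua aL aP] := lo_next W uL ut; have ax := aP x xL ux.
  have ub := arc_out_ro W uy; have /andP[bR byl] := ro_le W uy yR.
  have uy' := arc_ltc acy uy; have ub' := arc_ltc acy ub; have ua' := arc_ltc acy ua.
  have nxb : ~~ le x (ro u) by apply: contraNN nxy => h; apply: connect_trans h byl.
  (* The arc from [u] to [z] separates the two sides between its ends, so no arc [l -> r] and no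
     common vertex fits strictly between [u] and [z]. *)
  have nospan l r z : inL l -> inR r -> lt u l -> (e l r \/ l = r) -> lt r z -> e u z ->
      inR z -> False.
    move=> lL rR ul lr rz uz zR; case: lr => [lr|elr].
      have lz : lt l z by exact: (ltc_trans acy (arc_ltc acy lr) rz).
      apply: (ts_cross W uL zR lL rR _ _ ul rz).
      - by rewrite /edge uz.
      - by rewrite /edge lr.
      - by apply: ltc_neq (ltc_trans acy ul (arc_ltc acy lr)).
      - by rewrite eq_sym; exact: ltc_neq lz.
    by apply: (ts_cut W lL _ uz ul); rewrite elr.
  have nbx : ~~ le (ro u) x.
    apply/negP => bx; have [r [l [rR lL br lx rl]]] := bridgeR W bR xL bx.
    have ry : lt r y.
      apply: (chainR_ltNge W yR rR); apply: contraNN nyx => yr.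
      by apply: connect_trans yr _; apply: connect_trans lx; case: rl => [/connect1|->].
    have ur := ltc_le_trans acy ub' br.
    case: rl => [rl|erl].
      case: (ts_cross W uL yR lL rR _ _ _ ry).
      - by rewrite /edge uy.
      - by rewrite /edge rl orbT.
      - exact: (ltc_trans acy ur (arc_ltc acy rl)).
      - exact: ltc_neq ur.
      - by apply: contraNneq nyx => ->.
    by apply: (nospan l r y) => //; [rewrite -erl|right].
  have parb : parallel (lo u) (ro u).
    rewrite /parallel andbC; apply/andP; split; apply/negP.
      by move=> h; case/negP: nbx; apply: connect_trans ax.
    move=> ab; have [l [r [lL rR al rb lr]]] := bridge W aL bR ab.
    have lrle : le l r by case: lr => [/connect1|->].
    have ul := ltc_le_trans acy ua' al.
    have lx : lt l x.
      apply: (chainL_ltNge W xL lL); apply: contraNN nxb => h.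
      by apply: connect_trans h (connect_trans lrle rb).
    move: rb; rewrite le_eqVltc => /orP[/eqP erb|rb]; last exact: (nospan l r (ro u)).
    case: lr => [lr|elr]; last first.
      by have := ts_chainL W xL lL; rewrite elr erb (negbTE nxb) (negbTE nbx).
    rewrite erb in lr.
    have parb : parallel x (ro u) by rewrite /parallel nxb.
    move: byl; rewrite le_eqVltc => /orP[/eqP eby|bylt]; last first.
      by apply: (nospan l (ro u) y) => //; left.
    rewrite eby in lr.
    by have := uP l; rewrite lL lx lr ul => /(_ isT).
  have [v guv] := parallel_good W ua ub parb aL bR.
  exists u, v; split=> //; apply: (inside_above guv xL ax nbx) => c vR parv cL cv cx uc.
  have Sv : S v by rewrite /S parv; apply/existsP; exists c; rewrite cL cx cv.
  have vy : le v y.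
    by case: (chainR_lt W yR vR) (yP v Sv) => [->//|->|/ltcW]; rewrite ?connect0.
  move: vy; rewrite le_eqVltc => /orP[/eqP evy|vy].
    by rewrite evy in cv; have := uP c; rewrite cL cx cv uc => /(_ isT).
  by apply: (nospan c v y) => //; left.
have [nxy nyx] := andP par; have [_ yR] := parR _ par.
have sx : lt s x.
  by rewrite /ltc (ts_src W) andbT; apply: contraNneq nxy => <-; exact: ts_src W _.
have [u /andP[uR ux] uP] := @ex_maximal _ _ acy (fun r => inR r && lt r x) s
  (introT andP (conj (ts_sR W) sx)).
have ut : u != t by apply: ltc_neq (ltc_le_trans acy ux (ts_snk W _)).
have [ub bR bP] := ro_next W uR ut.
have ub' := arc_ltc acy ub.
have [c uc cx] := first_step ux.
have cL : inL c.
  apply: contraT => /(notL_R W) cR; have := uP c; rewrite cR (arc_ltc acy uc) /=.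
  move: cx; rewrite le_eqVltc => /orP[/eqP ecx|cx]; first by rewrite -ecx cR in xnR.
  by rewrite cx => /(_ isT).
have ua := arc_out_lo W uc; have /andP[aL ac] := lo_le W uc cL.
have ax := connect_trans ac cx; have ua' := arc_ltc acy ua.
have nbx : ~~ le (ro u) x.
  rewrite le_eqVltc negb_or; apply/andP; split.
    by apply: contraNneq xnR => <-.
  by apply/negP => bx; have := uP (ro u); rewrite bR bx ub' => /(_ isT).
have uy : lt u y.
  by apply: (chainR_ltNge W yR uR); apply: contraNN nyx => h; apply: connect_trans h (ltcW ux).
have by' := bP y yR uy.
have nxb : ~~ le x (ro u) by apply: contraNN nxy => h; apply: connect_trans h by'.
have parb : parallel x (ro u) by rewrite /parallel nxb.
have noSP z l : parallel x z -> inL l -> lt l x -> e l z -> False.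
  move=> pz lL lx lz; have := noS z; rewrite /S pz; case/existsP; exists l.
  by rewrite lL lx lz.
have par' : parallel (lo u) (ro u).
  rewrite /parallel andbC; apply/andP; split; apply/negP.
    by move=> h; case/negP: nbx; apply: connect_trans ax.
  move=> ab; have [l [r [lL rR al rb lr]]] := bridge W aL bR ab.
  have lrle : le l r by case: lr => [/connect1|->].
  have ur := ltc_le_trans acy (ltc_le_trans acy ua' al) lrle.
  have erb : r = ro u by apply: (connect_anti acy) => //; exact: bP.
  case: lr => [lr|elr]; last first.
    by have := ts_chainL W xL lL; rewrite elr erb (negbTE nxb) (negbTE nbx).
  rewrite erb in lr; apply: (noSP (ro u) l) => //.
  by apply: (chainL_ltNge W xL lL); apply: contraNN nxb => h; apply: connect_trans h (connect1 lr).
have [v guv] := parallel_good W ua ub par' aL bR.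
exists u, v; split=> //; apply: (inside_above guv xL ax nbx) => c' vR parv cL' cv cx' _.
exact: (noSP v c').
Qed.
End ParallelCover.

(** * Relative position of good intervals *)

Section SourcesLeftRight.
Variables (V : finType) (e : rel V) (s t : V) (inL inR : pred V) (outs ins : V -> seq V).
Hypothesis W : two_sided e s t inL inR outs ins.
Notation le := (connect e).
Notation lt := (ltc e).
Notation lo := (fst_nbr outs).
Notation ro := (lst_nbr outs).
Notation good := (good e inL inR).
Let acy := ts_acy W.

(** Otherwise the arcs from [u] to [ro u] and from [u'] to [lo u'] cross, unless they end in the
    same vertex. That vertex would be on the left above [u], hence above [lo u], although [ro u] is
    not. *)
Lemma good_src_comparableL u v u' v' : good u v -> good u' v' ->
  inL u -> inR u' -> le u u' || le u' u.
Proof.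
move=> g g' uL uR'; apply: contraT; rewrite negb_or => /andP[nuu' nu'u].
have [ua aL ai ub [bR bi]] := good_ends W g.
have [ua' aL' ai' ub' [bR' bi']] := good_ends W g'.
have /andP[nab nba] := good_par W g.
have u'b : lt u' (ro u).
  by apply: (chainR_ltNge W bR uR'); apply: contraNN nuu' => h; apply: connect_trans (connect1 ub) h.
have ua2 : lt u (lo u').
  by apply: (chainL_ltNge W aL' uL); apply: contraNN nu'u => h; apply: connect_trans (connect1 ua') h.
case: (eqVneq (ro u) (lo u')) => [ebm|nbm]; last first.
  case: (ts_cross W uL bR aL' uR' _ _ ua2 u'b) => //.
  - by rewrite /edge ub.
  - by rewrite /edge ua' orbT.
  - by apply: contraNneq nuu' => ->; rewrite connect0.
have ut : u != t by apply: ltc_neq (ltc_le_trans acy ua2 (ts_snk W _)).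
have [_ _ /(_ _ aL' ua2)] := lo_next W uL ut.
by rewrite -ebm (negbTE nab).
Qed.
End SourcesLeftRight.

Section GoodOrder.
Variables (V : finType) (e : rel V) (s t : V) (inL inR : pred V) (outs ins : V -> seq V).
Hypothesis W : two_sided e s t inL inR outs ins.
Notation le := (connect e).
Notation lt := (ltc e).
Notation inside := (inside e).
Notation good := (good e inL inR).
Notation parallel := (parallel e).
Let acy := ts_acy W.

Lemma parallel_inside x y : parallel x y -> exists u v, good u v /\ inside u v x.
Proof.
move=> par; have /orP[xL|xR] := ts_cover W x; first exact: (parallel_insideL W xL par).
have [u [v [guv xi]]] := parallel_insideL (ts_mirror W) xR par.
by exists u, v; split=> //; exact: good_mirror.
Qed.

Lemma good_src_comparable u v u' v' : good u v -> good u' v' -> le u u' || le u' u.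
Proof.
move=> g g'; case: (boolP (parallel u u')) => [par|]; last first.
  by rewrite /parallel negb_and !negbK.
case/orP: (parallel_sides W par) => /andP[/andP[uS _] /andP[uS' _]].
  exact: (good_src_comparableL W g g').
exact: (good_src_comparableL (ts_mirror W) (good_mirror g) (good_mirror g')).
Qed.

(** Inner vertices comparable with [u'] lie on the same side as [u'], so [lo u'] and [ro u'] would
    share a side of the larger interval. *)
Lemma good_inside_src u v u' v' : good u v -> good u' v' -> inside u v u' -> le v' v -> False.
Proof.
move=> g g' u'i v'v.
have [ua aL ai ub [bR bi]] := good_ends W g'.
have ins' x : inside u' v' x -> inside u v x.
  case/andP=> h1 h2; case/andP: u'i => h3 _.
  by rewrite /inside (ltc_trans acy h3 h1) (ltc_le_trans acy h2 v'v).
have /andP[nab nba] := good_par W g'.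
have h1 := goodL_chain W g u'i (ins' _ ai) (connect1 ua).
have h2 := goodL_chain W g u'i (ins' _ bi) (connect1 ub).
rewrite aL in h1; rewrite h1 in h2.
by have := goodL_notR W g (ins' _ bi) (esym h2); rewrite bR.
Qed.

(** If the sources differ, the upper one is an inner vertex of the larger interval, against
    [good_inside_src]. This makes every good interval maximal. *)
Lemma good_antichain u v u' v' : good u v -> good u' v' -> le u' u -> le v v' -> u = u' /\ v = v'.
Proof.
move=> g g' uu vv; have [_ _ /andP[h1 h2] _ _] := good_ends W g.
have uv := ltc_trans acy h1 h2.
move: uu; rewrite le_eqVltc => /orP[/eqP e1|uu]; last first.
  case: (good_inside_src g' g _ vv).
  by rewrite /inside uu (ltc_le_trans acy uv vv).
by subst u'; split=> //; exact: (good_snk_uniq W g g').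
Qed.

(** [u'] is a left inner vertex of the first interval below the left inner vertex [w], so by
    [good_closedL] its out-neighbour [ro u'] is either [v] or a left inner vertex. The former is
    above [w], the latter is not on the right; both are impossible for a right inner vertex of the
    second interval. *)
Lemma good_disjointL u v u' v' w : good u v -> good u' v' -> lt u u' ->
  inside u v w -> inside u' v' w -> inL w -> False.
Proof.
move=> g g' uu' wi wi' wL.
have [ua aL ai ub [bR bi]] := good_ends W g'.
have u'i : inside u v u'.
  by rewrite /inside uu'; case/andP: wi' => h _; case/andP: wi => _; apply: ltc_trans.
have u'w : lt u' w by case/andP: wi'.
have u'L : inL u' by rewrite (goodL_chain W g u'i wi (ltcW u'w)).
have := good_closedL W g u'i u'L wi wL u'w ub; case=> [ebv|/andP[bi' bL]].
  have := good_parallel W g' wi' wL bi bR.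
  by rewrite ebv /parallel; case/andP: wi => _ /ltcW ->.
by have := goodL_notR W g bi' bL; rewrite bR.
Qed.
End GoodOrder.

Section GoodSinks.
Variables (V : finType) (e : rel V) (s t : V) (inL inR : pred V) (outs ins : V -> seq V).
Hypothesis W : two_sided e s t inL inR outs ins.
Notation le := (connect e).
Notation lt := (ltc e).
Notation lo := (fst_nbr outs).
Notation ro := (lst_nbr outs).
Notation li := (fst_nbr ins).
Notation ri := (lst_nbr ins).
Notation inside := (inside e).
Notation good := (good e inL inR).
Let acy := ts_acy W.

Lemma good_disjoint u v u' v' w : good u v -> good u' v' ->
  inside u v w -> inside u' v' w -> u = u'.
Proof.
move=> g g' wi wi'; apply/eqP; apply: contraT => nuu.
wlog uu' : u v u' v' g g' wi wi' nuu / le u u'.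
  move=> wl; case/orP: (good_src_comparable W g g') => h; first exact: (wl u v u' v').
  by apply: (wl u' v' u v) => //; rewrite eq_sym.
have lt_uu : lt u u' by rewrite /ltc nuu.
case/orP: (ts_cover W w) => wS; first by case: (good_disjointL W g g' lt_uu wi wi' wS).
by case: (good_disjointL (ts_mirror W) (good_mirror g) (good_mirror g') lt_uu wi wi' wS).
Qed.

Definition is_snk (z : V) :=
  [&& li z != ri z, ro (li z) == z & lo (ri z) == z].

Lemma snk_good z : is_snk z -> exists u, good u z.
Proof.
move=> sz; have [u g] := src_good (ts_dual W) sz; exists u.
by have := good_dual g.
Qed.

Lemma good_snk u v : good u v -> is_snk v.
Proof. by move=> /good_dual /(good_src (ts_dual W)). Qed.

(* The test by which the algorithm recognises the last inner vertex on the left side. *)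
Definition left_end (w : V) :=
  [&& li (ro w) == w, ri (ro w) != w & lo (ri (ro w)) == ro w].

Lemma left_end_li u v : good u v -> ro (li v) = v /\ left_end (li v).
Proof.
move=> /good_snk /and3P[n1 /eqP n2 /eqP n3].
by rewrite /left_end n2 n3 !eqxx eq_sym n1.
Qed.

(** If [w] passed the test of [left_end], then [ro w] would be the sink of a good interval with [w]
    inside. Disjointness gives this interval the source [u] and hence the sink [v], but [ro w] is an
    inner vertex. *)
Lemma good_li_max u v w : good u v -> inside u v w -> inL w -> w != li v ->
  [/\ inside u v (lo w), inL (lo w), e w (lo w), lt w (li v) & ~~ left_end w].
Proof.
move=> g wi wL nw; have [cv cL ci wc] := good_li W g wi wL.
have wc' : lt w (li v) by rewrite /ltc nw.
have wt : w != t by apply: ltc_neq (ltc_le_trans acy wc' (ts_snk W _)).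
have [wlo loL loP] := lo_next W wL wt.
have loc := loP _ cL wc'.
have loi : inside u v (lo w).
  case/andP: wi => h1 h2; case/andP: ci => h3 h4.
  by rewrite /inside (ltc_trans acy h1 (arc_ltc acy wlo)) (le_ltc_trans acy loc h4).
split=> //; apply/negP => /and3P[/eqP e1 n2 /eqP e3].
have wz := arc_out_ro W wlo.
case: (good_closedL W g wi wL ci cL wc' wz) => [ezv|/andP[zi zL]].
  by rewrite ezv in e1; rewrite e1 eqxx in nw.
have sz : is_snk (ro w) by rewrite /is_snk e1 e3 !eqxx eq_sym n2.
have [u' g'] := snk_good sz.
have wi' : inside u' (ro w) w.
  have [a ai aL] := let: And3 h _ _ := g' in h.
  by have [_ _] := good_li W g' ai aL; rewrite e1.
have euu := good_disjoint g g' wi wi'; rewrite -euu in g'.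
have := good_snk_uniq W g g' => ev; case/andP: zi => _.
by rewrite -ev (negbTE (ltc_irr e v)).
Qed.
End GoodSinks.

(** * Walking along the sides and merging them *)

Section SideWalk.
Variables (V : finType) (e : rel V) (s t : V) (inL inR : pred V) (outs ins : V -> seq V).
Hypothesis W : two_sided e s t inL inR outs ins.
Notation le := (connect e).
Notation lt := (ltc e).
Notation lo := (fst_nbr outs).
Notation li := (fst_nbr ins).
Notation ri := (lst_nbr ins).
Notation inside := (inside e).
Notation good := (good e inL inR).
Let acy := ts_acy W.

Lemma left_end_iff u v w : good u v -> inside u v w -> inL w ->
  left_end outs ins w = (w == li v).
Proof.
move=> g wi wL; case: eqVneq => [->|nw]; first by case: (left_end_li W g).
by have [_ _ _ _ /negbTE] := good_li_max W g wi wL nw.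
Qed.

(** This is the walk of the program. It misses no left inner vertex because [lo w] is the next
    vertex of the left side after [w]. *)
Lemma left_chain u v : good u v ->
  exists p, [/\ fpath lo (lo u) p, last (lo u) p = li v, path e (lo u) p
    & forall w, (w \in lo u :: p) = inside u v w && inL w].
Proof.
move=> g; have [ua aL ai _ _] := good_ends W g.
suff H k w : #|[pred x | lt w x]| < k -> inside u v w -> inL w ->
    exists p, [/\ fpath lo w p, last w p = li v, path e w p
      & forall x, (x \in w :: p) = [&& inside u v x, inL x & le w x]].
  have [p [h1 h2 h3 h4]] := H _ _ (ltnSn _) ai aL; exists p; split=> // w.
  rewrite h4; case: (boolP (inside u v w)) => //= wi.
  by case: (boolP (inL w)) => //= wL; have [_ _ _ ->] := good_lo W g wi wL.
elim: k w => // k IH w wk wi wL; have [cv cL ci wc] := good_li W g wi wL.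
have [ew|nw] := eqVneq w (li v).
  exists [::]; split=> // x; rewrite inE ew; apply/eqP/and3P => [->|[xi xL cx]].
    by rewrite connect0.
  by apply/esym/(connect_anti acy) => //; have [_ _ _] := good_li W g xi xL.
have [loi loL wlo wc' _] := good_li_max W g wi wL nw.
have wlo' := arc_ltc acy wlo.
have [||//|p [h1 h2 h3 h4]] := IH (lo w).
- rewrite -ltnS (leq_trans _ wk) // ltnS; apply: proper_card; apply/properP; split.
    by apply/fintype.subsetP => x; rewrite !inE; apply: ltc_trans.
  by exists (lo w); rewrite !inE ?wlo' // ltc_irr.
- by [].
exists (lo w :: p); split=> //=; rewrite ?eqxx ?wlo // => x.
rewrite inE h4; case: (eqVneq x w) => [->|nx]; first by rewrite wi wL connect0.
rewrite orFb; case: (inside u v x) => //=; case: (boolP (inL x)) => //= xL.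
have wt : w != t by apply: ltc_neq (ltc_le_trans acy wc' (ts_snk W _)).
have [_ _ loP] := lo_next W wL wt.
apply/idP/idP => [|wx]; first exact: connect_trans (ltcW wlo').
by apply: loP => //; rewrite /ltc eq_sym nx.
Qed.

(* The vertices are treated in a linear extension of reachability, obtained by
   merging the two sides: [x] and [y] are the next vertices of the left and of the
   right side, and [x] is ready when its last in-neighbour has been treated. *)
Definition merge_inv (x y : V) (Q : seq V) : Prop :=
  [/\ inL x /\ inR y, uniq Q /\ t \notin Q,
      forall w, inL w -> (w \in Q) = lt w x,
      forall w, inR w -> (w \in Q) = lt w y &
      (forall a w, a \in Q -> e w a -> w \in Q) /\ pairwise (fun a b => ~~ le b a) Q].

Definition merge_pick (x y : V) (Q : seq V) : V :=
  if x == y then x else if ri x \in Q then x else y.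

Lemma merge_init : merge_inv s s [::].
Proof.
split=> //; first by split; [apply: ts_sL W|apply: ts_sR W].
- by move=> w _; rewrite in_nil; apply/esym/negbTE/negP => ws; have := ts_src W w; rewrite ltc_leF.
- by move=> w _; rewrite in_nil; apply/esym/negbTE/negP => ws; have := ts_src W w; rewrite ltc_leF.
Qed.

Lemma down_closed (Q : seq V) w a : (forall a w, a \in Q -> e w a -> w \in Q) ->
  le w a -> a \in Q -> w \in Q.
Proof.
move=> H /connectP[p]; elim: p w => [|c p IH] w /=; first by move=> _ ->.
by case/andP=> wc cp la aQ; apply: (H c) => //; apply: IH.
Qed.

Lemma next_lt x w : inL x -> x != t -> inL w -> lt w (lo x) = (w == x) || lt w x.
Proof.
move=> xL xt wL; have [xlo _ loP] := lo_next W xL xt; have xlo' := arc_ltc acy xlo.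
apply/idP/orP => [wlo|[/eqP -> //|wx]]; last exact: (ltc_trans acy wx).
case: (chainL_lt W wL xL) => [wx|->|xw]; [by right|by left|].
by have := loP _ wL xw; rewrite ltc_leF.
Qed.

(** Testing [ri x] is enough: left in-neighbours of [x] are below [x] and thus treated, and if there
    are right ones, [ri x] is the highest of them. If [ri x] has not been treated, it is a right
    vertex at or above [y]; so [y] is below [x], and all in-neighbours of [y] have been treated. *)
Lemma merge_in x y Q : merge_inv x y Q -> let w := merge_pick x y Q in
  w \notin Q /\ forall c, e c w -> c \in Q.
Proof.
case=> [[xL yR] [UQ tQ] QL QR [dc pw]] /=; rewrite /merge_pick.
have xQ : x \notin Q by rewrite QL // ltc_irr.
have yQ : y \notin Q by rewrite QR // ltc_irr.
case: (eqVneq x y) => [exy|nxy].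
  split=> // c /(arc_ltc acy) cx.
  by case/orP: (ts_cover W c) => cS; [rewrite QL|rewrite QR // -exy].
case: ifP => [rx|nrx].
  split=> // c cx; case/orP: (ts_cover W c) => cS.
    by rewrite QL // arc_ltc.
  have /andP[rR cr] := ri_ge W cx cS; rewrite QR // in rx; rewrite QR //.
  exact: (le_ltc_trans acy cr).
have sx : lt s x.
  rewrite /ltc (ts_src W) andbT; apply: contraNneq nxy => es.
  rewrite -es in xQ *; case: (chainR_lt W (ts_sR W) yR) => [sy|->//|ys].
    by move: xQ; rewrite QR ?sy //; apply: ts_sR W.
  by have := ts_src W y; rewrite ltc_leF.
have [c0 c0x _] := last_step sx.
have rx := arc_in_ri W c0x; have rx' := arc_ltc acy rx.
have rR : inR (ri x).
  by apply: (notL_R W); apply/negP => rL; rewrite QL // rx' in nrx.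
have yx : lt y x.
  apply: (le_ltc_trans acy _ rx'); rewrite QR // in nrx.
  by case: (chainR_lt W rR yR) => [ry|->|/ltcW //]; [rewrite ry in nrx|rewrite connect0].
split=> // c cy; case/orP: (ts_cover W c) => cS; last by rewrite QR // arc_ltc.
by rewrite QL // (ltc_trans acy (arc_ltc acy cy)).
Qed.

(** Every other vertex is at or below an in-neighbour of [t], and the treated vertices are closed
    downwards. *)
Lemma merge_last x y Q : merge_inv x y Q -> merge_pick x y Q = t ->
  (size Q).+1 = #|V|.
Proof.
move=> I ew; have [wQ win] := merge_in I; case: I => [_ [UQ tQ] _ _ [dc pw]].
have U : uniq (rcons Q t) by rewrite rcons_uniq tQ.
rewrite -(size_rcons Q t) -(card_uniqP U); apply: eq_card => v; rewrite inE.
rewrite mem_rcons inE; case: (eqVneq v t) => //= nvt.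
have [c ct vc] : exists2 c, e c t & le v c by apply: last_step; rewrite /ltc nvt (ts_snk W).
by apply: (down_closed dc vc); apply: win; rewrite ew.
Qed.

(** A vertex chosen while [x] and [y] differ is on one side only, for otherwise the pointer of the
    other side would be below it and yet untreated. So it is right to advance a single pointer. *)
Lemma merge_pick_cases x y Q : merge_inv x y Q -> x != y ->
  if ri x \in Q then ~~ inR x else ~~ inL y.
Proof.
move=> I nxy; have [] := merge_in I; rewrite /merge_pick (negbTE nxy).
case: I => [[xL yR] [UQ tQ] QL QR [dc pw]].
have xQ : x \notin Q by rewrite QL // ltc_irr.
have yQ : y \notin Q by rewrite QR // ltc_irr.
case: ifP => [rx|nrx] wQ win; apply/negP => wS.
  have yx : lt y x.
    by case: (chainR_lt W yR wS) => // [eyx|xy]; [rewrite eyx eqxx in nxy|move: xQ; rewrite QR ?xy].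
  have [c cx yc] := last_step yx.
  have cQ := win c cx.
  by have := down_closed dc yc cQ; rewrite (negbTE yQ).
have xy : lt x y.
  by case: (chainL_lt W xL wS) => // [exy|yx]; [rewrite exy eqxx in nxy|move: yQ; rewrite QL ?yx].
have [c cy xc] := last_step xy.
by have := down_closed dc xc (win c cy); rewrite (negbTE xQ).
Qed.
End SideWalk.

Section MergeStep.
Variables (V : finType) (e : rel V) (s t : V) (inL inR : pred V) (outs ins : V -> seq V).
Hypothesis W : two_sided e s t inL inR outs ins.
Notation le := (connect e).
Notation lo := (fst_nbr outs).
Notation ro := (lst_nbr outs).
Notation ri := (lst_nbr ins).
Let acy := ts_acy W.

Lemma merge_step x y Q : merge_inv e t inL inR x y Q ->
  let w := merge_pick ins x y Q in w != t ->
  merge_inv e t inL inR (if (x == y) || (ri x \in Q) then lo x else x)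
     (if (x == y) || (ri x \notin Q) then ro y else y) (rcons Q w).
Proof.
move=> I w wt; have [wQ win] := merge_in W I; have pc := merge_pick_cases W I.
case: I => [[xL yR] [UQ tQ] QL QR [dc pw]].
have next_ltR := next_lt (ts_mirror W).
have dc' : forall a v, a \in rcons Q w -> e v a -> v \in rcons Q w.
  move=> a v; rewrite !mem_rcons !inE => /orP[/eqP ->|aQ] va; first by rewrite win ?orbT.
  by rewrite (dc a v) ?orbT.
have pw' : pairwise (fun a b => ~~ le b a) (rcons Q w).
  rewrite pairwise_rcons pw andbT; apply/allP => a aQ; apply: contraNN wQ => wa.
  exact: (down_closed dc wa).
have tQ' : t \notin rcons Q w by rewrite mem_rcons inE negb_or eq_sym wt.
have UQ' : uniq (rcons Q w) by rewrite rcons_uniq wQ.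
rewrite /w /merge_pick in wt dc' pw' tQ' UQ' *.
case: (eqVneq x y) => [exy|nxy] /= in wt dc' pw' tQ' UQ' *.
  have yt : y != t by rewrite -exy.
  have [_ lL _] := lo_next W xL wt; have [_ rR _] := ro_next W yR yt.
  split=> // v vS; rewrite mem_rcons inE.
    by rewrite QL // (next_lt W).
  by rewrite QR // exy -(next_ltR y v) // fst_rev.
have {}pc := pc nxy.
case: (boolP (ri x \in Q)) => /= rx in wt dc' pw' tQ' UQ' pc *.
  have [_ lL _] := lo_next W xL wt.
  split=> // v vS; rewrite mem_rcons inE; first by rewrite QL // (next_lt W).
  by rewrite QR //; case: eqVneq => // evx; rewrite evx (negbTE pc) in vS.
have [_ rR _] := ro_next W yR wt.
split=> // v vS; rewrite mem_rcons inE.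
  by rewrite QL //; case: eqVneq => // evx; rewrite evx (negbTE pc) in vS.
by rewrite QR // -(next_ltR y v) // fst_rev.
Qed.
End MergeStep.

(** * Counting the arcs *)

Section LeftCharges.
Variables (V : finType) (e : rel V) (s t : V) (inL inR : pred V) (outs ins : V -> seq V).
Hypothesis W : two_sided e s t inL inR outs ins.
Notation lt := (ltc e).
Let acy := ts_acy W.

(* An out-neighbour [a] of [u] with a left vertex after it among the out-neighbours
   is charged by no other vertex, and all but two out-neighbours are charged on one
   of the two sides; hence there are at most [4 * #|V|] arcs. *)
Definition chargedL u a := [exists z, before (outs u) a z && inL z].
Definition chargedR u a := [exists z, before (outs u) z a && inR z].

(** Two vertices that charge [a] both have arcs to [a] and to a higher left vertex; wherever the two
    vertices lie, two of these four arcs conflict. *)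
Lemma chargedL_uniq u u' a : chargedL u a -> chargedL u' a -> u = u'.
Proof.
move=> h h'; apply/eqP; apply: contraT => nuu.
have H v : chargedL v a -> exists z, [/\ e v a, e v z, inL a, inL z & lt a z].
  case/existsP=> z /andP[b zL]; exists z; have [av zv naz] := before_mem b.
  have aL : inL a by apply: (notR_L W); apply/negP => aR; exact: (ts_outRL W b aR zL).
  by rewrite -!(ts_outs W); split=> //; rewrite /ltc naz (ts_outLL W b).
have [z [ua uz aL zL az]] := H _ h; have [z' [ua' uz' _ zL' az']] := H _ h'.
have ua2 := arc_ltc acy ua; have ua2' := arc_ltc acy ua'.
wlog wl : u u' z z' nuu h h' ua uz zL az ua' uz' zL' az' ua2 ua2' /
    inL u' && (inL u ==> lt u u') || ~~ inL u && ~~ inL u' && lt u u'.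
  move=> wl; have [uL|unL] := boolP (inL u); have [uL'|unL'] := boolP (inL u').
  - case: (chainL_lt W uL uL') => [uu|euu|uu].
    + by apply: (wl u u' z z') => //; rewrite uL' uu implybT.
    + by rewrite euu eqxx in nuu.
    + by apply: (wl u' u z' z) => //; rewrite 1?eq_sym // uL uu implybT.
  - by apply: (wl u' u z' z) => //; rewrite 1?eq_sym // uL (negbTE unL').
  - by apply: (wl u u' z z') => //; rewrite uL' (negbTE unL).
  - case: (chainR_lt W (notL_R W unL) (notL_R W unL')) => [uu|euu|uu].
    + by apply: (wl u u' z z') => //; rewrite unL unL' uu orbT.
    + by rewrite euu eqxx in nuu.
    + by apply: (wl u' u z' z) => //; rewrite 1?eq_sym // unL unL' uu orbT.
(* For two left vertices the arcs [u -> a] and [u' -> z'] interlock on the left side. If only [u']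
   is on the left, its arc to [z'] passes outside [a], which is joined to the right vertex [u]. If
   neither is on the left, [u' -> a] and [u -> z] cross. *)
case/orP: wl => [/andP[uL' uu]|/andP[/andP[unL unL'] uu]].
  have [uL|unL] := boolP (inL u).
    rewrite uL in uu.
    by case: (ts_nestL W uL uL' aL zL' ua uz' uu ua2' az').
  case: (ts_chordL W uL' aL zL' (notL_R W unL) uz' ua2' az') => //.
    by rewrite /edge ua orbT.
  by apply: ltc_neq (ltc_trans acy ua2 az').
case: (ts_cross W aL (notL_R W unL') zL (notL_R W unL) _ _ az uu).
- by rewrite /edge ua' orbT.
- by rewrite /edge uz orbT.
- by rewrite eq_sym; exact: (ltc_neq ua2).
- by apply: ltc_neq (ltc_trans acy ua2' az).
Qed.
End LeftCharges.

Lemma uniq_pairwise_before (T : eqType) (l : seq T) : uniq l -> pairwise (before l) l.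
Proof.
move=> U; case: l U => // x0 l U; apply/(pairwiseP x0) => i j; rewrite !inE => il jl ij.
by rewrite /before mem_nth // !index_uniq.
Qed.

Section ArcCount.
Variables (V : finType) (e : rel V) (s t : V) (inL inR : pred V) (outs ins : V -> seq V).
Hypothesis W : two_sided e s t inL inR outs ins.

Lemma chargedR_uniq u u' a : chargedR inR outs u a -> chargedR inR outs u' a -> u = u'.
Proof.
have H v : chargedR inR outs v a -> chargedL inR (fun v => rev (outs v)) v a.
  case/existsP=> z /andP[b zR]; apply/existsP; exists z; rewrite zR andbT.
  by apply: before_rev; rewrite ?rev_uniq ?(ts_outs_uniq W) // revK.
by move=> /H h /H; exact: (chargedL_uniq (ts_mirror W) h).
Qed.

(** Of three uncharged out-neighbours, consider the middle one: on the left it makes the first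
    charged, on the right the last. *)
Lemma size_outs u : size (outs u) <=
  count (chargedL inL outs u) (outs u) + count (chargedR inR outs u) (outs u) + 2.
Proof.
rewrite -count_predUI; set P := predU _ _.
rewrite -(count_predC P (outs u)) -addnA leq_add2l; apply: leq_trans (leq_addl _ _).
pose l := seq.filter (predC P) (outs u).
rewrite -size_filter -/l.
have pl : pairwise (before (outs u)) l.
  exact: subseq_pairwise (filter_subseq _ _) (uniq_pairwise_before (ts_outs_uniq W u)).
have al : all (predC P) l by apply: filter_all.
case: l pl al => [|x [|y [|z l]]] //=.
case/and3P=> /andP[xy _] /andP[yz _] _.
rewrite /P /= !negb_or -!andbA => /and5P[nx _ _ _ /andP[_ /andP[nz _]]].
case/orP: (ts_cover W y) => yS.
  by case/existsP: nx; exists y; rewrite xy yS.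
by case/existsP: nz; exists y; rewrite yz yS.
Qed.

Lemma sum_count_uniq (ch : V -> pred V) : (forall u u' a, ch u a -> ch u' a -> u = u') ->
  \sum_(u : V) count (ch u) (outs u) <= #|V|.
Proof.
move=> H; have E u : count (ch u) (outs u) <= \sum_(a : V) (ch u a : nat).
  rewrite -size_filter -(card_uniqP (filter_uniq _ (ts_outs_uniq W u))) -sum1_card.
  rewrite [X in _ <= X]big_mkcond [X in X <= _]big_mkcond; apply: leq_sum => a _ /=.
  by rewrite mem_filter; case: (ch u a); case: (_ \in _).
apply: leq_trans (leq_sum _ (fun u _ => E u)) _.
rewrite exchange_big /= -sum1_card; apply: leq_sum => a _.
case: (pickP (fun u => ch u a)) => [u0 h0|h0]; last by rewrite big1 // => u _; rewrite h0.
rewrite (bigD1 u0) //= h0 big1 ?addn0 // => u nu.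
by case: (boolP (ch u a)) => // h; rewrite (H _ _ _ h h0) eqxx in nu.
Qed.

(** The bound is [n + n + 2 n]: each vertex is charged at most once for the left and once for the
    right side, and at most two out-neighbours of each vertex are uncharged. *)
Lemma sum_outs : \sum_(u : V) size (outs u) <= 4 * #|V|.
Proof.
apply: leq_trans (leq_sum _ (fun u _ => size_outs u)) _.
rewrite !big_split /= sum_nat_const -addnA (_ : 4 * #|V| = #|V| + (#|V| + #|V| * 2)).
  by rewrite !leq_add // sum_count_uniq //; [exact: chargedL_uniq W|exact: chargedR_uniq].
by rewrite mulnC addnA addnn -muln2 -mulnDr.
Qed.
End ArcCount.

Lemma sum_ins (V : finType) (e : rel V) s t (inL inR : pred V) outs ins :
  two_sided e s t inL inR outs ins -> \sum_(u : V) size (ins u) <= 4 * #|V|.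
Proof. by move=> W; exact: sum_outs (ts_dual W). Qed.

(** * Sides as vertex lists *)

Section PolySides.
Variables (V : finType) (e : rel V) (s t : V) (inL inR : pred V) (outs ins : V -> seq V).
Hypothesis W : two_sided e s t inL inR outs ins.
Let acy := ts_acy W.

Definition poly_sides u v (l r : seq V) : Prop :=
  [/\ good e inL inR u v, path e u (rcons l v), path e u (rcons r v),
      forall w, (w \in l) = inside e u v w && inL w & forall w, (w \in r) = inside e u v w && inR w].

Lemma path_uniq x p : path e x p -> uniq (x :: p).
Proof.
move=> xp; apply: (sorted_uniq (leT := ltc e)).
- by move=> a b c; apply: ltc_trans.
- by move=> a; apply/negbTE/ltc_irr.
- by apply: sub_path xp => a b; apply: arc_ltc.
Qed.

(** A directed path of an acyclic digraph lists its vertices in strictly increasing order. Hence the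
    sides written by the program can be identified with those of the drawing by comparing
    members. *)
Lemma path_eq_mem x y p q : path e x p -> path e y q -> p =i q -> p = q.
Proof.
move=> xp yq; apply: (irr_sorted_eq (leT := ltc e)).
- by move=> a b c; apply: ltc_trans.
- by move=> a; apply/negbTE/ltc_irr.
- apply: (path_sorted (x := x)); apply: sub_path xp => a b; exact: arc_ltc.
- apply: (path_sorted (x := y)); apply: sub_path yq => a b; exact: arc_ltc.
Qed.
End PolySides.

(** * The program and its running time *)

(** Total correctness within a time bound. As [N] is only an upper bound, branches of different cost
    can share it. *)
Definition runs (c : com) (st : state) (N : nat) (Q : state -> Prop) : Prop :=
  exists k st', [/\ exec c st k st', k <= N & Q st'].

Lemma runs_le c st N N' (Q Q' : state -> Prop) :
  runs c st N Q -> N <= N' -> (forall st', Q st' -> Q' st') -> runs c st N' Q'.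
Proof. by case=> k [st' [ex kN Qst]] NN QQ; exists k, st'; split; [|lia|exact: QQ]. Qed.

Lemma runs_skip st (Q : state -> Prop) : Q st -> runs CSkip st 1 Q.
Proof. by move=> Qst; exists 1, st; split=> //; exact: exec_skip. Qed.

Lemma runs_assign st r e (Q : state -> Prop) :
  Q (set_reg st r (aeval st e)) -> runs (CAssign r e) st (acost e).+1 Q.
Proof. by move=> H; eexists _, _; split; [exact: exec_assign| |exact: H]. Qed.

Lemma runs_store st a e1 e2 (Q : state -> Prop) :
  Q (set_arr st a (aeval st e1) (aeval st e2)) ->
  runs (CStore a e1 e2) st (acost e1 + acost e2).+1 Q.
Proof. by move=> H; eexists _, _; split; [exact: exec_store| |exact: H]. Qed.

Lemma runs_write st e (Q : state -> Prop) :
  Q (add_out st (aeval st e)) -> runs (CWrite e) st (acost e).+1 Q.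
Proof. by move=> H; eexists _, _; split; [exact: exec_write| |exact: H]. Qed.

Lemma runs_seq c1 c2 st N1 N2 (Q : state -> Prop) :
  runs c1 st N1 (fun st1 => runs c2 st1 N2 Q) -> runs (CSeq c1 c2) st (N1 + N2).+1 Q.
Proof.
case=> k1 [st1 [ex1 h1 [k2 [st2 [ex2 h2 Qst]]]]].
by exists (k1 + k2).+1, st2; split=> //; [exact: exec_seq ex1 ex2|lia].
Qed.

Lemma runs_if_true e c1 c2 st N (Q : state -> Prop) :
  aeval st e != 0 -> runs c1 st N Q -> runs (CIf e c1 c2) st (acost e + N).+1 Q.
Proof.
move=> eT [k [st' [ex h Qst]]]; exists (acost e + k).+1, st'; split=> //; last by lia.
exact: exec_if_true.
Qed.

Lemma runs_if_false e c1 c2 st N (Q : state -> Prop) :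
  aeval st e = 0 -> runs c2 st N Q -> runs (CIf e c1 c2) st (acost e + N).+1 Q.
Proof.
move=> eT [k [st' [ex h Qst]]]; exists (acost e + k).+1, st'; split=> //; last by lia.
exact: exec_if_false.
Qed.

(* In [I i b], [i] bounds the number of remaining turns and [b] the total cost of their bodies. *)
Lemma runs_while e c (I : nat -> nat -> state -> Prop) :
  (forall i b st, I i.+1 b st -> aeval st e != 0 /\
     exists B b', B + b' <= b /\ runs c st B (I i b')) ->
  (forall b st, I 0 b st -> aeval st e = 0) ->
  forall i b st, I i b st ->
  runs (CWhile e c) st ((acost e).+1 * i.+1 + b) (fun st' => exists b', I 0 b' st').
Proof.
move=> HS H0; elim=> [|i IH] b st Ist.
  exists (acost e).+1, st; split; [|lia|by exists b].
  exact: exec_while_false (H0 _ _ Ist).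
have [eT [B [b' [hb [k1 [st1 [ex1 h1 I1]]]]]]] := HS _ _ _ Ist.
have [k2 [st2 [ex2 h2 I2]]] := IH _ _ I1.
exists (acost e + k1 + k2).+1, st2; split=> //; first exact: exec_while_true ex1 ex2.
rewrite mulnS in h2; rewrite !mulnS; lia.
Qed.

Definition ANot (e : aexp) := AEq e (ALit 0).
(* A conjunction only if the value of [e1] is 0 or 1. *)
Definition AAnd (e1 e2 : aexp) := ASub e1 (ANot e2).

Lemma aeval_not st e : aeval st (ANot e) = (aeval st e == 0).
Proof. by []. Qed.

Lemma aeval_and st e1 e2 (b1 b2 : bool) :
  aeval st e1 = b1 -> aeval st e2 = b2 -> aeval st (AAnd e1 e2) = b1 && b2.
Proof. by move=> /= -> ->; case: b1 b2 => [] []. Qed.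

(* Arrays: [a_w] is the input word, [a_lo], [a_ro], [a_li], [a_ri] the first and last
   out- and in-neighbours, [a_em] the vertices already treated, [a_mk] the vertices,
   other than the source, of the polygons already written. *)
Definition r_n := 0. Definition r_p := 1. Definition r_v := 2. Definition r_k := 3.
Definition r_j := 4. Definition r_x := 5. Definition r_y := 6. Definition r_cnt := 7.
Definition r_u := 8. Definition r_q := 9. Definition r_z := 10. Definition r_c := 11.
Definition r_m := 13. Definition r_a := 14.
Definition a_w := 0. Definition a_lo := 1. Definition a_ro := 2. Definition a_li := 3.
Definition a_ri := 4. Definition a_em := 5. Definition a_mk := 6.

(** * The text of the program *)

Definition incr r := CAssign r (ASucc (AReg r)).
Definition cseq := foldr CSeq CSkip.

Definition parse_list fa la : com := cseq
  [:: CAssign r_k (AGet a_w (AReg r_p)); incr r_p; CAssign r_j (ALit 0);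
      CWhile (ALt (AReg r_j) (AReg r_k)) (cseq
        [:: CIf (AReg r_j) CSkip (CStore fa (AReg r_v) (AGet a_w (AReg r_p)));
            CStore la (AReg r_v) (AGet a_w (AReg r_p)); incr r_p; incr r_j])].

(** After the second list [r_k] still holds the in-degree, which is 0 only at the source; so [r_x]
    ends with the vertex where the merge starts. *)
Definition parse : com := cseq
  [:: CAssign r_n (AGet a_w (ALit 0)); CAssign r_p (ALit 1); CAssign r_v (ALit 0);
      CWhile (ALt (AReg r_v) (AReg r_n)) (cseq
        [:: parse_list a_lo a_ro; parse_list a_li a_ri;
            CIf (AReg r_k) CSkip (CAssign r_x (AReg r_v)); incr r_v])].

(** The length precedes the vertices in the output, so the side is walked twice, to count and to
    write. The count starts at 3 for the source, the sink and the last inner vertex [r_c], at which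
    the loops stop. *)
Definition side nx : com := cseq
  [:: CAssign r_m (ALit 3); CAssign r_q (AReg r_a);
      CWhile (ANot (AEq (AReg r_q) (AReg r_c)))
        (cseq [:: CAssign r_q (AGet nx (AReg r_q)); incr r_m]);
      CWrite (AReg r_m); CWrite (AReg r_u); CAssign r_q (AReg r_a);
      CWhile (ANot (AEq (AReg r_q) (AReg r_c)))
        (cseq [:: CWrite (AReg r_q); CStore a_mk (AReg r_q) (ALit 1);
                  CAssign r_q (AGet nx (AReg r_q))]);
      CWrite (AReg r_c); CStore a_mk (AReg r_c) (ALit 1);
      CWrite (AReg r_z); CStore a_mk (AReg r_z) (ALit 1)].

Definition a_end : aexp :=
  let z := AGet a_ro (AReg r_q) in
  AAnd (AEq (AGet a_li z) (AReg r_q))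
    (AAnd (ANot (AEq (AGet a_ri z) (AReg r_q))) (AEq (AGet a_lo (AGet a_ri z)) z)).

Definition a_src : aexp :=
  AAnd (ANot (AEq (AGet a_lo (AReg r_u)) (AGet a_ro (AReg r_u))))
    (AAnd (AEq (AGet a_ri (AGet a_lo (AReg r_u))) (AReg r_u))
          (AEq (AGet a_li (AGet a_ro (AReg r_u))) (AReg r_u))).

(** The sink is not known in advance: it is read off as the last out-neighbour of the vertex at
    which [a_end] stops the walk on the left side, and it then yields the end of the right side. *)
Definition polygon : com := cseq
  [:: CAssign r_a (AGet a_lo (AReg r_u)); CAssign r_q (AReg r_a);
      CWhile (ANot a_end) (CAssign r_q (AGet a_lo (AReg r_q)));
      CAssign r_c (AReg r_q); CAssign r_z (AGet a_ro (AReg r_q)); CWrite (ALit 1);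
      side a_lo;
      CAssign r_c (AGet a_ri (AReg r_z)); CAssign r_a (AGet a_ro (AReg r_u));
      side a_ro].

Definition treat : com :=
  CIf a_src polygon
    (CIf (AGet a_mk (AReg r_u)) CSkip (CSeq (CWrite (ALit 0)) (CWrite (AReg r_u)))).

Definition pick : com :=
  CIf (AEq (AReg r_x) (AReg r_y))
    (cseq [:: CAssign r_u (AReg r_x); CAssign r_x (AGet a_lo (AReg r_x));
              CAssign r_y (AGet a_ro (AReg r_y))])
    (CIf (AGet a_em (AGet a_ri (AReg r_x)))
      (cseq [:: CAssign r_u (AReg r_x); CAssign r_x (AGet a_lo (AReg r_x))])
      (cseq [:: CAssign r_u (AReg r_y); CAssign r_y (AGet a_ro (AReg r_y))])).

Definition decompose : com := cseq
  [:: CAssign r_y (AReg r_x); CAssign r_cnt (ALit 0);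
      CWhile (ALt (AReg r_cnt) (AReg r_n)) (cseq
        [:: pick; CStore a_em (AReg r_u) (ALit 1); incr r_cnt; treat])].

Definition program : com := CSeq parse decompose.

(** * Correctness and running time of the subroutines *)

Ltac step :=
  match goal with
  | |- runs (incr _) _ _ _ => unfold incr
  | |- runs (CSeq _ _) _ _ _ => eapply runs_seq
  | |- runs (CAssign _ _) _ _ _ => eapply runs_assign
  | |- runs (CStore _ _ _) _ _ _ => eapply runs_store
  | |- runs (CWrite _) _ _ _ => eapply runs_write
  | |- runs CSkip _ _ _ => eapply runs_skip
  end.
Ltac steps := cbn [cseq foldr incr]; repeat (step; cbv beta).

(** [uniq] guarantees that the walk meets [r_c] only at its end, so neither loop stops early;
    [nx != a_mk] keeps the marks from changing the walk. *)
Lemma run_side nx st (ps : seq nat) : nx != a_mk ->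
  path (frel (arr st nx)) (reg st r_a) ps -> last (reg st r_a) ps = reg st r_c ->
  uniq (reg st r_a :: ps) ->
  runs (side nx) st (100 * (size ps).+1) (fun st' =>
    let l := reg st r_u :: rcons (reg st r_a :: ps) (reg st r_z) in
    [/\ out st' = out st ++ (size l :: l),
        forall r, r != r_q -> r != r_m -> reg st' r = reg st r,
        forall a i, a != a_mk -> arr st' a i = arr st a i &
        forall i, arr st' a_mk i =
          if (i \in reg st r_a :: ps) || (i == reg st r_z) then 1 else arr st a_mk i]).
Proof.
move=> nxmk pth lst U.
(* The step count stays existential while the commands are run; the shelved goal, that it is within
   the stated bound, is left to arithmetic at the end. The same scheme recurs below. *)
eapply runs_le; [|shelve|move=> st' H; exact: H].
rewrite /side; steps.
pose I1 (i b : nat) (st1 : state) := exists ps1 ps2, [/\ ps = ps1 ++ ps2,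
  size ps2 = i, b = 40 * i /\ reg st1 r_q = last (reg st r_a) ps1,
  reg st1 r_m = 3 + size ps1 /\ out st1 = out st &
  (forall r, r != r_q -> r != r_m -> reg st1 r = reg st r) /\ arr st1 = arr st].
eapply runs_le; first eapply (@runs_while _ _ I1).
- move=> i b st1 [ps1 [[|x ps2] [eps //= [es] [-> eq] [em eo] [er ea]]]].
  split.
    have := U; rewrite eps -cat_cons cat_uniq => /and3P[_ /hasPn H _].
    have := H (last x ps2) (mem_last _ _); move=> /=; rewrite eq er // -lst eps last_cat /=.
    by move=> h; case: (eqVneq (last _ ps1) (last x _)) h => [<-|]; rewrite ?mem_last.
  exists 40, (40 * i); split; first by lia.
  eapply runs_le; [steps|by []|move=> st' H; exact: H].
  have := pth; rewrite eps cat_path /= => /and3P[_ /eqP ex _].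
  exists (rcons ps1 x), ps2; split=> //=; rewrite ?cat_rcons ?last_rcons ?size_rcons ?em ?eq ?ea //.
  by split=> // r /negbTE r1 /negbTE r2; rewrite r1 r2 er ?r1 ?r2.
- move=> b st1 [ps1 [[|x ps2] [eps //= _ [_ eq] [em eo] [er ea]]]].
  by rewrite eq er // -lst eps cats0 eqxx.
- exists [::], ps; split=> //=.
  by split=> // r /negbTE r1 /negbTE r2; rewrite r1 r2.
- exact: leqnn.
move=> st1 [b0 [ps1 [[|? ?] [eps //= _ [_ _] [em eo] [er ea]]]]]; rewrite cats0 in eps; subst ps1.
cbv beta; steps.
pose I2 (i b : nat) (st2 : state) := exists ps1 ps2, [/\ reg st r_a :: ps = ps1 ++ ps2,
  size ps2 = i.+1, b = 40 * i /\ reg st2 r_q = head 0 ps2,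
  out st2 = out st ++ [:: 3 + size ps, reg st r_u & ps1] &
  (forall r, r != r_q -> r != r_m -> reg st2 r = reg st r) /\
  (forall a i, a != a_mk -> arr st2 a i = arr st a i) /\
  (forall i, arr st2 a_mk i = if i \in ps1 then 1 else arr st a_mk i)].
eapply runs_le; first eapply (@runs_while _ _ I2).
- move=> i b st2 [ps1 [[|x [|y ps2]] [eps //= [es] [-> eq] eo2 [er2 [ea2 em2]]]]].
  have ly : last y ps2 = reg st r_c.
    rewrite -lst; have := congr1 (last 0) eps; rewrite last_cat /=.
    by move=> ->; case: (ps1).
  split.
    rewrite eq er2 // -ly; move: U; rewrite eps cat_uniq => /and3P[_ _ /=].
    case/and3P=> xn _ _; by case: (eqVneq x (last y ps2)) => // ex; rewrite ex mem_last in xn.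
  exists 40, (40 * i); split; first by lia.
  eapply runs_le; [steps|by []|move=> st' H; exact: H].
  have exy : arr st nx x = y.
    have := pth; case: (ps1) eps => [|z ps1'] /= [e1 eps]; rewrite eps -?e1.
      by rewrite /= => /andP[/eqP].
    by rewrite cat_path /= => /and4P[_ _ /eqP].
  exists (rcons ps1 x), (y :: ps2); split=> //=; rewrite ?cat_rcons ?eq //.
  + by rewrite es.
  + by rewrite (negbTE nxmk) ea2.
  + by rewrite eo2 -cats1 -catA /= cats1.
  + split; first by move=> r r1 r2; rewrite (negbTE r1) er2.
    split; first by move=> a j /negbTE amk; rewrite amk /= ea2 ?amk.
    by move=> j; rewrite mem_rcons inE em2; case: eqP.
- move=> bb st2 [ps1 [[|x [|? ?]] [eps //= _ [_ eq] eo2 [er2 [ea2 em2]]]]].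
  have lx : reg st r_c = x by rewrite -lst; have := congr1 (last 0) eps; rewrite last_cat.
  by rewrite eq er2 // lx eqxx.
- exists [::], (reg st r_a :: ps); split=> //=.
  + by rewrite er.
  + by rewrite eo em er // -!cats1 -catA.
  + by split=> [r r1 r2|]; [rewrite (negbTE r1) er|rewrite ea].
- exact: leqnn.
move=> st2 [b2 [ps1 [[|x [|? ?]] [eps //= _ [_ eq] eo2 [er2 [ea2 em2]]]]]].
have ex : x = reg st r_c.
  by have := congr1 (last 0) eps; rewrite last_cat /= lst.
cbv beta; steps; split=> /=.
- rewrite eo2 !er2 // -!cats1 -!catA /= -ex; congr (_ ++ _).
  rewrite size_cat /= addn1 add3n; congr [:: _, _ & _].
  have := congr1 (fun l => l ++ [:: reg st r_z]) eps; rewrite -catA /= => <-; by [].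
- by move=> r r1 r2; rewrite er2.
- by move=> a i /negbTE amk; rewrite amk /= ea2 ?amk.
- move=> i; rewrite er2 // er2 //= em2 eps mem_cat inE -ex.
  by case: (i \in ps1); case: (i == x); case: (i == reg st r_z).
Unshelve.
all: rewrite /=; nia.
Qed.

Lemma run_list fa la st (l rest : seq nat) : fa != a_w -> la != a_w -> fa != la ->
  (forall i, arr st a_w (reg st r_p + i) = nth 0 (size l :: l ++ rest) i) ->
  runs (parse_list fa la) st (100 * (size l).+1) (fun st' =>
    [/\ reg st' r_p = reg st r_p + (size l).+1 /\ reg st' r_k = size l, out st' = out st,
        forall r, r != r_p -> r != r_k -> r != r_j -> reg st' r = reg st r &
        forall a i, arr st' a i =
          if [&& l != [::], i == reg st r_v & a == fa] then head 0 l
          else if [&& l != [::], i == reg st r_v & a == la] then last 0 l else arr st a i]).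
Proof.
move=> fw lw fl inp.
eapply runs_le; [|shelve|move=> st' H; exact: H].
rewrite /parse_list; steps.
pose I (i b : nat) (st1 : state) := exists2 j, j + i = size l /\ b = 50 * i &
  [/\ [/\ reg st1 r_j = j, reg st1 r_k = size l & reg st1 r_p = reg st r_p + j.+1],
      out st1 = out st,
      forall r, r != r_p -> r != r_k -> r != r_j -> reg st1 r = reg st r &
      forall a i, arr st1 a i =
          if [&& 0 < j, i == reg st r_v & a == fa] then head 0 l
          else if [&& 0 < j, i == reg st r_v & a == la] then nth 0 l j.-1 else arr st a i].
have in0 := inp 0; rewrite addn0 /= in in0.
eapply runs_le; first eapply (fun HS H0 => @runs_while _ _ I HS H0 (size l) (50 * size l)).
- move=> i b st1 [j [ji ->] [[rj rk rp] o er ea]]; split.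
    by rewrite /= rj rk (_ : j < size l) //; lia.
  exists 50, (50 * i); split; first by lia.
  have cell : arr st1 a_w (reg st1 r_p) = nth 0 l j.
    rewrite ea rp (negbTE (_ : a_w != fa)) 1?eq_sym // (negbTE (_ : a_w != la)) 1?eq_sym //.
    by rewrite !andbF -addSnnS addSn -addnS inp /= nth_cat (_ : j < size l) //; lia.
  have erv : reg st1 r_v = reg st r_v by exact: er.
  have [j0|jn0] := eqVneq j 0.
    eapply runs_le; [step; eapply runs_if_false; [by rewrite /= rj|steps]|by []|move=> st' H; exact: H].
    exists 1; first by lia.
    split=> /=; [split=> /=; lia|by []| |].
      by move=> r r1 r2 r3; rewrite (negbTE r1) (negbTE r3) er.
    move=> a i'; rewrite /= erv if_same cell ea j0 /= nth0.
    case: (eqVneq i' (reg st r_v)) => _; rewrite ?andbT ?andbF //=.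
    by case: (eqVneq a fa) => [->|]; rewrite ?(negbTE fl).
  eapply runs_le; [step; eapply runs_if_true; [by rewrite /= rj|steps]|by []|move=> st' H; exact: H].
  exists j.+1; first by lia.
  split=> /=; [split=> /=; lia|by []| |].
    by move=> r r1 r2 r3; rewrite (negbTE r1) (negbTE r3) er.
  move=> a i'; rewrite /= erv cell ea lt0n jn0 /= [(a == la) && _]andbC.
  case: (eqVneq i' (reg st r_v)) => //= _.
  by case: (eqVneq a la) => [->|]; rewrite 1?eq_sym ?(negbTE fl) // eq_sym (negbTE fl).
- move=> b st1 [j [ji _] [[rj rk rp] o er ea]].
  by rewrite /= rj rk -ji addn0 ltnn.
- exists 0 => //; split=> //=; first by split=> //=; lia.
  by move=> r /negbTE r1 /negbTE r2 /negbTE r3; rewrite r1 r2 r3.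
- exact: leqnn.
move=> st1 [b [j [ji _] [[rj rk rp] o er ea]]]; cbv beta; steps.
rewrite addn0 in ji; rewrite ji in rp ea; split=> // a i; rewrite ea lt0n size_eq0 -nth_last.
by [].
Unshelve.
rewrite /=; lia.
Qed.

Definition vword (l : seq nat * seq nat) : seq nat := (size l.1 :: l.1) ++ (size l.2 :: l.2).
(** A budget for reading one vertex: 100 per list entry, and 300 for starting the two lists and for
    the rest of the loop body. *)
Definition vcost (l : seq nat * seq nat) : nat := 100 * (size l.1 + size l.2) + 300.

Definition cells (st : state) fa la v (l : seq nat) : Prop :=
  arr st fa v = head 0 l /\ arr st la v = last 0 l.

Lemma run_parse (ls : seq (seq nat * seq nat)) (s : nat) :
  s < size ls -> (forall v, v < size ls -> (nth ([::], [::]) ls v).2 = [::] <-> v = s) ->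
  runs parse (init_state (size ls :: flatten (map vword ls)))
    (100 * (size ls).+1 + sumn (map vcost ls)) (fun st =>
    [/\ reg st r_n = size ls, reg st r_x = s, out st = [::],
        forall v, v < size ls -> cells st a_lo a_ro v (nth ([::], [::]) ls v).1 /\
                                 cells st a_li a_ri v (nth ([::], [::]) ls v).2 &
        forall i, arr st a_em i = 0 /\ arr st a_mk i = 0]).
Proof.
move=> sn sP; set n := size ls.
eapply runs_le; [|shelve|move=> st' H; exact: H].
rewrite /parse; steps.
pose I (i b : nat) (st : state) := exists2 v, v + i = n /\ b = sumn (map vcost (drop v ls)) &
  [/\ [/\ reg st r_v = v, reg st r_n = n, out st = [::] & s < v -> reg st r_x = s],
      forall k, arr st a_w (reg st r_p + k) = nth 0 (flatten (map vword (drop v ls))) k,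
      forall u, u < v -> cells st a_lo a_ro u (nth ([::], [::]) ls u).1 /\
                         cells st a_li a_ri u (nth ([::], [::]) ls u).2 &
      (forall a u, v <= u -> a_w < a -> arr st a u = 0) /\
      forall i, arr st a_em i = 0 /\ arr st a_mk i = 0].
eapply runs_le; first eapply (fun HS H0 => @runs_while _ _ I HS H0 n (sumn (map vcost ls))).
- move=> i b st [v [vi ->] [[rv rn o rx] inp cl [z0 z1]]]; split.
    by rewrite /= rv rn (_ : v < n) //; lia.
  have vn : v < n by lia.
  rewrite (drop_nth ([::], [::]) vn) in inp *; set l := nth _ ls v in inp *.
  exists (vcost l), (sumn (map vcost (drop v.+1 ls))); split; first by rewrite /= leqnn.
  pose rest := flatten (map vword (drop v.+1 ls)).
  have inp1 k : arr st a_w (reg st r_p + k) =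
      nth 0 (size l.1 :: l.1 ++ (size l.2 :: l.2) ++ rest) k.
    by rewrite inp /= /vword -catA.
  eapply runs_le; [step; eapply runs_le;
    [exact: (run_list (fa := a_lo) (la := a_ro) _ _ _ inp1)|exact: leqnn|]|shelve|move=> st' H; exact: H].
  move=> st1 [[p1 k1] eo1 er1 ea1]; step; eapply runs_le; [|exact: leqnn|].
    apply: (run_list (fa := a_li) (la := a_ri) (l := l.2) (rest := rest)) => // k.
    rewrite p1 ea1 !andbF -addnA inp1 addSn /= nth_cat.
    by rewrite ltnNge leq_addr /= addKn.
  move=> st2 [[p2 k2] eo2 er2 ea2].
  have e12 r : r != r_p -> r != r_k -> r != r_j -> reg st2 r = reg st r.
    by move=> r1 r2 r3; rewrite er2 // er1.
  have v1 : reg st1 r_v = v by rewrite er1.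
  have body st3 : (forall r, r != r_x -> r != r_v -> reg st3 r = reg st2 r) ->
      reg st3 r_v = v.+1 -> arr st3 = arr st2 -> out st3 = out st2 ->
      (s < v.+1 -> reg st3 r_x = s) -> I i (sumn (map vcost (drop v.+1 ls))) st3.
    move=> er3 rv3 ea3 eo3 rx3; exists v.+1; first by split=> //; lia.
    rewrite ea3; split.
    + by split=> //; rewrite ?er3 ?e12 // eo3 eo2 eo1.
    + move=> k; rewrite er3 // ea2 ea1 !andbF p2 p1 -!addnA inp1 addSn /= nth_cat.
      rewrite ltnNge leq_addr /= addKn addSn /= nth_cat.
      by rewrite ltnNge leq_addr /= addKn.
    + move=> u; rewrite ltnS leq_eqVlt /cells ea3 !ea2 !ea1 v1 rv => /orP[/eqP ->|uv].
        rewrite eqxx /= !andbF !andbT.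
        (* An empty list stores nothing, but [cells] then asks for the default 0, which the arrays
           still hold from their initialisation. *)
        rewrite !z0 ?leqnn // -/l; case: (l) => [[|? ?] [|? ?]] //=.
      by rewrite (ltn_eqF uv) !andbF; exact: cl.
    + split; last by move=> k; rewrite !ea2 !ea1 !andbF.
      move=> a u vu aw; rewrite ea2 ea1 v1 rv gtn_eqF //= !andbF; apply: z0 => //; exact: ltnW.
  step; apply: (@runs_le _ _ 10 _ (fun st3 =>
    [/\ forall r, r != r_x -> reg st3 r = reg st2 r, arr st3 = arr st2,
        out st3 = out st2 & s < v.+1 -> reg st3 r_x = s])).
  + have [l20|l2n] := eqVneq l.2 [::].
      have evs : v = s by apply/(sP v vn).
      eapply runs_le; [apply: runs_if_false; [by rewrite /= k2 l20|steps]|by []|by move=> st' H; exact: H].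
      split=> //= [r /negbTE -> //|_].
      by rewrite e12 // rv.
    eapply runs_le; [apply: runs_if_true; [by rewrite /= k2 size_eq0|steps]|by []|by move=> st' H; exact: H].
    split=> // /ltnSE; rewrite leq_eqVlt => /orP[/eqP esv|sv]; last by rewrite e12 // rx.
    by case/eqP: l2n; apply/(sP v vn).
  + exact: leqnn.
  move=> st3 [er3 ea3 eo3 rx3]; cbv beta; steps; apply: body => //=.
  + by move=> r /er3 er /negbTE ->.
  + by rewrite er3 // e12 // rv.
- move=> b st [v [vi _] [[rv rn o rx] inp cl [z0 z1]]].
  by rewrite /= rv rn -vi addn0 ltnn.
- exists 0; first by rewrite drop0.
  rewrite drop0; split=> /=; [by split|by []|by []|by split=> // -[|a] u].
- exact: leqnn.
move=> st [b [v [vi _] [[rv rn o rx] inp cl [z0 z1]]]]; cbv beta; steps.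
by rewrite addn0 in vi; rewrite vi in rx cl; split=> //; exact: rx.
Unshelve.
all: rewrite /= ?/vcost; lia.
Qed.

(** * Evaluating the tests and writing one polygon *)

Section Program.
Variables (n : nat) (e : rel 'I_n) (s t : 'I_n) (inL inR : pred 'I_n).
Variables (outs ins : 'I_n -> seq 'I_n).
Hypothesis W : two_sided e s t inL inR outs ins.
Notation lo := (fst_nbr outs).
Notation ro := (lst_nbr outs).
Notation li := (fst_nbr ins).
Notation ri := (lst_nbr ins).
Notation inside := (inside e).
Notation good := (good e inL inR).
Notation poly_sides := (poly_sides e inL inR).
Let acy := ts_acy W.

(** For an empty list the cells hold 0, whereas [fst_nbr] and [lst_nbr] default to the vertex
    itself. This is why [enc_out] and [enc_in] ask for an arc. *)
Definition enc (st : state) : Prop := forall v : 'I_n,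
  cells st a_lo a_ro v (map val (outs v)) /\ cells st a_li a_ri v (map val (ins v)).

Lemma cells_val st fa la (v : 'I_n) (l : seq 'I_n) c : cells st fa la v (map val l) -> c \in l ->
  arr st fa v = head v l /\ arr st la v = last v l.
Proof. by case=> -> ->; case: l => // x l _ /=; rewrite last_map. Qed.

Lemma enc_out st v c : enc st -> e v c -> arr st a_lo v = lo v /\ arr st a_ro v = ro v.
Proof. by move=> /(_ v)[h _]; rewrite -(ts_outs W) => vc; exact: (cells_val h vc). Qed.

Lemma enc_in st v c : enc st -> e c v -> arr st a_li v = li v /\ arr st a_ri v = ri v.
Proof. by move=> /(_ v)[_ h]; rewrite -(ts_ins W) => vc; exact: (cells_val h vc). Qed.

Lemma enc_ext st st' : enc st -> (forall a i, a != a_mk -> a != a_em -> arr st' a i = arr st a i) ->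
  enc st'.
Proof. by move=> h ea v; rewrite /cells !ea //; exact: h. Qed.

Lemma nat_eq (u v : 'I_n) : ((u : nat) == v) = (u == v).
Proof. by []. Qed.

Lemma eval_src st (u : 'I_n) : enc st -> reg st r_u = u ->
  aeval st a_src = is_src outs ins u.
Proof.
(* Without out-neighbours both cells hold 0, so the first comparison already fails, as it does in
   [is_src], where both neighbours default to [u]. *)
move=> en ru; case E : (outs u) => [|c l].
  have [[/= h1 h2] _] := en u; rewrite E in h1 h2.
  rewrite /is_src /fst_nbr /lst_nbr E eqxx /=.
  by rewrite ru h1 h2 eqxx.
have uc : e u c by rewrite -(ts_outs W) E mem_head.
have [h1 h2] := enc_out en uc.
have [_ h3] := enc_in en (arc_out_lo W uc); have [h4 _] := enc_in en (arc_out_ro W uc).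
apply: (aeval_and (b1 := lo u != ro u) (b2 := (ri (lo u) == u) && (li (ro u) == u))).
  by rewrite /= ru h1 h2 nat_eq; case: (_ == ro u).
by apply: aeval_and; rewrite /= ru ?h1 ?h2 ?h3 ?h4 nat_eq.
Qed.

Lemma eval_end st (w : 'I_n) c : enc st -> reg st r_q = w -> e w c ->
  aeval st a_end = left_end outs ins w.
Proof.
move=> en rq wc; have [_ h2] := enc_out en wc.
have wz := arc_out_ro W wc; have [h3 h4] := enc_in en wz.
have [h5 _] := enc_out en (arc_in_ri W wz).
apply: (aeval_and (b2 := (ri (ro w) != w) && (lo (ri (ro w)) == ro w))).
  by rewrite /= rq h2 h3 nat_eq.
apply: aeval_and; first by rewrite /= rq h2 h4 nat_eq; case: (_ == w).
by rewrite /= rq h2 h4 h5 nat_eq.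
Qed.

Lemma path_val (f : 'I_n -> 'I_n) (g : nat -> nat) (x : 'I_n) p :
  (forall w c, e w c -> g w = f w) -> path e x p -> fpath f x p ->
  path (frel g) (val x) (map val p).
Proof.
move=> H; elim: p x => [|c p IH] x //= /andP[xc cp] /andP[/eqP fx fp].
by rewrite /= (H _ _ xc) fx eqxx IH.
Qed.

Definition polygon_word u v (l r : seq 'I_n) : seq nat :=
  1 :: list_word (u :: rcons l v) ++ list_word (u :: rcons r v).

(** The sides are chosen before the state, so that the cost and the new inner vertices that enter
    the budget of the main loop do not depend on the state. *)
Lemma run_polygon (u v : 'I_n) : good u v -> exists l r, poly_sides u v l r /\
  forall st, enc st -> reg st r_u = u ->
  runs polygon st (300 * (size l + size r) + 500) (fun st' =>
    [/\ out st' = out st ++ polygon_word u v l r,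
        forall k, k < r_q -> reg st' k = reg st k,
        forall a i, a != a_mk -> arr st' a i = arr st a i &
        forall w : 'I_n, arr st' a_mk w =
          if inside u v w || (w == v) then 1 else arr st a_mk w]).
Proof.
move=> g; have [ua aL ai ub [bR bi]] := good_ends W g.
have [p [p1 p2 p3 p4]] := left_chain W g.
have [q [q1 q2 q3 q4]] := left_chain (ts_mirror W) (good_mirror g).
rewrite !fst_rev in q1 q2 q3 q4.
have {}q1 : fpath ro (ro u) q.
  by apply: etrans q1; apply: eq_path => a b /=; rewrite fst_rev.
have [cv cL ci _] := good_li W g ai aL; have [dv dR di _] := good_ri W g bi bR.
have [rc tc] := left_end_li W g.
exists (lo u :: p), (ro u :: q); split.
  split=> //=; first by rewrite ua rcons_path p3 p2.
  by rewrite ub rcons_path q3 q2.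
move=> st en ru; have [elo _] := enc_out en ua.
eapply runs_le; [|shelve|move=> st' H; exact: H].
rewrite /polygon; steps.
pose I (i b : nat) (st1 : state) := exists p1 p2, [/\ lo u :: p = p1 ++ p2,
  size p2 = i.+1, b = 5 * i /\ reg st1 r_q = head u p2 :> nat,
  out st1 = out st /\ arr st1 = arr st &
  (forall r, r != r_q -> r != r_a -> reg st1 r = reg st r) /\ reg st1 r_a = lo u].
have enI i b st1 : I i b st1 -> enc st1.
  by case=> ? [? [_ _ _ [_ ear] _]]; apply: (enc_ext en) => a j _ _; rewrite ear.
eapply runs_le; first eapply (fun HS H0 => @runs_while _ _ I HS H0 (size p) (5 * size p)).
- move=> i b st1 Ist; have en1 := enI _ _ _ Ist.
  case: Ist => p' [[|x [|y p'']] [ep es [-> eq] [eo ear] [er era]]]; try by [].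
  case: es => es.
  have xm : x \in lo u :: p by rewrite ep mem_cat mem_head orbT.
  move: (xm); rewrite p4 => /andP[xi xL].
  have [c xc] : exists c, e x c.
    by case/andP: xi => _ xv; have [c xc _] := first_step xv; exists c.
  have nx : x != li v.
    rewrite -p2; have := path_uniq W p3; rewrite ep cat_uniq => /and3P[_ _ /=].
    case/andP=> xn _; have := congr1 (last u) ep; rewrite last_cat /= => ->.
    by apply: contraNneq xn => ->; rewrite mem_last.
  split.
    by rewrite aeval_not (eval_end en1 eq xc) (left_end_iff W g xi xL) (negbTE nx).
  exists 5, (5 * i); split; first by rewrite mulnS.
  eapply runs_le; [steps|by []|move=> st' H; exact: H].
  exists (rcons p' x), (y :: p''); split=> //=; rewrite ?cat_rcons ?es //.
  + split=> //; rewrite eq; have [-> _] := enc_out en1 xc.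
    have := p1; case: (p') ep => [|z p0] /= [e1 ep]; rewrite ep -?e1.
      by rewrite /= => /andP[/eqP ->].
    by rewrite cat_path /= => /and4P[_ _ /eqP ->].
  + by split=> // r r1 r2; rewrite (negbTE r1) er.
- move=> b st1 Ist; have en1 := enI _ _ _ Ist.
  case: Ist => p' [[|x [|? ?]] [ep es [_ eq] [eo ear] [er era]]]; try by [].
  have ex : x = li v by rewrite -p2; have := congr1 (last u) ep; rewrite last_cat /= => ->.
  rewrite ex in eq.
  by rewrite aeval_not (eval_end en1 eq cv) tc.
- exists [::], (lo u :: p); split=> //=; rewrite ?ru ?elo //.
  by split=> // r /negbTE r1 /negbTE r2; rewrite r1 r2.
- exact: leqnn.
move=> st1 [b Ist]; have en1 := enI _ _ _ Ist.
case: Ist => p' [[|x [|? ?]] [ep es [_ eq] [eo ear] [er era]]]; try by [].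
have ex : x = li v by rewrite -p2; have := congr1 (last u) ep; rewrite last_cat /= => ->.
rewrite {p' ep}ex /= in eq.
cbv beta; steps.
have [_ rov] := enc_out en1 cv.
have [_ riv] := enc_in en1 cv.
have pathL := path_val (fun w c wc => proj1 (enc_out en1 wc)) p3 p1.
have pathR := path_val (fun w c wc => proj2 (enc_out en1 wc)) q3 q1.
have uL : uniq (map val (lo u :: p)) by rewrite map_inj_uniq ?(path_uniq W) //; exact: val_inj.
have uR : uniq (map val (ro u :: q)) by rewrite map_inj_uniq ?(path_uniq W) //; exact: val_inj.
eapply runs_le.
  apply: (run_side (nx := a_lo) (ps := map val p)) => //=.
  - by rewrite era.
  - by rewrite era eq last_map p2.
  - by rewrite era; exact: uL.
- exact: leqnn.
rewrite /= !era eq rov rc er // ru => st2 [eo2 er2 ea2 em2].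
cbv beta; steps.
eapply runs_le.
  apply: (run_side (nx := a_ro) (ps := map val q)) => //=.
  - by rewrite !er2 //= er // ru !ea2 // (proj2 (enc_out en1 ub)) (eq_path (e' := frel (arr st1 a_ro))) // => a b'; rewrite /= ea2.
  - by rewrite !er2 //= er // ru !ea2 // (proj2 (enc_out en1 ub)) riv last_map q2.
  - rewrite !er2 //= er // ru ea2 // (proj2 (enc_out en1 ub)).
    exact: uR.
- exact: leqnn.
rewrite /= !er2 //= er // ru !ea2 // (proj2 (enc_out en1 ub)) => st3 [eo3 er3 ea3 em3].
cbv beta; steps; split.
- rewrite eo3 eo2 /polygon_word /list_word /= !size_rcons !size_map -!map_rcons -catA /=.
  by rewrite eo cat_rcons !map_rcons.
- move=> k kq; have knq r : r_q <= r -> k != r by move=> qr; apply: contraTneq kq => ->; rewrite -leqNgt.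
  by rewrite er3 ?knq //= !(negbTE (knq _ _)) // er2 ?knq //= !(negbTE (knq _ _)) // er ?knq.
- by move=> a i am; rewrite ea3 //= ea2 //= ear.
- move=> w; rewrite em3 /= em2 /= !nat_eq ear.
  rewrite -![_ :: map _ _]/(map val (_ :: _)) !mem_map; try exact: val_inj.
  rewrite p4 q4; case: (eqVneq w v) => [|nwv]; rewrite ?orbT // !orbF.
  by case: (inside u v w) => //=; have := ts_cover W w; case: (inL w) (inR w) => [] [].
Unshelve.
all: clear; rewrite /= ?size_map; lia.
Qed.
End Program.

(** * The main loop *)

Section Main.
Variables (n : nat) (e : rel 'I_n) (s t : 'I_n) (inL inR : pred 'I_n).
Variables (outs ins : 'I_n -> seq 'I_n).
Hypothesis W : two_sided e s t inL inR outs ins.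
Notation le := (connect e).
Notation lt := (ltc e).
Notation lo := (fst_nbr outs).
Notation ro := (lst_nbr outs).
Notation ri := (lst_nbr ins).
Notation inside := (inside e).
Notation good := (good e inL inR).
Let acy := ts_acy W.

Definition covered (w : 'I_n) : Prop := exists u v, good u v /\ le u w /\ le w v.

(* A vertex that is neither free nor the source of a polygon writes nothing. *)
Definition word_of (u : 'I_n) (w : seq nat) : Prop :=
  [\/ exists v l r, poly_sides e inL inR u v l r /\ w = polygon_word u v l r,
      ~ covered u /\ w = [:: 0; val u] |
      [/\ covered u, forall v, ~ good u v & w = [::]]].

Inductive emitted : seq 'I_n -> seq nat -> Prop :=
| emitted_nil : emitted [::] [::]
| emitted_rcons Q o u w : emitted Q o -> word_of u w -> emitted (rcons Q u) (o ++ w).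

Definition marked_inv (Q : seq 'I_n) (st : state) : Prop := forall w : 'I_n,
  arr st a_mk w <> 0 <-> exists u v, [/\ u \in Q, good u v & inside u v w || (w == v)].

Lemma poly_sides_uniq u v l r : poly_sides e inL inR u v l r -> uniq (l ++ r).
Proof.
case=> g pl pr ml mr.
have U x : path e u (rcons x v) -> uniq x.
  by move/(path_uniq W); rewrite /= rcons_uniq => /and3P[].
rewrite cat_uniq (U _ pl) (U _ pr) andbT /=; apply/hasPn => x; rewrite mr => /andP[xi xR].
by rewrite ml xi /=; apply/negP => xL; have := goodL_notR W g xi xL; rewrite xR.
Qed.

(* [Z] lists the inner vertices of the polygons written so far.  Inner vertices of
   distinct polygons are distinct, so the growth of [Z] pays for writing a polygon. *)
Lemma run_treat Q Z (u : 'I_n) : u \notin Q -> (forall c, lt c u -> c \in Q) ->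
  uniq Z -> (forall z, z \in Z -> exists u' v, [/\ u' \in Q, good u' v & inside u' v z]) ->
  exists B Z', [/\ B + 300 * (n - size Z') <= 300 * (n - size Z) + 600,
    uniq Z', forall z, z \in Z' -> exists u' v, [/\ u' \in rcons Q u, good u' v & inside u' v z] &
    forall st, enc outs ins st -> reg st r_u = u -> marked_inv Q st ->
    runs treat st B (fun st' => exists w, [/\ word_of u w /\ out st' = out st ++ w,
      enc outs ins st', (forall i, arr st' a_em i = arr st a_em i),
      forall k, k < r_q -> reg st' k = reg st k & marked_inv (rcons Q u) st'])].
Proof.
move=> uQ uin UZ ZP; rewrite /treat.
have rQ v : v \in Q -> v \in rcons Q u by rewrite mem_rcons inE orbC => ->.
have ZP' : forall z, z \in Z -> exists u' v, [/\ u' \in rcons Q u, good u' v & inside u' v z].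
  by move=> z /ZP[u' [v [h1 h2 h3]]]; exists u', v; split=> //; exact: rQ.
have [su|nsu] := boolP (is_src outs ins u).
  have [v g] := src_good W su.
  have [l [r [ps run]]] := run_polygon W g.
  have Ulr := poly_sides_uniq ps; case: (ps) => _ _ _ ml mr.
  have mlr w : (w \in l ++ r) -> inside u v w.
    by rewrite mem_cat ml mr => /orP[/andP[]|/andP[]].
  have UZ' : uniq (l ++ r ++ Z).
    rewrite catA cat_uniq Ulr UZ andbT /=; apply/hasPn => z /ZP[u' [v' [h1 h2 h3]]].
    apply/negP => /mlr zi; have euu := good_disjoint W g h2 zi h3.
    by rewrite euu h1 in uQ.
  (* Beyond the cost of [polygon], 40 steps are set aside for evaluating [a_src] and branching. *)
  exists (300 * (size l + size r) + 540), (l ++ r ++ Z).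
  have sz : size (l ++ r ++ Z) <= n.
    by rewrite -(card_uniqP UZ') -[X in _ <= X]card_ord; exact: max_card.
  split=> //.
  - move: sz; rewrite !size_cat; move: (size l) (size r) (size Z) => a b c; clear; lia.
  - move=> z; rewrite catA mem_cat => /orP[/mlr zi|/ZP' //].
    by exists u, v; rewrite mem_rcons mem_head.
  move=> st en ru mk; have ev := eval_src W en ru.
  eapply runs_le; [apply: runs_if_true; first by rewrite ev su| |move=> st' H; exact: H].
    eapply runs_le; [exact: run en ru|exact: leqnn|].
    move=> st' [eo1 r1 a1 m1]; exists (polygon_word u v l r); split=> //.
    + by split=> //; constructor 1; exists v, l, r.
    + by apply: (enc_ext en) => a i am _; exact: a1.
    + by move=> i; exact: a1.
    move=> w; rewrite m1; case: ifP => [wi|nwi].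
      by split=> // _; exists u, v; rewrite mem_rcons mem_head.
    split=> [/(mk w)[u' [v' [h1 h2 h3]]]|[u' [v' [h1 h2 h3]]]].
      by exists u', v'; split=> //; exact: rQ.
    move: h1; rewrite mem_rcons inE => /orP[/eqP euu|h1]; last by apply/(mk w); exists u', v'.
    by rewrite euu in h2 h3; rewrite (good_snk_uniq W g h2) h3 in nwi.
  by rewrite /=; move: (size l) (size r) => a b; clear; lia.
exists 50, Z; split=> //; first by clear; lia.
move=> st en ru mk; have ev := eval_src W en ru.
have ngood v : ~ good u v by move=> /(good_src W) h; rewrite h in nsu.
(* Since [u] is not a source, an interval covering it has its source strictly below [u]. That source
   has been treated, so the mark of [u] has been set. *)
have mkP : arr st a_mk u <> 0 <-> covered u.
  split=> [/(mk u)[u' [v' [h1 h2 /orP[/andP[h3 h4]|/eqP ev']]]]|[u' [v' [h1 [h2 h3]]]]].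
  - by exists u', v'; rewrite !ltcW.
  - exists u', v'; split=> //; rewrite ev' connect0; split=> //.
    by have [_ _ /andP[h3 h4] _ _] := good_ends W h2; exact: ltcW (ltc_trans acy h3 h4).
  have uu : lt u' u.
    by move: h2; rewrite le_eqVltc => /orP[/eqP eu|//]; rewrite eu in h1; case: (ngood v').
  apply/(mk u); exists u', v'; split=> //; first exact: uin.
  by move: h3; rewrite le_eqVltc orbC /inside uu.
have mk' st' : (forall i, arr st' a_mk i = arr st a_mk i) -> marked_inv (rcons Q u) st'.
  move=> em w; rewrite em; split=> [/(mk w)[u' [v' [h1 h2 h3]]]|[u' [v' [h1 h2 h3]]]].
    by exists u', v'; split=> //; exact: rQ.
  move: h1; rewrite mem_rcons inE => /orP[/eqP euu|h1]; last by apply/(mk w); exists u', v'.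
  by rewrite euu in h2; case: (ngood v').
eapply runs_le; [apply: (@runs_if_false _ _ _ _ 20); first by rewrite ev (negbTE nsu)|by []|
  move=> st' H; exact: H].
have [m0|m0] := eqVneq (arr st a_mk u) 0.
  eapply runs_le; [apply: runs_if_false; [by rewrite /= ru m0|steps]|by []|move=> st' H; exact: H].
  exists [:: 0; val u]; split=> //=.
  - split; last by rewrite ru -!cats1 -catA.
    by constructor 2; split=> // /mkP; rewrite m0.
  - exact: mk'.
eapply runs_le; [apply: runs_if_true; [by rewrite /= ru|steps]|by []|move=> st' H; exact: H].
exists [::]; split=> //=; last exact: mk'.
split; last by rewrite cats0.
by constructor 3; split=> //; apply/mkP/eqP.
Qed.

Definition emitted_inv (Q : seq 'I_n) (st : state) : Prop :=
  forall w : 'I_n, arr st a_em w <> 0 <-> w \in Q.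

(** Nothing is promised about the pointers once [t] is chosen: it has no out-neighbours, and its
    cells do not encode a next vertex. *)
Lemma run_pick x y Q st : enc outs ins st -> merge_inv e t inL inR x y Q ->
  reg st r_x = x -> reg st r_y = y -> emitted_inv Q st ->
  let u := merge_pick ins x y Q in
  runs pick st 30 (fun st' =>
    [/\ reg st' r_u = u, out st' = out st, arr st' = arr st,
        forall k, k != r_x -> k != r_y -> k != r_u -> reg st' k = reg st k &
        u != t -> reg st' r_x = (if (x == y) || (ri x \in Q) then lo x else x) /\
                  reg st' r_y = (if (x == y) || (ri x \notin Q) then ro y else y)]).
Proof.
move=> en I rx ry em; rewrite /pick /=.
have [[xL yR] _ QL QR _] := I.
have arcs z : z != t -> exists c, e z c.
  by move=> zt; have [c zc _] : exists2 c, e z c & le c t;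
    [apply: first_step; rewrite /ltc zt (ts_snk W)|exists c].
have regs st' (xx yy uu : nat) : (forall k, reg st' k =
    if k == r_u then uu else if k == r_y then yy else if k == r_x then xx else reg st k) ->
  forall k, k != r_x -> k != r_y -> k != r_u -> reg st' k = reg st k.
  by move=> h k /negbTE k1 /negbTE k2 /negbTE k3; rewrite h k1 k2 k3.
rewrite /merge_pick; have [exy|nxy] := eqVneq x y.
  eapply runs_le; [apply: runs_if_true; [by rewrite /= rx ry exy eqxx|steps]|by []|move=> st' H; exact: H].
  rewrite /=; split=> //=.
  - by move=> k /negbTE k1 /negbTE k2 /negbTE k3; rewrite k1 k2 k3.
  - by move=> xt; have [c xc] := arcs _ xt; rewrite rx ry -exy; have [-> ->] := enc_out W en xc.
have [c cx] : exists c, e c x.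
  have sx : s != x.
    apply: contraNneq nxy => esx; rewrite -esx in QR QL *.
    have := QR s (ts_sR W); rewrite (QL s (ts_sL W)) (negbTE (ltc_irr e s)) => /esym/negbT.
    by rewrite /ltc (ts_src W) andbT negbK.
  by have [c cx _] : exists2 c, e c x & le s c;
    [apply: last_step; rewrite /ltc sx (ts_src W)|exists c].
have [_ riE] := enc_in W en cx.
have cost30 N : N <= 20 -> (acost (AEq (AReg r_x) (AReg r_y)) + N).+1 <= 30.
  by rewrite /=; clear; lia.
eapply runs_le; [apply: (@runs_if_false _ _ _ _ 20)|by []|move=> st' H; exact: H].
  by rewrite /= rx ry nat_eq (negbTE nxy).
case: (boolP (ri x \in Q)) => rQ /=.
  eapply runs_le; [apply: runs_if_true; [|steps]|by []|move=> st' H; exact: H].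
    by rewrite /= rx riE; apply/eqP/(em (ri x)).
  split=> //=; first by move=> k /negbTE k1 /negbTE k2 /negbTE k3; rewrite k1 k3.
  by move=> xt; have [c' xc] := arcs _ xt; rewrite rx; have [-> _] := enc_out W en xc.
eapply runs_le; [apply: runs_if_false; [|steps]|by []|move=> st' H; exact: H].
  by rewrite /= rx riE; apply/eqP; apply: contraNT rQ => h; apply/(em (ri x))/eqP.
split=> //=; first by move=> k /negbTE k1 /negbTE k2 /negbTE k3; rewrite k2 k3.
by move=> yt; have [c' yc] := arcs _ yt; rewrite ry; have [_ ->] := enc_out W en yc.
Qed.

Lemma run_decompose st : enc outs ins st -> reg st r_n = n -> reg st r_x = s -> out st = [::] ->
  (forall i, arr st a_em i = 0 /\ arr st a_mk i = 0) ->
  runs decompose st (2000 * n + 100) (fun st' => exists Q,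
    [/\ emitted Q (out st'), uniq Q, (forall v, v \in Q) & pairwise (fun a b => ~~ le b a) Q]).
Proof.
move=> en rn rx eo0 a0.
eapply runs_le; [|shelve|move=> st' H; exact: H].
rewrite /decompose; steps.
(* Of the 700 steps per remaining turn, 600 are the surplus left by [run_treat] and 70 cover the
   other commands of the body; the 300 per vertex not yet in [Z] are released when polygons are
   written. The pointers are constrained only while turns remain. *)
pose I (i b : nat) (st1 : state) := exists Q Z,
  [/\ [/\ reg st1 r_n = n, reg st1 r_cnt = size Q, size Q + i = n & b = 700 * i + 300 * (n - size Z)],
      enc outs ins st1 /\ emitted Q (out st1),
      emitted_inv Q st1 /\ marked_inv Q st1,
      uniq Z /\ forall z, z \in Z -> exists u v, [/\ u \in Q, good u v & inside u v z] &
      [/\ uniq Q, pairwise (fun a b => ~~ le b a) Q, forall a w, a \in Q -> e w a -> w \in Q &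
          i != 0 -> exists x y, [/\ reg st1 r_x = val x, reg st1 r_y = val y & merge_inv e t inL inR x y Q]]].
eapply runs_le; first eapply (fun HS H0 => @runs_while _ _ I HS H0 n (700 * n + 300 * n)).
- move=> i b st1 [Q [Z [[rn1 rc1 sz ->] [en1 em1] [ei mi] [UZ ZP] [UQ pw dc]]]] [//|x [y [rx1 ry1 mg]]].
  split; first by rewrite /= rc1 rn1 (_ : size Q < n) // -[X in _ < X]sz addnS ltnS leq_addr.
  have [uQ uin] := merge_in W mg; have := run_pick en1 mg rx1 ry1 ei.
  set u := merge_pick ins x y Q in uQ uin *; cbv zeta => rp.
  have uin' c : lt c u -> c \in Q.
    by case/last_step=> d /uin dQ cd; exact: (down_closed dc cd dQ).
  have pwu : pairwise (fun a b => ~~ le b a) (rcons Q u).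
    rewrite pairwise_rcons pw andbT; apply/allP => a aQ; apply: contraNN uQ => ua.
    exact: (down_closed dc ua aQ).
  have dcu : forall a w, a \in rcons Q u -> e w a -> w \in rcons Q u.
    move=> a w; rewrite !mem_rcons !inE => /orP[/eqP ->|aQ] wa; first by rewrite uin ?orbT.
    by rewrite (dc a w) ?orbT.
  have mgs (i0 : i != 0) : u != t.
    apply: contraNneq i0 => eut; have := merge_last W mg eut; rewrite card_ord => szn.
    by apply/eqP; move: sz szn; move: (size Q); clear; lia.
  have [B [Z' [hB UZ' ZP' rt]]] := run_treat uQ uin' UZ ZP.
  exists (B + 70), (700 * i + 300 * (n - size Z')); split.
    by move: hB; move: (size Z) (size Z'); clear; lia.
  cbn [cseq foldr]; eapply runs_le; [step|shelve|move=> st' h; exact: h].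
  eapply runs_le; [exact: rp|exact: leqnn|].
  move=> st2 [r2 eo2 a2 k2 xy2]; cbv beta; steps.
  eapply runs_le; [apply: rt|exact: leqnn|].
  - by apply: (enc_ext en1) => a j am ae; rewrite /= (negbTE ae) /= a2.
  - by rewrite /= r2.
  - by move=> w; rewrite /= a2; exact: mi.
  rewrite /= r2 a2 => st3 [w [[wu eo3] en3 em3 k3 mi3]]; cbv beta; steps.
  exists (rcons Q u), Z'; split=> //.
  - split=> //; rewrite ?k3 //= ?size_rcons ?k2 // ?rc1 //.
    by move: sz; rewrite addSnnS.
  - by split=> //; rewrite eo3 eo2; exact: emitted_rcons.
  - split=> // w'; rewrite em3 /= mem_rcons inE nat_eq; case: (w' == u) => //=; exact: ei.
  - split=> //; first by rewrite rcons_uniq uQ.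
    move=> i0; have [x2 y2] := xy2 (mgs i0).
    exists (if (x == y) || (ri x \in Q) then lo x else x), (if (x == y) || (ri x \notin Q) then ro y else y).
    by split; rewrite ?k3 //=; apply: (merge_step W mg (mgs i0)).
- move=> b st1 [Q [Z [[rn1 rc1 sz _] _ _ _ _]]].
  by rewrite /= rc1 rn1 (_ : size Q < n = false) // -[X in _ < X]sz addn0 ltnn.
- exists [::], [::]; split=> //=; rewrite ?eo0.
  + by rewrite subn0.
  + by split=> //; exact: emitted_nil.
  + split=> w; rewrite /= ?(proj1 (a0 _)) ?(proj2 (a0 _)); split=> //.
    by case=> u [v [] ].
  + split=> // _; exists s, s; split=> //; exact: (merge_init W).
- exact: leqnn.
move=> st1 [b [Q [Z [[rn1 rc1 sz _] [en1 em1] _ _ [UQ pw dc _]]]]]; cbv beta; steps.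
rewrite addn0 in sz.
exists Q; split=> // v.
have : #|Q| = #|'I_n| by rewrite (card_uniqP UQ) card_ord.
by move=> /subset_cardP/(_ (subset_predT _)) ->.
Unshelve.
all: rewrite /=; try (move: B); clear; lia.
Qed.

Lemma run_program : exists k st Q,
  [/\ exec program (init_state (input_word outs ins)) k st, k <= 4000 * n, emitted Q (out st),
      uniq Q & (forall v, v \in Q) /\ pairwise (fun a b => ~~ le b a) Q].
Proof.
pose ls := [seq (map val (outs v), map val (ins v)) | v <- enum 'I_n].
have sz : size ls = n by rewrite size_map size_enum_ord.
have nthls (v : 'I_n) : nth ([::], [::]) ls v = (map val (outs v), map val (ins v)).
  by rewrite (nth_map v) ?size_enum_ord // nth_ord_enum.
have inp : input_word outs ins = size ls :: flatten (map vword ls).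
  rewrite /input_word sz; congr (_ :: flatten _); rewrite /ls -[RHS]map_comp; apply: eq_map => v.
  by rewrite /vword /= !size_map.
have srcP v : v < size ls -> (nth ([::], [::]) ls v).2 = [::] <-> v = s.
  rewrite sz => vn; rewrite -[v]/(val (Ordinal vn)) nthls /=; set w := Ordinal vn.
  have nil_map : map val (ins w) = [::] <-> ins w = [::] by case: (ins w).
  rewrite nil_map; split=> [i0|ws].
    have ew : w = s; last by rewrite -ew.
    apply/eqP; rewrite eq_sym; apply: contraT => sw.
    have [c] : exists2 c, e c w & le s c by apply: last_step; rewrite /ltc sw (ts_src W).
    by rewrite -(ts_ins W) i0.
  have -> : w = s by apply: val_inj.
  case E : (ins s) => [//|c l]; have : e c s by rewrite -(ts_ins W) E mem_head.
  by move/acy; rewrite (ts_src W).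
(* Out-lists and in-lists have at most [4 n] entries each, hence [100 * 8 n] steps, and 300 more per
   vertex. *)
have cost : sumn (map vcost ls) <= 1100 * n.
  rewrite sumnE big_map big_map big_enum /= (eq_bigl predT) //.
  have := leq_add (sum_outs W) (sum_ins W); rewrite card_ord -big_split /= => le8.
  rewrite (eq_bigr (fun v => 100 * (size (outs v) + size (ins v)) + 300)); last first.
    by move=> v _; rewrite /vcost /= !size_map.
  rewrite big_split /= -big_distrr /= sum_nat_const card_ord.
  by move: le8; set S := \sum_(_ | _) _; move: S; clear; lia.
(* Since there is a vertex, a multiple of [n] absorbs the additive constants. *)
have n0 : 0 < n by apply: leq_ltn_trans (ltn_ord s).
have [k1 [st1 [ex1 c1 [rn rx o cl z]]]] : runs parse (init_state (input_word outs ins))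
    (100 * n.+1 + 1100 * n) (fun st => [/\ reg st r_n = n, reg st r_x = s, out st = [::],
      enc outs ins st & forall i, arr st a_em i = 0 /\ arr st a_mk i = 0]).
  rewrite inp; eapply runs_le; first apply: run_parse srcP.
  - by rewrite sz.
  - by rewrite sz leq_add2l.
  move=> st [rn rx o cl z]; rewrite sz in rn cl; split=> // v.
  by have := cl v (ltn_ord v); rewrite nthls.
have [k2 [st2 [ex2 c2 [Q [em UQ Qa pw]]]]] := run_decompose cl rn rx o z.
exists (k1 + k2).+1, st2, Q; split=> //; first exact: exec_seq ex1 ex2.
by move: c1 c2 n0; clear; lia.
Qed.
End Main.

(** * Upward planar drawings and their external face *)

Import Order.TTheory GRing.Theory Num.Theory.
Import numFieldNormedType.Exports.

Section Planar.
Local Open Scope classical_set_scope.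
Local Open Scope ring_scope.
Variables (R : realType) (n : nat) (d : drawing R n) (H : digraph n).
Hypothesis up : upward_planar d H.
Hypothesis wf : wf_digraph H.
Local Notation X := (xcurve d).
Local Notation Y := (ypos d).
Local Notation E := (edges H).

Lemma edge_verts e : e \in E -> e.1 \in verts H /\ e.2 \in verts H.
Proof. by case: e => u v /wf. Qed.

Lemma edge_Y e : e \in E -> Y e.1 < Y e.2.
Proof. by case: up => _ h _ _ /h[]. Qed.

Lemma edge_bot e : e \in E -> X e (Y e.1) = xpos d e.1.
Proof. by case: up => _ h _ _ /h[]. Qed.

Lemma edge_top e : e \in E -> X e (Y e.2) = xpos d e.2.
Proof. by case: up => _ h _ _ /h[]. Qed.

Lemma edge_cont e : e \in E -> {within `[Y e.1, Y e.2], continuous (X e)}.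
Proof. by case: up => _ h _ _ /h[]. Qed.

Lemma spans_bot e : e \in E -> spans d e (Y e.1).
Proof. by move=> eE; rewrite /spans lexx ltW // edge_Y. Qed.

Lemma spans_top e : e \in E -> spans d e (Y e.2).
Proof. by move=> eE; rewrite /spans lexx andbT ltW // edge_Y. Qed.

Lemma vertex_on e w : e \in E -> w \in verts H -> spans d e (Y w) ->
  X e (Y w) = xpos d w -> endpoint e w.
Proof. by case: up => _ _ h _ eE wH sp Xe; apply: h. Qed.

Lemma edges_meet e f y : e \in E -> f \in E -> spans d e y -> spans d f y -> X e y = X f y ->
  e = f \/ exists w, [/\ endpoint e w, endpoint f w & Y w = y].
Proof.
move=> eE fE se sf Xef; case: (eqVneq e f) => [|/eqP nef]; [by left|right].
case: up => _ _ _ /(_ e f (X e y, y) eE fE nef) [//|//|w [h1 h2 [_ ->]]].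
by exists w.
Qed.

(** Otherwise the difference of the two curves vanishes strictly between the two heights. The common
    point would be an end of [e], but [e] extends at least from the lower to the upper of these
    heights. *)
Lemma edges_nocross e f y1 y2 : e \in E -> f \in E -> spans d e y1 -> spans d f y1 ->
  spans d e y2 -> spans d f y2 -> X e y1 < X f y1 -> X e y2 <= X f y2.
Proof.
move=> eE fE e1 f1 e2 f2 lt1; rewrite leNgt; apply/negP => lt2.
pose g := X f - X e.
have gE y : g y = X f y - X e y by [].
suff [c [c1 c2] gc] : exists2 c, (Num.min y1 y2 < c /\ c < Num.max y1 y2) & g c = 0.
  have in12 (h : 'I_n * 'I_n) : spans d h y1 -> spans d h y2 ->
      Y h.1 <= Num.min y1 y2 /\ Num.max y1 y2 <= Y h.2.
    by rewrite /spans => /andP[a1 a2] /andP[a3 a4]; rewrite le_min ge_max a1 a2 a3 a4.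
  have [ea eb] := in12 e e1 e2; have [fa fb] := in12 f f1 f2.
  have ec : spans d e c by rewrite /spans !ltW // ?(le_lt_trans ea) // (lt_le_trans c2).
  have fc : spans d f c by rewrite /spans !ltW // ?(le_lt_trans fa) // (lt_le_trans c2).
  have Xc : X e c = X f c by move/eqP: gc; rewrite gE subr_eq0 => /eqP.
  case: (edges_meet eE fE ec fc Xc) => [ef|[w [[->|->] _ wc]]].
  - by rewrite ef ltxx in lt1.
  - by have := le_lt_trans ea c1; rewrite wc ltxx.
  - by have := lt_le_trans c2 eb; rewrite wc ltxx.
have cont a b : spans d e a -> spans d e b -> spans d f a -> spans d f b ->
    {within `[a, b], continuous g}.
  move=> /andP[ea _] /andP[_ eb] /andP[fa _] /andP[_ fb]; apply: within_continuousB.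
    apply: continuous_subspaceW (edge_cont fE) => z /=; rewrite !in_itv /= => /andP[za zb].
    by rewrite (le_trans fa za) (le_trans zb fb).
  apply: continuous_subspaceW (edge_cont eE) => z /=; rewrite !in_itv /= => /andP[za zb].
  by rewrite (le_trans ea za) (le_trans zb eb).
have g1 : 0 < g y1 by rewrite gE subr_gt0.
have g2 : g y2 < 0 by rewrite gE subr_lt0.
have [y12|y21] := leP y1 y2.
  have [|c] := @IVT R g y1 y2 0 y12 (cont _ _ e1 e2 f1 f2).
    by rewrite ge_min le_max (ltW g2) (ltW g1) orbT.
  rewrite in_itv /= => /andP[c1 c2] gc; exists c => //; split.
    by rewrite lt_neqAle c1 andbT; apply: contraTneq g1 => ->; rewrite gc ltxx.
  by rewrite lt_neqAle c2 andbT; apply: contraTneq g2 => <-; rewrite gc ltxx.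
have [|c] := @IVT R g y2 y1 0 (ltW y21) (cont _ _ e2 e1 f2 f1).
  by rewrite ge_min le_max (ltW g2) (ltW g1) orbT.
rewrite in_itv /= => /andP[c1 c2] gc; exists c => //; split.
  by rewrite lt_neqAle c1 andbT; apply: contraTneq g2 => ->; rewrite gc ltxx.
by rewrite lt_neqAle c2 andbT; apply: contraTneq g1 => <-; rewrite gc ltxx.
Qed.

Lemma edges_disjoint e f y1 y2 : e \in E -> f \in E -> spans d e y1 -> spans d f y1 ->
  spans d e y2 -> spans d f y2 -> X e y1 <= X f y1 -> X f y2 <= X e y2 ->
  (forall w, endpoint e w -> endpoint f w -> False) -> False.
Proof.
move=> eE fE e1 f1 e2 f2 le1 le2 ns.
have neq y : spans d e y -> spans d f y -> X e y != X f y.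
  move=> ey fy; apply/eqP => /(edges_meet eE fE ey fy)[ef|[w [h1 h2 _]]]; last exact: ns h1 h2.
  by apply: (ns e.1); [left|rewrite ef; left].
have := @edges_nocross f e y2 y1 fE eE f2 e2 f1 e1.
rewrite !lt_neqAle le2 eq_sym neq // => /(_ isT) h.
by move: (neq y1 e1 f1); rewrite eq_le le1 h.
Qed.

Lemma out_neq v a b y : (v, a) \in E -> (v, b) \in E -> a != b -> spans d (v, a) y ->
  spans d (v, b) y -> Y v < y -> X (v, a) y != X (v, b) y.
Proof.
move=> va vb nab sa sb vy; apply/eqP => /(edges_meet va vb sa sb)[[eab]|[w [h1 h2 wy]]].
  by rewrite eab eqxx in nab.
case: h1 => /= ew; first by rewrite -wy ew ltxx in vy.
case: h2 => /= ew'; first by rewrite -wy ew' ltxx in vy.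
by rewrite -ew -ew' eqxx in nab.
Qed.

Lemma in_neq v a b y : (a, v) \in E -> (b, v) \in E -> a != b -> spans d (a, v) y ->
  spans d (b, v) y -> y < Y v -> X (a, v) y != X (b, v) y.
Proof.
move=> va vb nab sa sb vy; apply/eqP => /(edges_meet va vb sa sb)[[eab]|[w [h1 h2 wy]]].
  by rewrite eab eqxx in nab.
case: h1 => /= ew; last by rewrite -wy ew ltxx in vy.
case: h2 => /= ew'; last by rewrite -wy ew' ltxx in vy.
by rewrite -ew -ew' eqxx in nab.
Qed.

Definition leftV (v : 'I_n) : Prop :=
  forall e, e \in E -> spans d e (Y v) -> xpos d v <= X e (Y v).
Definition rightV (v : 'I_n) : Prop :=
  forall e, e \in E -> spans d e (Y v) -> X e (Y v) <= xpos d v.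

Definition leftE (e : 'I_n * 'I_n) : Prop := e \in E /\
  forall f y, f \in E -> spans d e y -> spans d f y -> X e y <= X f y.
Definition rightE (e : 'I_n * 'I_n) : Prop := e \in E /\
  forall f y, f \in E -> spans d e y -> spans d f y -> X f y <= X e y.

(** The height of the lowest out-neighbour is spanned by all out-edges of [v], so they are compared
    there; their order cannot change at other heights. *)
Lemma leftmost_out v c : (v, c) \in E -> exists2 a, (v, a) \in E &
  forall b y, (v, b) \in E -> spans d (v, a) y -> spans d (v, b) y -> X (v, a) y <= X (v, b) y.
Proof.
move=> vc; pose P b := (v, b) \in E.
have [b0 Pb0 b0P] := arg_minP Y (vc : P c).
have [a Pa aP] := arg_minP (fun b => X (v, b) (Y b0)) (vc : P c).
exists a => // b y vb sa sb; have [->//|nab] := eqVneq a b.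
have sp b' : P b' -> spans d (v, b') (Y b0).
  by move=> Pb'; rewrite /spans (b0P _ Pb') andbT ltW // (edge_Y Pb0).
apply: (@edges_nocross (v, a) (v, b) (Y b0) y) => //; try exact: sp.
rewrite lt_neqAle aP // andbT; apply: out_neq => //; try exact: sp.
exact: edge_Y Pb0.
Qed.
End Planar.

Lemma connect_Y (R : realType) (n : nat) (d : drawing R n) (H : digraph n) u v :
  upward_planar d H -> connect (arc H) u v -> (ypos d u <= ypos d v ?= iff (u == v))%R.
Proof.
move=> up /connectP[p]; elim: p u => [|c p IH] u /=; first by move=> _ ->; split; rewrite ?eqxx.
case/andP=> uc cp lp; have lt_uc := edge_Y up uc; have [le_cv _] := IH c cp lp.
have lt_uv := lt_le_trans lt_uc le_cv; split; first exact: ltW.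
by rewrite lt_eqF //; apply/esym/negbTE; apply: contraTneq lt_uv => ->; rewrite ltxx.
Qed.

(** * The leftmost path from source to sink *)

Section StPaths.
Local Open Scope classical_set_scope.
Local Open Scope ring_scope.
Variables (R : realType) (n : nat) (d : drawing R n) (H : digraph n) (s t : 'I_n).
Hypothesis up : upward_planar d H.
Hypothesis st : st_digraph H s t.
Local Notation X := (xcurve d).
Local Notation Y := (ypos d).
Local Notation E := (edges H).

Let wf : wf_digraph H. Proof. by case: st. Qed.
Let acy : acyclic H. Proof. by case: st. Qed.

Lemma s_vert : s \in verts H.
Proof.
case: st => _ _ hs _; have : s \in [set s]%SET by rewrite inE.
by rewrite -hs inE => /andP[].
Qed.

Lemma in_arc v : v \in verts H -> v != s -> exists u, (u, v) \in E.
Proof.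
move=> vH vs; case: st => _ _ hs _; have : v \notin sources H by rewrite hs inE.
by rewrite inE vH /= negb_forall => /existsP[u]; rewrite negbK; exists u.
Qed.

Lemma out_arc v : v \in verts H -> v != t -> exists u, (v, u) \in E.
Proof.
move=> vH vs; case: st => _ _ _ hs; have : v \notin sinks H by rewrite hs inE.
by rewrite inE vH /= negb_forall => /existsP[u]; rewrite negbK; exists u.
Qed.

Lemma from_s v : v \in verts H -> connect (arc H) s v.
Proof.
have [k] := ubnP #|[pred w | Y w < Y v]|; elim: k v => // k IH v vk vH.
have [->|vs] := eqVneq v s; first exact: connect0.
have [u uv] := in_arc vH vs; have [uH _] := edge_verts wf uv; have lt_uv := edge_Y up uv.
apply: connect_trans (connect1 (uv : arc H u v)); apply: IH uH.
rewrite -ltnS; apply: leq_trans vk; rewrite ltnS; apply: proper_card; apply/properP.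
split; first by apply/fintype.subsetP => w; rewrite !inE => /lt_trans; apply.
by exists u; rewrite !inE ?lt_uv ?ltxx.
Qed.

Lemma to_t v : v \in verts H -> connect (arc H) v t.
Proof.
have [k] := ubnP #|[pred w | Y v < Y w]|; elim: k v => // k IH v vk vH.
have [->|vs] := eqVneq v t; first exact: connect0.
have [u uv] := out_arc vH vs; have [_ uH] := edge_verts wf uv; have lt_uv := edge_Y up uv.
apply: connect_trans (connect1 (uv : arc H v u)) _; apply: IH uH.
rewrite -ltnS; apply: leq_trans vk; rewrite ltnS; apply: proper_card; apply/properP.
split; first by apply/fintype.subsetP => w; rewrite !inE; apply: lt_trans.
by exists u; rewrite !inE ?lt_uv ?ltxx.
Qed.

Lemma Ys_le v : v \in verts H -> Y s <= Y v ?= iff (s == v).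
Proof. by move=> /from_s; exact: connect_Y. Qed.

Lemma Yt_ge v : v \in verts H -> Y v <= Y t ?= iff (v == t).
Proof. by move=> /to_t; exact: connect_Y. Qed.

(** Let [f] run left of the leftmost out-edge of [x]. If [f] starts no higher than [x], it must pass
    through the left vertex [x], and it has to start there, against the choice of the out-edge. If
    it starts higher, its lower end has an in-edge, which by induction is not left of the out-edge;
    so this lower end lies on the out-edge, and the two curves meet there instead of being strictly
    ordered. *)
Lemma out_edge_leftE x c : leftV d H x -> x \in verts H -> (x, c) \in E ->
  exists2 a, leftE d H (x, a) & leftV d H a.
Proof.
move=> xl xH xc; have [a xa aP] := leftmost_out up xc.
have lE : leftE d H (x, a).
  split=> // f y; have [k] := ubnP #|[pred w | Y w < Y f.1]|.
  elim: k f y => // k IH f y fk fE se sf; rewrite leNgt; apply/negP => lt_fe.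
  have [f1H _] := edge_verts wf fE.
  case/andP: (se) => /= xy ya; case/andP: (sf) => fy1 fy2.
  have [fx|xf] := leP (Y f.1) (Y x).
    have sfx : spans d f (Y x) by rewrite /spans fx (le_trans xy fy2).
    have sex : spans d (x, a) (Y x) by exact: (spans_bot up xa).
    have le1 := edges_nocross up fE xa sf se sfx sex lt_fe.
    have Xx := edge_bot up xa; rewrite /= in Xx; rewrite Xx in le1.
    have eqX : X f (Y x) = xpos d x by apply/eqP; rewrite eq_le le1 xl.
    case: (vertex_on up fE xH sfx eqX) => ex.
      case: f fE se sf lt_fe ex {fk f1H fy1 fy2 fx sfx le1 eqX} => f1 f2 /= fE se sf lt_fe ex.
      by subst f1; have := aP f2 y fE se sf; rewrite leNgt lt_fe.
    have eyx : y = Y x by apply/eqP; rewrite eq_le xy andbT; rewrite -ex in fy2.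
    by move: lt_fe; rewrite eyx Xx eqX ltxx.
  have fs : f.1 != s.
    apply/eqP => fs; have [le_s _] := Ys_le xH.
    by rewrite fs in xf; have := lt_le_trans xf le_s; rewrite ltxx.
  have [g gf] := in_arc f1H fs.
  have sf' : spans d f (Y f.1) by exact: (spans_bot up fE).
  have se' : spans d (x, a) (Y f.1) by rewrite /spans /= (ltW xf) (le_trans fy1 ya).
  have sg' : spans d (g, f.1) (Y f.1) by exact: (spans_top up gf).
  have le1 := edges_nocross up fE xa sf se sf' se' lt_fe.
  have Xg := edge_top up gf; rewrite /= in Xg.
  rewrite (edge_bot up fE) in le1.
  have : X (x, a) (Y f.1) <= X (g, f.1) (Y f.1).
    apply: IH => //=; rewrite -ltnS; apply: leq_trans fk; rewrite ltnS; apply: proper_card.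
    apply/properP; split; last by exists g; rewrite !inE ?ltxx // (edge_Y up gf).
    by apply/fintype.subsetP => w; rewrite !inE => /lt_trans; apply; exact: (edge_Y up gf).
  rewrite Xg => le2; have eqX : X (x, a) (Y f.1) = xpos d f.1 by apply/eqP; rewrite eq_le le1 le2.
  case: (vertex_on up xa f1H se' eqX) => /= ef1; first by rewrite ef1 ltxx in xf.
  have ey : y = Y f.1 by apply/eqP; rewrite eq_le fy1 andbT ef1.
  by move: lt_fe; rewrite ey (edge_bot up fE) eqX ltxx.
exists a => // f fE sf; have [_ /(_ f (Y a) fE (spans_top up xa) sf)] := lE.
by rewrite (edge_top up xa).
Qed.

Lemma s_leftV : leftV d H s.
Proof.
move=> f fE /andP[sf _]; have [f1H _] := edge_verts wf fE.
have [le1 eq1] := Ys_le f1H.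
have /eqP : Y s == Y f.1 by rewrite eq_le le1.
move/eqP; rewrite eq1 => /eqP ->; by rewrite (edge_bot up fE).
Qed.

Lemma leftmost_path : exists p, [/\ path (arc H) s p, last s p = t &
  forall e, e \in zip (s :: p) p -> leftE d H e].
Proof.
suff K x : x \in verts H -> leftV d H x -> exists p, [/\ path (arc H) x p, last x p = t &
    forall e, e \in zip (x :: p) p -> leftE d H e].
  exact: K s_vert s_leftV.
have [k] := ubnP #|[pred w | Y x < Y w]|; elim: k x => // k IH x xk xH xl.
have [->|xt] := eqVneq x t; first by exists [::].
have [c xc] := out_arc xH xt; have [a la al] := out_edge_leftE xl xH xc.
have xa : (x, a) \in E by case: la.
have lt_xa := edge_Y up xa; have [_ aH] := edge_verts wf xa.
have [||//|p [p1 p2 p3]] := IH a.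
- rewrite -ltnS; apply: leq_trans xk; rewrite ltnS; apply: proper_card; apply/properP.
  split; first by apply/fintype.subsetP => w; rewrite !inE; apply: lt_trans.
  by exists a; rewrite !inE ?lt_xa ?ltxx.
- exact: aH.
exists (a :: p); split=> //=; first by rewrite p1 andbT.
by move=> e; rewrite inE => /orP[/eqP ->//|/p3].
Qed.
End StPaths.

Section PathEdges.
Local Open Scope ring_scope.
Variables (R : realType) (n : nat) (d : drawing R n) (H : digraph n).
Hypothesis up : upward_planar d H.
Local Notation Y := (ypos d).

Lemma path_edge (x : 'I_n) p e : path (arc H) x p -> e \in zip (x :: p) p ->
  [/\ e \in edges H, e.1 \in x :: p & e.2 \in x :: p].
Proof.
elim: p x => [|c p IH] x //= /andP[xc cp]; rewrite inE => /orP[/eqP -> /=|/(IH _ cp)[h1 h2 h3]].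
  by split=> //; rewrite !inE ?eqxx ?orbT.
by split=> //; rewrite inE ?h2 ?h3 orbT.
Qed.

Lemma path_span (x : 'I_n) p (y : R) : path (arc H) x p -> p <> [::] -> Y x <= y <= Y (last x p) ->
  exists2 e, e \in zip (x :: p) p & spans d e y.
Proof.
elim: p x => [|c p IH] x //= /andP[xc cp] _ /andP[xy yl].
have [yc|cy] := leP y (Y c); first by exists (x, c); rewrite ?mem_head // /spans /= xy yc.
have pn : p <> [::] by move=> pn; rewrite pn /= leNgt cy in yl.
have [|e ep se] := IH c cp pn; first by rewrite (ltW cy).
by exists e => //; rewrite inE ep orbT.
Qed.

Lemma path_incident (x : 'I_n) p v : p <> [::] -> v \in x :: p ->
  exists2 e, e \in zip (x :: p) p & endpoint e v.
Proof.
elim: p x => [|c p IH] x //= _; rewrite inE => /orP[/eqP ->|vp].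
  by exists (x, c); [rewrite mem_head|left].
have [p0|/eqP pn] := eqVneq p [::].
  exists (x, c); first by rewrite mem_head.
  by right; move: vp; rewrite p0 inE => /eqP.
by have [e ep ev] := IH c pn vp; exists e => //; rewrite inE ep orbT.
Qed.
End PathEdges.

Definition mir (R : realType) (n : nat) (d : drawing R n) : drawing R n :=
  Drawing (fun v => - xpos d v)%R (ypos d) (fun e y => - xcurve d e y)%R.

Section Mirror.
Local Open Scope classical_set_scope.
Local Open Scope ring_scope.
Variables (R : realType) (n : nat) (d : drawing R n) (H : digraph n).

Lemma mir_upward_planar : upward_planar d H -> upward_planar (mir d) H.
Proof.
case=> h1 h2 h3 h4; split.
- move=> u v uH vH [/oppr_inj hx hy]; apply: h1 => //; by rewrite /pos hx hy.
- move=> e /h2[k1 k2 k3 k4]; split=> //=; [|by rewrite k3|by rewrite k4].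
  have -> : (fun y => - xcurve d e y) = cst 0 - xcurve d e.
    by apply/funext => y; rewrite -[RHS]/(0 - xcurve d e y) sub0r.
  apply: within_continuousB => //; apply: continuous_subspaceT; exact: cst_continuous.
- by move=> e w eE wH [sp /= /oppr_inj Xw]; apply: h3.
- move=> e f [x y] eE fE nef [/= se xe] [/= sf xf].
  have [||w [w1 w2 [wx wy]]] := h4 e f (- x, y) eE fE nef.
  + by split=> //=; rewrite xe opprK.
  + by split=> //=; rewrite xf opprK.
  by exists w; split=> //; rewrite /pos /= -wx -wy opprK.
Qed.

Lemma mir_rightV v : leftV (mir d) H v <-> rightV d H v.
Proof. by split=> h e eE se; have := h e eE se; rewrite /= lerN2. Qed.

Lemma mir_rightE e : leftE (mir d) H e <-> rightE d H e.
Proof.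
by split=> -[eE h]; split=> // f y fE se sf; have := h f y fE se sf; rewrite /= lerN2.
Qed.
End Mirror.

(** * The hull and the external face *)

Section Clamp.
Local Open Scope classical_set_scope.
Local Open Scope ring_scope.
Variables (R : realType).

(** Composing with [clamp] extends a curve by constants beyond its heights, which turns continuity
    on a closed interval into continuity on the line. *)
Definition clamp (a b y : R) : R := Num.max a (Num.min y b).

Lemma clamp_id a b y : a <= y <= b -> clamp a b y = y.
Proof. by case/andP=> ay yb; rewrite /clamp (min_idPl yb) (max_idPr ay). Qed.

Lemma clamp_in a b y : a <= b -> a <= clamp a b y <= b.
Proof. by move=> ab; rewrite /clamp le_max lexx /= ge_max ab /= ge_min lexx orbT. Qed.

Lemma clamp_continuous a b : continuous (clamp a b).
Proof.
move=> y; apply: (@continuous_max R R (cst a) (fun z => Num.min z b)); first exact: cvg_cst.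
by apply: (@continuous_min R R id (cst b)); [exact: cvg_id|exact: cvg_cst].
Qed.

Lemma clamp_extension a b (f : R -> R) : a <= b ->
  {within `[a, b], continuous f} -> continuous (f \o clamp a b).
Proof.
move=> ab /subspace_continuousP cf y U.
have yin : (`[a, b]%classic : set R) (clamp a b y) by rewrite /= in_itv /= clamp_in.
move=> /(cf _ yin) h.
have hh : \forall z \near y, (`[a, b]%classic : set R) (clamp a b z) -> U (f (clamp a b z)).
  exact: (@clamp_continuous a b y _ h).
suff : \forall z \near y, U (f (clamp a b z)) by [].
by near=> z; have := near hh z; apply=> //; rewrite /= in_itv /= clamp_in.
Unshelve. all: by end_near.
Qed.

Lemma near_above (g : R -> R) (x y : R) : {for y, continuous g} -> g y < x ->
  \forall z \near (x, y), g z.2 < z.1.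
Proof.
move=> gc lt_gx; have h : (fun z : R * R => z.1 - g z.2) @ (x, y) --> x - g y.
  by apply: cvgB; [exact: cvg_fst|apply: (@continuous_comp _ _ _ snd g (x, y)); [exact: cvg_snd|exact: gc]].
have := @cvgr_gt _ _ _ _ _ _ h 0; rewrite subr_gt0 => hh.
have h2 : \forall z \near (x, y), 0 < z.1 - g z.2 by exact: hh.
by apply: filterS h2 => z; rewrite subr_gt0.
Qed.

Lemma near_height (P : R -> Prop) (x y : R) : (\forall h \near y, P h) ->
  \forall z \near (x, y), P z.2.
Proof. by move=> hP; have := @cvg_snd _ _ (nbhs x) (nbhs y) _; apply. Qed.
End Clamp.

Section Face.
Local Open Scope classical_set_scope.
Local Open Scope ring_scope.
Variables (R : realType) (n : nat) (d : drawing R n) (H : digraph n) (s t : 'I_n).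
Hypothesis up : upward_planar d H.
Hypothesis st : st_digraph H s t.
Local Notation X := (xcurve d).
Local Notation Y := (ypos d).
Local Notation E := (edges H).
Let wf : wf_digraph H. Proof. by case: st. Qed.

(* The complement of the external face: the drawing and everything horizontally between two of its points. *)
Definition hull : set (R * R) :=
  [set z | exists x1 x2, [/\ drawn d H (x1, z.2), drawn d H (x2, z.2) & x1 <= z.1 <= x2]].

Lemma drawn_hull : drawn d H `<=` hull.
Proof. by move=> [x y] dz; exists x, x; rewrite lexx. Qed.

Lemma drawn_edge e y : e \in E -> spans d e y -> drawn d H (X e y, y).
Proof. by move=> eE se; right; exists e. Qed.

Lemma drawn_vertex v : v \in verts H -> drawn d H (pos d v).
Proof. by move=> vH; left; exists v. Qed.

Lemma drawn_height z : drawn d H z -> Y s <= z.2 <= Y t.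
Proof.
case=> [[v vH ->]|[e eE [/andP[h1 h2] _]]] /=.
  by rewrite (Ys_le up st vH) (Yt_ge up st vH).
have [e1 e2] := edge_verts wf eE.
by rewrite (le_trans _ h1) ?(Ys_le up st e1) // (le_trans h2) // (Yt_ge up st e2).
Qed.

Lemma drawn_cases z : drawn d H z ->
  (exists e, [/\ e \in E, spans d e z.2 & z.1 = X e z.2]) \/ z = pos d s.
Proof.
case=> [[v vH ->]|[e eE [h1 h2]]]; last by left; exists e.
have [->|vs] := eqVneq v s; [by right|left].
have [u uv] := in_arc st vH vs; exists (u, v); split=> //=; first exact: (spans_top up uv).
by rewrite (edge_top up uv).
Qed.

Lemma span_bottom e : e \in E -> spans d e (Y s) -> X e (Y s) = xpos d s.
Proof.
move=> eE /andP[h _]; have [e1 _] := edge_verts wf eE; have [le1 eq1] := Ys_le up st e1.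
have : Y s == Y e.1 by rewrite eq_le le1.
by rewrite eq1 => /eqP ->; rewrite (edge_bot up eE).
Qed.

Lemma span_top' e : e \in E -> spans d e (Y t) -> X e (Y t) = xpos d t.
Proof.
move=> eE /andP[_ h]; have [_ e1] := edge_verts wf eE; have [le1 eq1] := Yt_ge up st e1.
have : Y e.2 == Y t by rewrite eq_le le1.
by rewrite eq1 => /eqP <-; rewrite (edge_top up eE).
Qed.

(** Neighbouring heights may leave the range of [e]. If [y] is the height of an end of [e], an edge
    into the lower end or out of the upper end continues [e]; it exists because [y] is strictly
    between the heights of [s] and [t]. *)
Lemma near_right_of_edge e x y : e \in E -> spans d e y -> X e y < x -> Y s < y < Y t ->
  \forall z \near (x, y), exists2 x1, drawn d H (x1, z.2) & x1 <= z.1.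
Proof.
move=> eE se lt_ex /andP[sy yt].
have ext f : f \in E -> spans d f y -> X f y < x ->
    \forall z \near (x, y), spans d f z.2 -> X f z.2 < z.1.
  move=> fE sf lt_fx; have ab := ltW (edge_Y up fE).
  have c := clamp_extension ab (edge_cont up fE).
  have := @near_above R _ x y (c y); rewrite /= clamp_id // => /(_ lt_fx).
  by apply: filterS => z h sz; move: h; rewrite clamp_id.
have he := ext e eE se lt_ex; case/andP: (se) => ey1 ey2.
have [eb|nb] := eqVneq y (Y e.1).
  have es : e.1 != s by apply: contraTneq sy => es; rewrite eb es ltxx.
  have [e1 _] := edge_verts wf eE; have [u ue] := in_arc st e1 es.
  have Xy : X (u, e.1) y = X e y by rewrite eb (edge_top up ue) (edge_bot up eE).
  have su : spans d (u, e.1) y by rewrite eb; exact: (spans_top up ue).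
  have hu := ext (u, e.1) ue su; rewrite Xy in hu; have {}hu := hu lt_ex.
  have lo : \forall z \near (x, y), Y u < z.2 /\ z.2 < Y e.2.
    apply: (@near_height _ (fun h => Y u < h /\ h < Y e.2)); apply: filterI.
      by apply: lt_nbhsr; rewrite eb (edge_Y up ue).
    by apply: lt_nbhsl; rewrite eb (edge_Y up eE).
  near=> z; have [l1 l2] : Y u < z.2 /\ z.2 < Y e.2 by near: z.
  have [zl|zh] := leP z.2 y.
    have sz : spans d (u, e.1) z.2 by rewrite /spans /= ltW //= -eb.
    by exists (X (u, e.1) z.2); [exact: drawn_edge|apply: ltW; move: sz; near: z].
  have sz : spans d e z.2 by rewrite /spans -eb !ltW.
  by exists (X e z.2); [exact: drawn_edge|apply: ltW; move: sz; near: z].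
have [et|nt] := eqVneq y (Y e.2).
  have es : e.2 != t by apply: contraTneq yt => es; rewrite et es ltxx.
  have [_ e1] := edge_verts wf eE; have [u ue] := out_arc st e1 es.
  have Xy : X (e.2, u) y = X e y by rewrite et (edge_bot up ue) (edge_top up eE).
  have su : spans d (e.2, u) y by rewrite et; exact: (spans_bot up ue).
  have hu := ext (e.2, u) ue su; rewrite Xy in hu; have {}hu := hu lt_ex.
  have lo : \forall z \near (x, y), Y e.1 < z.2 /\ z.2 < Y u.
    apply: (@near_height _ (fun h => Y e.1 < h /\ h < Y u)); apply: filterI.
      by apply: lt_nbhsr; rewrite et (edge_Y up eE).
    by apply: lt_nbhsl; rewrite et (edge_Y up ue).
  near=> z; have [l1 l2] : Y e.1 < z.2 /\ z.2 < Y u by near: z.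
  have [zl|zh] := leP z.2 y.
    have sz : spans d e z.2 by rewrite /spans /= ltW //= -et.
    by exists (X e z.2); [exact: drawn_edge|apply: ltW; move: sz; near: z].
  have sz : spans d (e.2, u) z.2 by rewrite /spans -et !ltW.
  by exists (X (e.2, u) z.2); [exact: drawn_edge|apply: ltW; move: sz; near: z].
have lo : \forall z \near (x, y), Y e.1 < z.2 /\ z.2 < Y e.2.
  apply: (@near_height _ (fun h => Y e.1 < h /\ h < Y e.2)); apply: filterI.
    by apply: lt_nbhsr; rewrite lt_neqAle eq_sym nb.
  by apply: lt_nbhsl; rewrite lt_neqAle nt.
near=> z; have [l1 l2] : Y e.1 < z.2 /\ z.2 < Y e.2 by near: z.
have sz : spans d e z.2 by rewrite /spans !ltW.
by exists (X e z.2); [exact: drawn_edge|apply: ltW; move: sz; near: z].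
Unshelve. all: by end_near.
Qed.
End Face.

Section Hull.
Local Open Scope classical_set_scope.
Local Open Scope ring_scope.
Variables (R : realType) (n : nat) (d : drawing R n) (H : digraph n) (s t : 'I_n).
Hypothesis up : upward_planar d H.
Hypothesis st : st_digraph H s t.
Local Notation X := (xcurve d).
Local Notation Y := (ypos d).
Local Notation E := (edges H).
Let wf : wf_digraph H. Proof. by case: st. Qed.

Lemma drawn_mir z : drawn (mir d) H z <-> drawn d H (- z.1, z.2).
Proof.
case: z => x y /=; split=> [[[v vH [-> ->]]|[e eE [se /= xe]]]|[[v vH [xv ->]]|[e eE [se /= xe]]]].
- by left; exists v; rewrite //= opprK.
- by right; exists e => //; split=> //=; rewrite xe opprK.
- by left; exists v; rewrite // /pos /= -xv opprK.
- by right; exists e => //; split=> //=; rewrite -xe opprK.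
Qed.

Lemma near_left_of_edge e x y : e \in E -> spans d e y -> x < X e y -> Y s < y < Y t ->
  \forall z \near (x, y), exists2 x1, drawn d H (x1, z.2) & z.1 <= x1.
Proof.
move=> eE se lt_xe syt.
have := @near_right_of_edge _ _ (mir d) H s t (mir_upward_planar up) st e (- x) y eE se _ syt.
rewrite /= ltrN2 => /(_ lt_xe) h.
have c : {for (x, y), continuous (fun z : R * R => (- z.1, z.2) : R * R)}.
  apply: (@cvg_pair _ _ _ (nbhs (x, y)) (nbhs (- x)) (nbhs y)); last exact: cvg_snd.
  by apply: continuous_comp; [exact: cvg_fst|exact: opp_continuous].
have := c _ h => h2; have h3 : \forall z \near (x, y),
    exists2 x1, drawn (mir d) H (x1, z.2) & x1 <= - z.1 by exact: h2.
near=> z; have [x1 /drawn_mir /= dx le1] : exists2 x1, drawn (mir d) H (x1, z.2) & x1 <= - z.1.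
  by near: z; exact: h3.
by exists (- x1) => //; rewrite lerNr.
Unshelve. all: by end_near.
Qed.

Lemma hull_interior e f x y : e \in E -> f \in E -> spans d e y -> spans d f y ->
  X e y < x < X f y -> \forall z \near (x, y), hull d H z.
Proof.
move=> eE fE se sf /andP[ex xf]; have lt_ef := lt_trans ex xf.
have /andP[sy yt] := drawn_height up st (drawn_edge eE se).
(* At the heights of [s] and [t] all edges pass through that vertex, so nothing is strictly between
   two of them. *)
have syt : Y s < y < Y t.
  rewrite !lt_neqAle sy yt !andbT; apply/andP; split.
    by apply: contraTneq lt_ef => ys; rewrite -ys in se sf *; rewrite !(span_bottom up st) ?ltxx.
  by apply: contraTneq lt_ef => ys; rewrite ys in se sf *; rewrite !(span_top' up st) ?ltxx.
have h1 := near_right_of_edge up st eE se ex syt.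
have h2 := near_left_of_edge fE sf xf syt.
near=> z; have [x1 d1 l1] : exists2 x1, drawn d H (x1, z.2) & x1 <= z.1.
  by near: z; exact: h1.
have [x2 d2 l2] : exists2 x2, drawn d H (x2, z.2) & z.1 <= x2.
  by near: z; exact: h2.
by exists x1, x2; split=> //; rewrite l1 l2.
Unshelve. all: by end_near.
Qed.

(** Every vertex except [s] is the upper end of an edge, so that apart from [s] the hull is bounded
    by edges alone. *)
Lemma hull_cases z : hull d H z -> z = pos d s \/
  exists e f, [/\ e \in E /\ f \in E, spans d e z.2 /\ spans d f z.2 & X e z.2 <= z.1 <= X f z.2].
Proof.
case: z => x y [x1 [x2 [/(drawn_cases up st) /= h1 /(drawn_cases up st) /= h2 /= /andP[l1 l2]]]].
case: h1 h2 => [[e [eE se e1]]|[e1 ey]] [[f [fE sf f1]]|[f1 fy]].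
- by right; exists e, f; rewrite -e1 -f1 l1 l2.
- right; exists e, e; split=> //=; rewrite -e1 l1 /=.
  by rewrite e1 fy (span_bottom up st eE) -?fy // -f1.
- right; exists f, f; split=> //=; rewrite -f1 l2 andbT.
  by rewrite f1 ey (span_bottom up st fE) -?ey // -e1.
- by left; rewrite /pos -ey; congr (_, _); apply/eqP; rewrite eq_le -{1}f1 l2 -e1 l1.
Qed.

Lemma hull_edges e f z : e \in E -> f \in E -> spans d e z.2 -> spans d f z.2 ->
  X e z.2 <= z.1 <= X f z.2 -> hull d H z.
Proof. by move=> eE fE se sf le; exists (X e z.2), (X f z.2); split=> //; exact: drawn_edge. Qed.

Lemma closed_ge_fun (h : R * R -> R) : continuous h -> closed [set z | 0 <= h z].
Proof.
move=> hc; have -> : [set z | 0 <= h z] = h @^-1` [set x | 0 <= x] by [].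
by apply: closed_comp; [move=> z _; exact: hc|exact: closed_ge].
Qed.

(** Apart from [s] the hull is a finite union over pairs of edges, and with the curves extended by
    [clamp] each part is given by weak inequalities between continuous functions. *)
Lemma hull_closed : closed (hull d H).
Proof.
pose g e := X e \o clamp (Y e.1) (Y e.2).
have gc e : e \in E -> continuous (g e).
  by move=> eE; apply: clamp_extension; [exact: ltW (edge_Y up eE)|exact: (edge_cont up eE)].
have gE e y : spans d e y -> g e y = X e y by move=> se; rewrite /g /= clamp_id.
pose Pc (i : ('I_n * 'I_n) * ('I_n * 'I_n)) : set (R * R) :=
  [set z | 0 <= z.2 - Y i.1.1] `&` [set z | 0 <= Y i.1.2 - z.2] `&`
  ([set z | 0 <= z.2 - Y i.2.1] `&` [set z | 0 <= Y i.2.2 - z.2]) `&`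
  ([set z | 0 <= z.1 - g i.1 z.2] `&` [set z | 0 <= g i.2 z.2 - z.1]).
have -> : hull d H = [set pos d s] `|`
    \bigcup_(i in [set i | (i.1 \in E) && (i.2 \in E)]) Pc i.
  apply/seteqP; split=> [z|z [->|[[e f] /= /andP[eE fE]]]].
  - case/hull_cases=> [->|[e [f [[eE fE] [se sf] /andP[l1 l2]]]]]; [by left|right].
    exists (e, f); first by rewrite /= eE fE.
    rewrite /Pc /= !subr_ge0 !gE //; case/andP: se => -> ->; case/andP: sf => -> ->.
    by rewrite l1 l2.
  - by apply: drawn_hull; apply: drawn_vertex; exact: (s_vert st).
  - rewrite /Pc /= !subr_ge0 => -[[[a1 a2] [b1 b2]] [c1 c2]].
    have se : spans d e z.2 by rewrite /spans a1 a2.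
    have sf : spans d f z.2 by rewrite /spans b1 b2.
    by apply: (hull_edges eE fE) => //; rewrite -!gE // c1 c2.
have c1 : continuous (fst : R * R -> R) by move=> z; exact: cvg_fst.
have c2 : continuous (snd : R * R -> R) by move=> z; exact: cvg_snd.
have cst' k : continuous (cst k : R * R -> R) by move=> z; exact: cvg_cst.
have cg e : e \in E -> continuous (fun z : R * R => g e z.2).
  by move=> eE z; apply: (@continuous_comp _ _ _ snd (g e) z); [exact: c2|exact: gc].
apply: closedU; first exact: accessible_closed_set1 (hausdorff_accessible (@norm_hausdorff _ _)) _.
apply: closed_bigcup; first exact: finite_finset.
move=> [e f] /= /andP[eE fE].
by do !apply: closedI; apply: closed_ge_fun => z /=; apply: cvgB;
  do ?[exact: c1|exact: c2|exact: cst'|exact: cg].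
Qed.

Lemma hull_bounded : bounded_set (hull d H).
Proof.
have /choice[M MP] : forall e, exists M : R, e \in E -> forall y, spans d e y -> `|X e y| <= M.
  move=> e; have [eE|neE] := boolP (e \in E); last by exists 0.
  have ab := ltW (edge_Y up eE).
  have [c1 _ c1P] := EVT_max ab (edge_cont up eE).
  have [c2 _ c2P] := EVT_min ab (edge_cont up eE).
  exists (`|X e c1| + `|X e c2|) => _ y sy; rewrite ler_norml; apply/andP; split.
    have := c2P y; rewrite in_itv /= => /(_ sy) h.
    by rewrite opprD; have := ler_norm (- X e c2); rewrite normrN; have := normr_ge0 (X e c1); lra.
  have := c1P y; rewrite in_itv /= => /(_ sy) h.
  by have := ler_norm (X e c1); have := normr_ge0 (X e c2); lra.
pose B := `|xpos d s| + \sum_e `|M e|.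
have sum0 : 0 <= \sum_e `|M e| by apply: sumr_ge0.
have drawnB z : drawn d H z -> `|z.1| <= B.
  case/(drawn_cases up st)=> [[e [eE se ->]]|->]; last by rewrite /B /=; lra.
  have le1 := MP e eE _ se; rewrite /B (bigD1 e) //=.
  have : 0 <= \sum_(i | i != e) `|M i| by apply: sumr_ge0.
  by have := ler_norm (M e); have := normr_ge0 (xpos d s); lra.
pose C := B + (`|Y s| + `|Y t|).
exists C; split; first exact: num_real.
move=> K CK [x y] [x1 [x2 [d1 d2 /= /andP[l1 l2]]]].
have /= h1 := drawnB _ d1; have /= h2 := drawnB _ d2.
have /= /andP[ys yt] := drawn_height up st d1.
apply: le_trans (ltW CK); rewrite [X in X <= _]prod_normE /= ge_max; apply/andP; split.
  have : - B <= x <= B.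
    move: h1 h2; rewrite !ler_norml => /andP[k1 k2] /andP[k3 k4].
    by rewrite (le_trans k1 l1) (le_trans l2 k4).
  rewrite -ler_norml => h; rewrite /C; have := normr_ge0 (Y s); have := normr_ge0 (Y t); lra.
have B0 : 0 <= B by rewrite /B; have := normr_ge0 (xpos d s); lra.
have : `|y| <= `|Y s| + `|Y t|.
  rewrite ler_norml; apply/andP; split.
    by have := ler_norm (- Y s); rewrite normrN; have := normr_ge0 (Y t); lra.
  by have := ler_norm (Y t); have := normr_ge0 (Y s); lra.
rewrite /C; lra.
Qed.

Lemma ray_unbounded (x y : R) (A : set (R * R)) :
  (forall u, x <= u -> A (u, y)) \/ (forall u, u <= x -> A (u, y)) -> ~ bounded_set A.
Proof.
move=> h [M [_ hM]]; have /(_ _) hM1 := hM (`|M| + 1) _.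
have {}hM1 : forall z, A z -> `|z| <= `|M| + 1.
  by apply: hM1; have := ler_norm M; lra.
pose N := `|x| + `|M| + 2.
have N0 : 0 <= N by rewrite /N; have := normr_ge0 x; have := normr_ge0 M; lra.
have [u Au Nu] : exists2 u, A (u, y) & N <= `|u|.
  case: h => h; [exists N|exists (- N)]; rewrite ?normrN ?ger0_norm //; apply: h.
    by rewrite /N; have := ler_norm x; have := normr_ge0 M; lra.
  by rewrite /N; have := ler_norm (- x); rewrite normrN; have := normr_ge0 M; lra.
have := hM1 _ Au; rewrite [X in X <= _]prod_normE /= ge_max => /andP[h1 _].
by have := le_trans Nu h1; rewrite /N; have := normr_ge0 x; lra.
Qed.

Lemma ray_component (x y : R) (D : set (R * R)) :
  (forall u, x <= u -> ~ D (u, y)) \/ (forall u, u <= x -> ~ D (u, y)) ->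
  ~ bounded_set (connected_component (~` D) (x, y)).
Proof.
move=> h; pose S : set R := if `[< forall u, x <= u -> ~ D (u, y) >] then `[x, +oo[%classic else `]-oo, x]%classic.
have SD : forall u, S u -> ~ D (u, y).
  move=> u; rewrite /S; case: asboolP => [hr|nr].
    by rewrite /= in_itv /= andbT; exact: hr.
  by case: h => // hl; rewrite /= in_itv /=; exact: hl.
have cS : connected ((fun u => (u, y)) @` S).
  apply: connected_continuous_connected.
    by apply/connected_intervalP; rewrite /S; case: asboolP => _; exact: interval_is_interval.
  by apply: continuous_subspaceT => u; apply: (@cvg_pair _ _ _ (nbhs u) (nbhs u) (nbhs y)); [exact: cvg_id|exact: cvg_cst].
have Sx : S x by rewrite /S; case: asboolP => _; rewrite /= in_itv /= lexx.
have sub : (fun u => (u, y)) @` S `<=` connected_component (~` D) (x, y).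
  by apply: connected_component_max => //; [exists x|move=> _ [u Su <-]; exact: SD].
apply: (@ray_unbounded x y); case: h => h.
  left=> u xu; apply: sub; exists u => //; rewrite /S; case: asboolP => // _.
  by rewrite /= in_itv /= xu.
have [hr|nr] := pselect (forall u, x <= u -> ~ D (u, y)).
  left=> u xu; apply: sub; exists u => //; rewrite /S; case: asboolP => // _.
  by rewrite /= in_itv /= xu.
right=> u ux; apply: sub; exists u => //; rewrite /S; case: asboolP => // _.
Qed.

(** The hull minus the drawing is open and closed in the complement of the drawing, so a component
    that meets it stays in the bounded hull. From a point outside the hull, one of the two
    horizontal rays avoids the drawing. *)
Lemma external_faceE : external_face d H = ~` hull d H.
Proof.
apply/seteqP; split=> [z [nd nb] hz|[x y] nh].
  apply: nb; have [M [Mr hM]] := hull_bounded; exists M; split=> // K MK w [C [Cz CD cC] Cw].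
  apply: (hM K MK).
  have hC : C `&` hull d H = C.
    apply: cC; first by exists z.
    - exists (hull d H)°; first exact: open_interior.
      apply/seteqP; split=> v [Cv hv]; split=> //; last exact: interior_subset.
      have nv : ~ drawn d H v by exact: CD.
      case: (hull_cases hv) => [ev|[e [f [[eE fE] [se sf] /andP[l1 l2]]]]].
        by case: nv; rewrite ev; apply: drawn_vertex; exact: (s_vert st).
      case: v {Cv hv} nv se sf l1 l2 => vx vy /= nv se sf l1 l2.
      apply: (hull_interior eE fE se sf); rewrite !lt_neqAle l1 l2 !andbT.
      apply/andP; split; apply/eqP => ee; apply: nv.
        by rewrite -ee; exact: drawn_edge.
      by rewrite ee; exact: drawn_edge.
    - by exists (hull d H) => //; exact: hull_closed.
  by rewrite -hC in Cw; case: Cw.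
split; first by move=> /drawn_hull.
apply: ray_component.
have [hr|nr] := pselect (forall u, x <= u -> ~ drawn d H (u, y)); first by left.
right=> u ux du; apply: nr => w xw dw; apply: nh.
by exists u, w; split=> //=; rewrite ux xw.
Qed.
End Hull.

(** * The boundary of the external face and the two sides *)

Section Trace.
Local Open Scope classical_set_scope.
Local Open Scope ring_scope.
Variables (R : realType) (n : nat) (d : drawing R n) (H : digraph n) (s t : 'I_n).
Hypothesis up : upward_planar d H.
Hypothesis st : st_digraph H s t.
Local Notation X := (xcurve d).
Local Notation E := (edges H).
Let wf : wf_digraph H. Proof. by case: st. Qed.

Lemma trace_cases x p z : path (arc H) x p -> path_trace d (x :: p) z ->
  (exists e, [/\ e \in zip (x :: p) p, e \in E, spans d e z.2 & z.1 = X e z.2]) \/ z = pos d x.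
Proof.
move=> pp [[v vp ->]|[e ep [se ze]]]; last first.
  by left; exists e; split=> //; case: (path_edge pp ep).
have [p0|/eqP pn] := eqVneq p [::].
  by right; move: vp; rewrite p0 inE => /eqP ->.
have [e ep ev] := path_incident pn vp; have [eE _ _] := path_edge pp ep.
left; exists e; split=> //=; case: ev => ->.
- exact: (spans_bot up eE).
- exact: (spans_top up eE).
- by rewrite (edge_bot up eE).
- by rewrite (edge_top up eE).
Qed.

Lemma trace_drawn x p z : x \in verts H -> path (arc H) x p -> path_trace d (x :: p) z -> drawn d H z.
Proof.
move=> xH pp /(trace_cases pp)[[e [_ eE se ze]]|->]; last exact: drawn_vertex.
by right; exists e.
Qed.

Lemma left_trace_min p z x1 : path (arc H) s p -> (forall e, e \in zip (s :: p) p -> leftE d H e) ->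
  path_trace d (s :: p) z -> drawn d H (x1, z.2) -> z.1 <= x1.
Proof.
case: z => x y pp lp tr /(drawn_cases up st) /= h; case: (trace_cases pp tr) => /= [[e [ep eE se ->]]|[-> ey]].
  case: h => [[f [fE sf ->]]|[-> ey]]; first by case: (lp e ep) => _; exact.
  by rewrite ey (span_bottom up st eE) // -ey.
case: h => [[f [fE sf ->]]|[-> //]].
by rewrite ey (span_bottom up st fE) // -ey.
Qed.

(** Points of the same height just to the left are outside the hull. *)
Lemma min_not_interior z : (forall x1, drawn d H (x1, z.2) -> z.1 <= x1) -> ~ nbhs z (hull d H).
Proof.
case: z => x y /= mn hn.
have c : {for x, continuous (fun u : R => (u, y) : R * R)}.
  by apply: (@cvg_pair _ _ _ (nbhs x) (nbhs x) (nbhs y)); [exact: cvg_id|exact: cvg_cst].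
have h2 : \forall u \near x, hull d H (u, y) by exact: (c _ hn).
have h0 : \forall u \near x^'-, u < x by rewrite near_withinE; apply: nearW.
have h1 : \forall u \near x^'-, hull d H (u, y) by exact: cvg_within h2.
have h3 : \forall u \near x^'-, hull d H (u, y) /\ u < x by apply: filterI.
have [u [[x1 [x2 [/= d1 _ /andP[l1 _]]]] ux]] := @filter_ex _ _ (at_left_proper_filter x) _ h3.
by have := le_lt_trans (le_trans (mn _ d1) l1) ux; rewrite ltxx.
Qed.

Lemma closure_face z : closure (external_face d H) z <-> ~ nbhs z (hull d H).
Proof. by rewrite (external_faceE up st) closure_setC. Qed.

(** A vertex with an edge on its left and another on its right would be interior to the hull. *)
Lemma closure_face_side v : closure (external_face d H) (pos d v) -> leftV d H v \/ rightV d H v.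
Proof.
move=> /closure_face cl; have [|nl] := pselect (leftV d H v); [by left|right].
move=> f fE sf; rewrite leNgt; apply/negP => lf; apply: nl => e eE se.
rewrite leNgt; apply/negP => le; apply: cl.
by apply: (hull_interior up st eE fE se sf); rewrite le lf.
Qed.
End Trace.

Section Sides.
Local Open Scope classical_set_scope.
Local Open Scope ring_scope.
Variables (R : realType) (n : nat) (d : drawing R n) (H : digraph n) (s t : 'I_n).
Hypothesis up : upward_planar d H.
Hypothesis st : st_digraph H s t.
Local Notation X := (xcurve d).
Local Notation Y := (ypos d).
Local Notation E := (edges H).
Let wf : wf_digraph H. Proof. by case: st. Qed.

Lemma hull_mir z : hull (mir d) H z <-> hull d H (- z.1, z.2).
Proof.
split=> -[x1 [x2 [d1 d2 l12]]]; exists (- x2), (- x1).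
  move: d1 d2 => /drawn_mir /= d1 /drawn_mir /= d2; split=> //=.
  by rewrite !lerN2 andbC.
split; [apply/drawn_mir|apply/drawn_mir|]; rewrite /= ?opprK //.
by move: l12; rewrite /= lerNl lerNr andbC.
Qed.

Lemma trace_mir p z : path_trace (mir d) p z <-> path_trace d p (- z.1, z.2).
Proof.
case: z => x y; split=> [[[v vp [-> ->]]|[e ep [se /= xe]]]|[[v vp [xv ->]]|[e ep [se /= xe]]]].
- by left; exists v; rewrite //= opprK.
- by right; exists e => //; split=> //=; rewrite xe opprK.
- by left; exists v; rewrite // /pos /= -xv opprK.
- by right; exists e => //; split=> //=; rewrite -xe opprK.
Qed.

Lemma right_trace_max q z x1 : path (arc H) s q -> (forall e, e \in zip (s :: q) q -> rightE d H e) ->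
  path_trace d (s :: q) z -> drawn d H (x1, z.2) -> x1 <= z.1.
Proof.
move=> pq rq tr dr; have := @left_trace_min _ _ (mir d) H s t (mir_upward_planar up) st q
  (- z.1, z.2) (- x1) pq; rewrite /= lerN2; apply.
- by move=> e /rq /mir_rightE.
- by apply/trace_mir; rewrite /= opprK; case: (z) tr.
- by apply/drawn_mir; rewrite /= opprK.
Qed.

Lemma max_not_interior z : (forall x1, drawn d H (x1, z.2) -> x1 <= z.1) -> ~ nbhs z (hull d H).
Proof.
case: z => x y /= mx hn; apply: (@min_not_interior _ _ (mir d) H (- x, y)).
  by move=> x1 /drawn_mir /= /mx; rewrite lerNl.
have c : {for (- x, y), continuous (fun z : R * R => (- z.1, z.2) : R * R)}.
  apply: (@cvg_pair _ _ _ (nbhs (- x, y)) (nbhs (- - x)) (nbhs y)); last exact: cvg_snd.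
  by apply: (@continuous_comp _ _ _ fst (@GRing.opp R) (- x, y)); [exact: cvg_fst|exact: opp_continuous].
have h2 : \forall z \near (- x, y), hull d H (- z.1, z.2).
  by apply: c; rewrite /= opprK.
near=> z; apply/hull_mir; near: z; exact: h2.
Unshelve. all: by end_near.
Qed.

Lemma s_eq_t e : s = t -> e \in E -> False.
Proof.
move=> est eE; have [e1 e2] := edge_verts wf eE.
have [le1 _] := Ys_le up st e1; have [le2 _] := Yt_ge up st e2.
by have := le_lt_trans le1 (lt_le_trans (edge_Y up eE) le2); rewrite est ltxx.
Qed.

Lemma vertex_incident v : v \in verts H -> s <> t ->
  exists e, [/\ e \in E, spans d e (Y v) & X e (Y v) = xpos d v].
Proof.
move=> vH nst; have [->|vs] := eqVneq v s.
  have [c sc] := out_arc st (s_vert st) (introN eqP nst).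
  by exists (s, c); split=> //; [exact: (spans_bot up sc)|exact: (edge_bot up sc)].
have [c cv] := in_arc st vH vs.
by exists (c, v); split=> //; [exact: (spans_top up cv)|exact: (edge_top up cv)].
Qed.

(** At the height of a left vertex, the edges of the leftmost path can only pass through it. *)
Lemma left_on_path p v : path (arc H) s p -> last s p = t ->
  (forall e, e \in zip (s :: p) p -> leftE d H e) -> v \in verts H ->
  leftV d H v <-> v \in s :: p.
Proof.
move=> pp lst lp vH; have [est|nst] := eqVneq s t.
  have vs : v = s by have [] := Ys_le up st vH; have [] := Yt_ge up st vH;
    rewrite -est => h1 h2 h3 h4; apply/eqP; rewrite -h2 eq_le h1 h3.
  rewrite vs mem_head; split=> // _; exact: (s_leftV up st).
have pn : p <> [::] by move=> p0; move: lst nst; rewrite p0 /= => ->; rewrite eqxx.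
split=> [lv|vp].
  have [|e ep se] := path_span (y := Y v) pp pn (d := d).
    by rewrite lst (Ys_le up st vH) (Yt_ge up st vH).
  have [eE _ e2] := path_edge pp ep; have [_ e1 _] := path_edge pp ep.
  have [f [fE sf Xf]] := vertex_incident vH (elimN eqP nst).
  have Xe : X e (Y v) = xpos d v.
    apply/eqP; rewrite eq_le lv // andbT -Xf; case: (lp e ep) => _; exact.
  by case: (vertex_on up eE vH se Xe) => ->.
have [e ep ev] := path_incident pn vp; have [eE _ _] := path_edge pp ep.
move=> f fE sf; have [_ le] := lp e ep; case: ev => ev; rewrite ev in sf *.
  by rewrite -(edge_bot up eE); apply: le => //; exact: (spans_bot up eE).
by rewrite -(edge_top up eE); apply: le => //; exact: (spans_top up eE).
Qed.

(** A boundary point of the hull cannot lie strictly between the leftmost and the rightmost edge at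
    its height, so it is on one of them. Conversely, a point that is extreme at its height is not
    interior. *)
Lemma sides_of_paths p q : path (arc H) s p -> last s p = t ->
  (forall e, e \in zip (s :: p) p -> leftE d H e) ->
  path (arc H) s q -> last s q = t ->
  (forall e, e \in zip (s :: q) q -> rightE d H e) ->
  sides d H s t (s :: p) (s :: q).
Proof.
move=> pp lp Lp pq lq Rq; split; [by exists p|by exists q| |].
  apply/seteqP; split=> [z [cl nf]|z tr].
    have hz : hull d H z by apply: contrapT => nh; apply: nf; rewrite (external_faceE up st).
    move/(closure_face up st): cl => nn.
    case: (hull_cases up st hz) => [->|[e [f [[eE fE] [se sf] /andP[l1 l2]]]]].
      by left; left; exists s => //; rewrite mem_head.
    have nst : s <> t by move=> est; exact: (s_eq_t est eE).
    have yst := drawn_height up st (drawn_edge eE se); rewrite /= in yst.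
    have pn : p <> [::] by move=> p0; apply: nst; rewrite -lp p0.
    have qn : q <> [::] by move=> p0; apply: nst; rewrite -lq p0.
    have [|e1 ep1 se1] := path_span (y := z.2) pp pn (d := d); first by rewrite lp.
    have [|f1 fq1 sf1] := path_span (y := z.2) pq qn (d := d); first by rewrite lq.
    have [e1E le1] := Lp e1 ep1; have [f1E lf1] := Rq f1 fq1.
    have k1 := le_trans (le1 e _ eE se1 se) l1; have k2 := le_trans l2 (lf1 f _ fE sf1 sf).
    have [ez|nz1] := eqVneq (X e1 z.2) z.1; first by left; right; exists e1.
    have [ez|nz2] := eqVneq z.1 (X f1 z.2); first by right; right; exists f1.
    case: nn; have := @hull_interior _ _ d H s t up st e1 f1 z.1 z.2 e1E f1E se1 sf1.
    by rewrite !lt_neqAle nz1 k1 nz2 k2 => /(_ isT); case: (z).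
  have dz : drawn d H z.
    by case: tr; [apply: trace_drawn pp|apply: trace_drawn pq] => //; exact: (s_vert st).
  split; last by rewrite (external_faceE up st) => nh; apply: nh; exact: drawn_hull.
  apply/(closure_face up st); case: tr => tr.
    by apply: min_not_interior => x1; exact: (left_trace_min up st pp Lp tr).
  by apply: max_not_interior => x1; exact: (right_trace_max pq Rq tr).
move=> x x' y tp tq; apply: (left_trace_min up st pp Lp tp) => /=.
exact: (trace_drawn up (s_vert st) pq tq).
Qed.
End Sides.

Section StSides.
Local Open Scope classical_set_scope.
Local Open Scope ring_scope.
Variables (R : realType) (n : nat) (d : drawing R n) (H : digraph n) (s t : 'I_n).
Hypothesis up : upward_planar d H.
Hypothesis st : st_digraph H s t.

(** It is applied to [G] itself and to the intervals of [G]. *)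
Lemma st_sides : exists p q,
  [/\ [/\ path (arc H) s p, last s p = t & forall v, v \in verts H -> leftV d H v <-> v \in s :: p],
      [/\ path (arc H) s q, last s q = t & forall v, v \in verts H -> rightV d H v <-> v \in s :: q] &
      sides d H s t (s :: p) (s :: q)].
Proof.
have [p [p1 p2 p3]] := leftmost_path up st.
have [q [q1 q2 q3]] := leftmost_path (mir_upward_planar up) st.
exists p, q; split.
- by split=> // v vH; exact: left_on_path up st _ _ p1 p2 p3 vH.
- split=> // v vH; have := left_on_path (mir_upward_planar up) st q1 q2 q3 vH.
  by move=> <-; split=> /mir_rightV.
- by apply: (sides_of_paths up st p1 p2 p3 q1 q2) => e /q3 /mir_rightE.
Qed.
End StSides.

(** * Configurations that a planar drawing excludes *)

Section Crossings.
Local Open Scope classical_set_scope.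
Local Open Scope ring_scope.
Variables (R : realType) (n : nat) (d : drawing R n) (H : digraph n).
Hypothesis up : upward_planar d H.
Hypothesis wf : wf_digraph H.
Local Notation X := (xcurve d).
Local Notation Y := (ypos d).
Local Notation E := (edges H).
Local Notation leftV := (leftV d H).
Local Notation rightV := (rightV d H).

Lemma no_shared (a b a' b' w : 'I_n) : a != a' -> a != b' -> b != a' -> b != b' ->
  endpoint (a, b) w -> endpoint (a', b') w -> False.
Proof. by move=> n1 n2 n3 n4 [->|->] [] /= /eqP; apply/negP. Qed.

Lemma Y_neq u v : Y u < Y v -> u != v.
Proof. by apply: contraTneq => ->; rewrite ltxx. Qed.

Lemma Y_neq' u v : Y u < Y v -> v != u.
Proof. by apply: contraTneq => ->; rewrite ltxx. Qed.

Lemma leftV_bot u b e : leftV u -> (u, b) \in E -> e \in E -> spans d e (Y u) ->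
  X (u, b) (Y u) <= X e (Y u).
Proof. by move=> lu ub eE se; rewrite (edge_bot up ub); exact: lu. Qed.
Lemma leftV_top u b e : leftV u -> (b, u) \in E -> e \in E -> spans d e (Y u) ->
  X (b, u) (Y u) <= X e (Y u).
Proof. by move=> lu ub eE se; rewrite (edge_top up ub); exact: lu. Qed.
Lemma rightV_bot u b e : rightV u -> (u, b) \in E -> e \in E -> spans d e (Y u) ->
  X e (Y u) <= X (u, b) (Y u).
Proof. by move=> lu ub eE se; rewrite (edge_bot up ub); exact: lu. Qed.
Lemma rightV_top u b e : rightV u -> (b, u) \in E -> e \in E -> spans d e (Y u) ->
  X e (Y u) <= X (b, u) (Y u).
Proof. by move=> lu ub eE se; rewrite (edge_top up ub); exact: lu. Qed.

Lemma spansE a b y : spans d (a, b) y = (Y a <= y <= Y b).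
Proof. by []. Qed.

(** As in the next lemmas, boundary vertices force opposite orders of two edges at two heights, and
    [edges_disjoint] forbids this for edges without a common end. For arcs of opposite directions
    the two heights are the ends of the common range: the maximum of the lower ends and the minimum
    of the upper ends. *)
Lemma geo_cross l r l' r' : leftV l -> rightV r -> leftV l' -> rightV r' ->
  (l, r) \in E \/ (r, l) \in E -> (l', r') \in E \/ (r', l') \in E ->
  Y l < Y l' -> Y r' < Y r -> l != r' -> r != l' -> False.
Proof.
move=> lL rR lL' rR' e1 e2 ll rr n1 n2.
have := Y_neq ll; have := Y_neq' rr => n3 n4.
case: e1 e2 => [lr|rl] [lr'|rl'].
- have /= h1 := edge_Y up lr; have /= h2 := edge_Y up lr'.
  apply: (edges_disjoint (y1 := Y l') (y2 := Y r') up lr' lr); rewrite ?spansE ?lexx ?(ltW h2) //.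
  + by rewrite (ltW ll) (ltW (lt_trans h2 rr)).
  + by rewrite (ltW (lt_trans ll h2)) (ltW rr).
  + by apply: leftV_bot => //; rewrite spansE (ltW ll) (ltW (lt_trans h2 rr)).
  + by apply: rightV_top => //; rewrite spansE (ltW (lt_trans ll h2)) (ltW rr).
  + by move=> w; apply: no_shared; rewrite eq_sym // eq_sym.
- have /= h1 := edge_Y up lr; have /= h2 := edge_Y up rl'.
  have s1 : spans d (l, r) (Num.max (Y l) (Y r')).
    by rewrite spansE le_max lexx /= ge_max (ltW h1) (ltW rr).
  have s2 : spans d (r', l') (Num.max (Y l) (Y r')).
    by rewrite spansE le_max lexx orbT /= ge_max (ltW h2) (ltW ll).
  have s3 : spans d (l, r) (Num.min (Y r) (Y l')).
    by rewrite spansE ge_min lexx /= le_min (ltW h1) (ltW ll).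
  have s4 : spans d (r', l') (Num.min (Y r) (Y l')).
    by rewrite spansE ge_min lexx orbT /= le_min (ltW h2) (ltW rr).
  apply: (edges_disjoint up lr rl' s1 s2 s3 s4).
  + case: (leP (Y l) (Y r')) s1 s2 => _ s1 s2; first exact: rightV_bot.
    exact: leftV_bot.
  + case: (leP (Y r) (Y l')) s3 s4 => _ s3 s4; first exact: rightV_top.
    exact: leftV_top.
  + by move=> w; apply: no_shared.
- have /= h1 := edge_Y up rl; have /= h2 := edge_Y up lr'.
  by have := lt_trans h1 (lt_trans ll (lt_trans h2 rr)); rewrite ltxx.
- have /= h1 := edge_Y up rl; have /= h2 := edge_Y up rl'.
  apply: (edges_disjoint (y1 := Y l) (y2 := Y r) up rl rl'); rewrite ?spansE ?lexx ?(ltW h1) //.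
  + by rewrite (ltW (lt_trans rr h1)) (ltW ll).
  + by rewrite (ltW (lt_trans h1 ll)) (ltW rr).
  + by apply: leftV_top => //; rewrite spansE (ltW (lt_trans rr h1)) (ltW ll).
  + by apply: rightV_bot => //; rewrite spansE (ltW (lt_trans h1 ll)) (ltW rr).
  + by move=> w; apply: no_shared.
Qed.

Lemma geo_chord w m z r : leftV w -> leftV m -> leftV z -> rightV r ->
  (w, z) \in E -> Y w < Y m -> Y m < Y z -> (m, r) \in E \/ (r, m) \in E -> r != w -> r != z -> False.
Proof.
move=> wL mL zL rR wz wm mz e n1 n2.
have sm : spans d (w, z) (Y m) by rewrite spansE (ltW wm) (ltW mz).
have wz' := lt_trans wm mz.
case: e => [mr|rm].
  have /= h := edge_Y up mr.
  have sm' : spans d (m, r) (Y m) by rewrite spansE lexx (ltW h).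
  have s1 : spans d (w, z) (Num.min (Y r) (Y z)).
    by rewrite spansE ge_min lexx orbT le_min (ltW wz') (ltW (lt_trans wm h)).
  have s2 : spans d (m, r) (Num.min (Y r) (Y z)).
    by rewrite spansE ge_min lexx le_min (ltW mz) (ltW h).
  apply: (edges_disjoint up mr wz sm' sm s2 s1); first exact: leftV_bot.
    case: (leP (Y r) (Y z)) s1 s2 => _ s1 s2; first exact: rightV_top.
    exact: leftV_top.
  by move=> v; apply: no_shared => //; [exact: Y_neq'|exact: Y_neq].
have /= h := edge_Y up rm.
have sm' : spans d (r, m) (Y m) by rewrite spansE lexx (ltW h).
have s1 : spans d (w, z) (Num.max (Y r) (Y w)).
  by rewrite spansE le_max lexx orbT ge_max (ltW wz') (ltW (lt_trans h mz)).
have s2 : spans d (r, m) (Num.max (Y r) (Y w)).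
  by rewrite spansE le_max lexx ge_max (ltW wm) (ltW h).
apply: (edges_disjoint up rm wz sm' sm s2 s1); first exact: leftV_top.
  case: (leP (Y r) (Y w)) s1 s2 => _ s1 s2; first exact: leftV_bot.
  exact: rightV_bot.
by move=> v; apply: no_shared => //; [exact: Y_neq'|exact: Y_neq].
Qed.

Lemma geo_nest w m z m' : leftV m -> leftV z -> (w, z) \in E -> (m, m') \in E ->
  Y w < Y m -> Y m < Y z -> Y z < Y m' -> False.
Proof.
move=> mL zL wz mm wm mz zm.
have mm' := lt_trans mz zm; have wz' := lt_trans wm mz.
have s1 : spans d (m, m') (Y m) by rewrite spansE lexx (ltW mm').
have s2 : spans d (w, z) (Y m) by rewrite spansE (ltW wm) (ltW mz).
have s3 : spans d (m, m') (Y z) by rewrite spansE (ltW mz) (ltW zm).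
have s4 : spans d (w, z) (Y z) by rewrite spansE lexx (ltW wz').
apply: (edges_disjoint up mm wz s1 s2 s3 s4); [exact: leftV_bot|exact: leftV_top|].
move=> v; apply: no_shared; try exact: Y_neq; try exact: Y_neq'.
- by apply: Y_neq'; exact: lt_trans zm.
Qed.

Lemma geo_cut u m v : m \in verts H -> leftV m -> rightV m -> (u, v) \in E ->
  Y u < Y m -> Y m < Y v -> False.
Proof.
move=> mH mL mR uv um mv; have se : spans d (u, v) (Y m) by rewrite spansE (ltW um) (ltW mv).
have Xe : X (u, v) (Y m) = xpos d m by apply/eqP; rewrite eq_le mL // mR.
by case: (vertex_on up uv mH se Xe) => /= em; move: um mv; rewrite em ltxx.
Qed.

(** The order holds at some height just above [u] that both edges span, [edges_nocross] carries it
    along, and edges with a common lower end do not meet again. *)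
Lemma out_lt u a b y : (u, a) \in E -> (u, b) \in E -> a != b ->
  (\forall y \near (Y u)^'+, X (u, a) y < X (u, b) y) ->
  spans d (u, a) y -> spans d (u, b) y -> Y u < y -> X (u, a) y < X (u, b) y.
Proof.
move=> ua ub nab nr sa sb uy; rewrite lt_neqAle (out_neq up) //=.
pose m := Num.min (Y a) (Y b).
have um : Y u < m by rewrite lt_min (edge_Y up ua) (edge_Y up ub).
have h3 : \forall y \near (Y u)^'+, [/\ X (u, a) y < X (u, b) y, Y u < y & y <= m].
  near=> z; split; near: z; [exact: nr|exact: nbhs_right_gt|exact: nbhs_right_le].
have [z [lt_ab uz]] := @filter_ex _ _ (at_right_proper_filter (Y u)) _ h3.
rewrite le_min => /andP[za zb].
by apply: (edges_nocross up ua ub _ _ sa sb lt_ab); rewrite spansE (ltW uz).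
Unshelve. all: by end_near.
Qed.

Lemma in_lt v a b y : (a, v) \in E -> (b, v) \in E -> a != b ->
  (\forall y \near (Y v)^'-, X (a, v) y < X (b, v) y) ->
  spans d (a, v) y -> spans d (b, v) y -> y < Y v -> X (a, v) y < X (b, v) y.
Proof.
move=> ua ub nab nr sa sb uy; rewrite lt_neqAle (in_neq up) //=.
pose m := Num.max (Y a) (Y b).
have um : m < Y v by rewrite gt_max (edge_Y up ua) (edge_Y up ub).
have h3 : \forall y \near (Y v)^'-, [/\ X (a, v) y < X (b, v) y, y < Y v & m <= y].
  near=> z; split; near: z; [exact: nr|exact: nbhs_left_lt|exact: nbhs_left_ge].
have [z [lt_ab uz]] := @filter_ex _ _ (at_left_proper_filter (Y v)) _ h3.
rewrite ge_max => /andP[za zb].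
by apply: (edges_nocross up ua ub _ _ sa sb lt_ab); rewrite spansE (ltW uz) andbT.
Unshelve. all: by end_near.
Qed.

Section Out.
Variables u a b : 'I_n.
Hypotheses (ua : (u, a) \in E) (ub : (u, b) \in E) (nab : a != b).
Hypothesis nr : \forall y \near (Y u)^'+, X (u, a) y < X (u, b) y.

(** At the height of the lower of [a] and [b], an edge would pass to the right of [a] or to the left
    of [b]. *)
Lemma geo_outRL : rightV a -> leftV b -> False.
Proof.
move=> aR bL; have lt := out_lt ua ub nab nr.
have /= uay := edge_Y up ua; have /= uby := edge_Y up ub.
have [lab|lba] := leP (Y a) (Y b).
  have sb : spans d (u, b) (Y a) by rewrite spansE (ltW uay).
  have := lt _ (spans_top up ua) sb uay; rewrite (edge_top up ua) /=.
  by rewrite ltNge aR.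
have sa : spans d (u, a) (Y b) by rewrite spansE (ltW uby) (ltW lba).
have := lt _ sa (spans_top up ub) uby; rewrite (edge_top up ub) /=.
by rewrite ltNge bL.
Qed.

Lemma geo_outLL : leftV b -> Y a < Y b.
Proof.
move=> bL; have lt := out_lt ua ub nab nr; rewrite ltNge; apply/negP => lba.
have /= uby := edge_Y up ub.
have sa : spans d (u, a) (Y b) by rewrite spansE (ltW uby) lba.
have := lt _ sa (spans_top up ub) uby; rewrite (edge_top up ub) /=.
by rewrite ltNge bL.
Qed.
End Out.

Section In.
Variables v a b : 'I_n.
Hypotheses (av : (a, v) \in E) (bv : (b, v) \in E) (nab : a != b).
Hypothesis nr : \forall y \near (Y v)^'-, X (a, v) y < X (b, v) y.

Lemma geo_inRL : rightV a -> leftV b -> False.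
Proof.
move=> aR bL; have lt := in_lt av bv nab nr.
have /= avy := edge_Y up av; have /= bvy := edge_Y up bv.
have [lab|lba] := leP (Y a) (Y b).
  have sa : spans d (a, v) (Y b) by rewrite spansE (ltW bvy) lab.
  have := lt _ sa (spans_bot up bv) bvy; rewrite (edge_bot up bv) /=.
  by rewrite ltNge bL.
have sb : spans d (b, v) (Y a) by rewrite spansE (ltW avy) (ltW lba).
have := lt _ (spans_bot up av) sb avy; rewrite (edge_bot up av) /=.
by rewrite ltNge aR.
Qed.

Lemma geo_inLL : leftV b -> Y b < Y a.
Proof.
move=> bL; have lt := in_lt av bv nab nr; rewrite ltNge; apply/negP => lab.
have /= bvy := edge_Y up bv.
have sa : spans d (a, v) (Y b) by rewrite spansE (ltW bvy) lab.
have := lt _ sa (spans_bot up bv) bvy; rewrite (edge_bot up bv) /=.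
by rewrite ltNge bL.
Qed.
End In.
End Crossings.

(** * From the drawing to a two-sided digraph *)

Section PathOrder.
Variables (V : finType) (e : rel V).

Lemma path_from x p v : path e x p -> v \in x :: p -> connect e x v.
Proof.
elim: p x => [|c p IH] x /=; first by rewrite inE => _ /eqP ->.
case/andP=> xc cp; rewrite inE => /orP[/eqP ->|vp]; first exact: connect0.
exact: connect_trans (connect1 xc) (IH c cp vp).
Qed.

Lemma path_chain x p u v : path e x p -> u \in x :: p -> v \in x :: p ->
  connect e u v || connect e v u.
Proof.
elim: p x => [|c p IH] x; first by rewrite !inE => _ /eqP -> /eqP ->; rewrite connect0.
move=> xcp; have /andP[_ cp] := xcp.
rewrite [u \in _]inE [v \in _]inE => /orP[/eqP ->|up].
  by move=> vp; rewrite (path_from xcp vp).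
case/orP=> [/eqP ->|vp]; last exact: (IH c).
by rewrite orbC (path_from xcp) // inE up orbT.
Qed.

Lemma path_consecutive x p u v : (forall a b, e a b -> ~~ connect e b a) ->
  path e x p -> u \in x :: p -> v \in x :: p -> ltc e u v ->
  (forall w, w \in x :: p -> ltc e u w -> ltc e w v -> False) -> e u v.
Proof.
move=> acy; elim: p x => [|c p IH] x.
  by rewrite !inE => _ /eqP -> /eqP ->; rewrite (negbTE (ltc_irr e x)).
move=> xcp; have /andP[xc cp] := xcp.
rewrite [u \in _]inE => /orP[/eqP ->|up].
  rewrite inE => /orP[/eqP ->|vp]; first by rewrite (negbTE (ltc_irr e x)).
  move=> xv H; have [<-//|ncv] := eqVneq c v.
  case: (H c); first by rewrite inE mem_head orbT.
    exact: arc_ltc.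
  by rewrite /ltc ncv (path_from cp vp).
rewrite inE => /orP[/eqP ->|vp].
  have := path_from xcp; move=> h; have xu : connect e x u by apply: h; rewrite inE up orbT.
  by move=> /(ltc_leF acy); rewrite xu.
by move=> uv H; apply: (IH c cp up vp uv) => w wp; apply: H; rewrite inE wp orbT.
Qed.
End PathOrder.

Lemma pairwise_before (T : eqType) (r : rel T) (l : seq T) a b : pairwise r l -> before l a b -> r a b.
Proof.
move=> pw bf; have [al bl _] := before_mem bf; case/andP: bf => _ ltab.
have /(pairwiseP a)/(_ _ _ _ _ ltab) := pw; rewrite !inE !index_mem !nth_index //.
by apply.
Qed.

Section TwoSided.
Local Open Scope classical_set_scope.
Local Open Scope ring_scope.
Variables (R : realType) (n : nat) (d : drawing R n) (E : {set 'I_n * 'I_n}).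
Variables (outs ins : 'I_n -> seq 'I_n) (s t : 'I_n).
Let G : digraph n := ([set: 'I_n]%SET, E).
Hypothesis up : upward_planar d G.
Hypothesis st : st_digraph G s t.
Local Notation X := (xcurve d).
Local Notation Y := (ypos d).
Let wf : wf_digraph G. Proof. by case: st. Qed.

Definition inL (v : 'I_n) : bool := `[< leftV d G v >].
Definition inR (v : 'I_n) : bool := `[< rightV d G v >].

Lemma inLP v : reflect (leftV d G v) (inL v). Proof. exact: asboolP. Qed.
Lemma inRP v : reflect (rightV d G v) (inR v). Proof. exact: asboolP. Qed.

Lemma vertT (v : 'I_n) : v \in verts G. Proof. by rewrite /= inE. Qed.

Lemma ltc_Y u v : ltc (arc G) u v -> Y u < Y v.
Proof.
case/andP=> nuv uv; have [le1 eq1] := connect_Y up uv.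
by rewrite lt_neqAle le1 andbT eq1.
Qed.

Lemma edge_or u v : edge (arc G) u v -> (u, v) \in edges G \/ (v, u) \in edges G.
Proof. by case/orP; [left|right]. Qed.

Lemma before_out u a b : left_to_right (fun w => arc G u w)
      (fun a b => \forall y \near (Y u)^'+, X (u, a) y < X (u, b) y) (outs u) ->
  before (outs u) a b -> [/\ (u, a) \in edges G, (u, b) \in edges G, a != b &
    \forall y \near (Y u)^'+, X (u, a) y < X (u, b) y].
Proof.
case=> _ mem pw bf; have [al bl nab] := before_mem bf.
rewrite !mem in al bl; split=> //.
by have /asboolP := pairwise_before pw bf.
Qed.

Lemma before_in v a b : left_to_right (fun w => arc G w v)
      (fun a b => \forall y \near (Y v)^'-, X (a, v) y < X (b, v) y) (ins v) ->
  before (ins v) a b -> [/\ (a, v) \in edges G, (b, v) \in edges G, a != b &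
    \forall y \near (Y v)^'-, X (a, v) y < X (b, v) y].
Proof.
case=> _ mem pw bf; have [al bl nab] := before_mem bf.
rewrite !mem in al bl; split=> //.
by have /asboolP := pairwise_before pw bf.
Qed.

Lemma mir_leftV v : rightV (mir d) G v <-> leftV d G v.
Proof. by split=> h e eE se; have := h e eE se; rewrite /= lerN2. Qed.

Lemma planar_two_sided : (forall v, leftV d G v \/ rightV d G v) -> rotation d G outs ins ->
  two_sided (arc G) s t inL inR outs ins.
Proof.
move=> cov rot.
have [p [q [[p1 p2 p3] [q1 q2 q3] _]]] := st_sides up st.
have memp v : inL v = (v \in s :: p) by apply/inLP/idP => /(p3 v (vertT v)).
have memq v : inR v = (v \in s :: q) by apply/inRP/idP => /(q3 v (vertT v)).
have acy : forall u v, arc G u v -> ~~ connect (arc G) v u by case: st.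
have upm := mir_upward_planar up.
have chainL u v : inL u -> inL v -> connect (arc G) u v || connect (arc G) v u.
  by rewrite !memp; exact: path_chain.
have chainR u v : inR u -> inR v -> connect (arc G) u v || connect (arc G) v u.
  by rewrite !memq; exact: path_chain.
(* Within a chain, heights decide the direction of reachability. *)
have leY u v : connect (arc G) u v || connect (arc G) v u -> Y u < Y v -> connect (arc G) u v.
  case/orP=> // vu uv; have [le1 _] := connect_Y up vu.
  by have := lt_le_trans uv le1; rewrite ltxx.
have rotO v := proj1 (rot v); have rotI v := proj2 (rot v).
have mrR (P : Prop) v : inR v -> (leftV (mir d) G v -> P) -> P by move=> /inRP h; apply; apply/mir_rightV.
have mnr (e f : 'I_n * 'I_n) (F : set_system R) : Filter F ->
    (\forall y \near F, X e y < X f y) -> \forall y \near F, xcurve (mir d) f y < xcurve (mir d) e y.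
  by move=> FF h; apply: filterS h => y; rewrite /= ltrN2.
split=> //.
- by rewrite memp mem_head.
- by rewrite memq mem_head.
- by rewrite memp -p2 mem_last.
- by rewrite memq -q2 mem_last.
- by move=> v; exact: (from_s up st (vertT v)).
- by move=> v; exact: (to_t up st (vertT v)).
- by move=> v; apply/orP; case: (cov v) => h; [left; apply/inLP|right; apply/inRP].
- move=> u v; rewrite !memp => up' vp uv H; apply: (path_consecutive acy p1 up' vp uv) => w wp.
  by apply: H; rewrite memp.
- move=> u v; rewrite !memq => up' vp uv H; apply: (path_consecutive acy q1 up' vp uv) => w wp.
  by apply: H; rewrite memq.
- move=> l r l' r' /inLP lL /inRP rR /inLP lL' /inRP rR' /edge_or lr /edge_or lr' /ltc_Y ll /ltc_Y rr.
  exact: (geo_cross up lL rR lL' rR' lr lr').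
- move=> w m z r /inLP wL /inLP mL /inLP zL /inRP rR wz /ltc_Y wm /ltc_Y mz /edge_or mr.
  exact: (geo_chord up wL mL zL rR wz wm mz mr).
- move=> w m z r /inRP wL /inRP mL /inRP zL /inLP rR wz /ltc_Y wm /ltc_Y mz /edge_or mr.
  apply: (geo_chord upm _ _ _ _ wz wm mz mr); try exact/mir_rightV; exact/mir_leftV.
- move=> w m z m' /inLP wL /inLP mL /inLP zL _ wz mm /ltc_Y wm /ltc_Y mz /ltc_Y zm.
  exact: (geo_nest up mL zL wz mm wm mz zm).
- move=> w m z m' /inRP wL /inRP mL /inRP zL _ wz mm /ltc_Y wm /ltc_Y mz /ltc_Y zm.
  by apply: (geo_nest upm _ _ wz mm wm mz zm); apply/mir_rightV.
- move=> u m v /inLP mL /inRP mR uv /ltc_Y um /ltc_Y mv.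
  exact: (geo_cut up (vertT m) mL mR uv um mv).
- by move=> v; case: (rotO v).
- by move=> v; case: (rotI v).
- by move=> v w; case: (rotO v).
- by move=> v w; case: (rotI v).
- move=> u a b /(before_out (rotO u))[ua ub nab nr] /inRP aR /inLP bL.
  exact: (geo_outRL up ua ub nab nr aR bL).
- move=> u a b /(before_out (rotO u))[ua ub nab nr] aL bL; apply: leY; first exact: chainL.
  exact: (geo_outLL up ua ub nab nr (elimT (inLP b) bL)).
- move=> u a b /(before_out (rotO u))[ua ub nab nr] aR bR; apply: leY; first exact: chainR.
  apply: (geo_outLL upm ub ua); [by rewrite eq_sym|exact: mnr|apply/mir_rightV; exact/inRP].
- move=> v a b /(before_in (rotI v))[ua ub nab nr] /inRP aR /inLP bL.
  exact: (geo_inRL up ua ub nab nr aR bL).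
- move=> v a b /(before_in (rotI v))[ua ub nab nr] aL bL; apply: leY; first exact: chainL.
  exact: (geo_inLL up ua ub nab nr (elimT (inLP b) bL)).
- move=> v a b /(before_in (rotI v))[ua ub nab nr] aR bR; apply: leY; first exact: chainR.
  apply: (geo_inLL upm ub ua); [by rewrite eq_sym|exact: mnr|apply/mir_rightV; exact/inRP].
Qed.
End TwoSided.

(** * The st-polygons are good intervals *)

Section SubDrawing.
Local Open Scope classical_set_scope.
Local Open Scope ring_scope.
Variables (R : realType) (n : nat) (d : drawing R n) (G H : digraph n).
Hypothesis sub : sub_digraph H G.

Lemma sub_edge e : e \in edges H -> e \in edges G.
Proof. by case: sub => _ /fintype.subsetP; apply. Qed.

Lemma sub_vert v : v \in verts H -> v \in verts G.
Proof. by case: sub => /fintype.subsetP h _; apply: h. Qed.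

Lemma sub_upward_planar : upward_planar d G -> upward_planar d H.
Proof.
case=> h1 h2 h3 h4; split.
- by move=> u v uH vH; apply: h1; exact: sub_vert.
- by move=> e /sub_edge; exact: h2.
- by move=> e w /sub_edge eE /sub_vert; exact: h3.
- by move=> e f z /sub_edge eE /sub_edge; exact: h4.
Qed.

Lemma sub_connect u v : connect (arc H) u v -> connect (arc G) u v.
Proof. by apply: connect_sub => a b ab; apply: connect1; exact: sub_edge ab. Qed.

Lemma sub_path u p : path (arc H) u p -> path (arc G) u p.
Proof. by apply: sub_path => a b; exact: sub_edge. Qed.

Lemma sub_leftV v : leftV d G v -> leftV d H v.
Proof. by move=> h e /sub_edge; exact: h. Qed.

Lemma sub_rightV v : rightV d G v -> rightV d H v.
Proof. by move=> h e /sub_edge; exact: h. Qed.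
End SubDrawing.

Section Stay.
Local Open Scope ring_scope.
Variables (R : realType) (n : nat) (d : drawing R n) (G : digraph n).
Hypothesis up : upward_planar d G.
Hypothesis wf : wf_digraph G.
Local Notation X := (xcurve d).
Local Notation Y := (ypos d).
Local Notation E := (edges G).

(** A path that gets to the right of the arc cannot come back across it. As it climbs to the height
    of [z] without visiting [z], it would pass to the right of a right vertex. *)
Lemma stay_up x z w p g y : (x, z) \in E -> rightV d G z -> path (arc G) w p -> z \notin w :: p ->
  Y z <= Y (last w p) -> g \in zip (w :: p) p -> spans d g y -> spans d (x, z) y ->
  X g y <= X (x, z) y.
Proof.
move=> eE zR; elim: p w g y => [|c p IH] w g y //= /andP[wc cp].
rewrite inE negb_or => /andP[zw zcp] zl; rewrite inE => /orP[/eqP -> {g}|gp] sg se; last exact: (IH c g y cp zcp zl gp sg se).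
rewrite leNgt; apply/negP => lt_eg; case/andP: (sg) => /= wy yc; case/andP: (se) => /= xy yz.
have cG : c \in verts G by case: (wf wc).
have zG : z \in verts G by case: (edge_verts wf eE).
have [zc|cz] := leP (Y z) (Y c).
  have sgz : spans d (w, c) (Y z) by rewrite spansE (le_trans wy yz) zc.
  have le1 := edges_nocross up eE wc se sg (spans_top up eE) sgz lt_eg.
  rewrite (edge_top up eE) /= in le1.
  have eqX : X (w, c) (Y z) = xpos d z by apply/eqP; rewrite eq_le zR.
  case: (vertex_on up wc zG sgz eqX) => /= ez; first by rewrite ez eqxx in zw.
  by move: zcp; rewrite ez mem_head.
have sec : spans d (x, z) (Y c) by rewrite spansE (le_trans xy yc) (ltW cz).
have le1 := edges_nocross up eE wc se sg sec (spans_top up wc) lt_eg.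
rewrite (edge_top up wc) /= in le1.
have nX : X (x, z) (Y c) != xpos d c.
  apply/eqP => eqX; case: (vertex_on up eE cG sec eqX) => /= ez; last first.
    by rewrite ez ltxx in cz.
  have yE : y = Y c by apply/eqP; rewrite eq_le yc ez xy.
  by move: lt_eg; rewrite yE eqX (edge_top up wc) ltxx.
case: p cp IH zl zcp => [|c' p] cp IH zl zcp; first by rewrite /= leNgt cz in zl.
have cc' : (c, c') \in E by move: cp => /= /andP[].
have := IH c (c, c') (Y c) cp zcp zl (mem_head _ _) (spans_bot up cc') sec.
by rewrite (edge_bot up cc') /= leNgt lt_neqAle nX le1.
Qed.

(** The same argument downwards, by induction from the end of the path: from the left of the arc,
    the path would descend to the left of [x]. *)
Lemma stay_down x z w p g y : (x, z) \in E -> leftV d G x -> path (arc G) w p -> x \notin w :: p ->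
  Y w <= Y x -> g \in zip (w :: p) p -> spans d g y -> spans d (x, z) y ->
  X (x, z) y <= X g y.
Proof.
move=> eE xL; elim/last_ind: p g y => [|p c IH] g y //.
rewrite rcons_path => /andP[wp lc]; rewrite -rcons_cons mem_rcons inE negb_or => /andP[xc xwp] wx.
have -> : zip (rcons (w :: p) c) (rcons p c) = rcons (zip (w :: p) p) (last w p, c).
  by elim: (p) (w) => [|a l IHl] b //=; rewrite -IHl.
rewrite mem_rcons inE => /orP[/eqP -> {g}|gp] sg se; last exact: (IH g y wp xwp wx gp sg se).
set l := last w p in lc sg *.
rewrite leNgt; apply/negP => lt_eg; case/andP: (sg) => /= ly yc; case/andP: (se) => /= xy yz.
have lG : l \in verts G by case: (wf lc).
have xG : x \in verts G by case: (edge_verts wf eE).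
have lwp : l \in w :: p by exact: mem_last.
have [lx|xl] := leP (Y l) (Y x).
  have sgz : spans d (l, c) (Y x) by rewrite spansE lx (le_trans xy yc).
  have le1 := edges_nocross up lc eE sg se sgz (spans_bot up eE) lt_eg.
  rewrite (edge_bot up eE) /= in le1.
  have eqX : X (l, c) (Y x) = xpos d x by apply/eqP; rewrite eq_le le1 xL.
  case: (vertex_on up lc xG sgz eqX) => /= ez; first by move: xwp; rewrite ez lwp.
  by move: xc; rewrite ez eqxx.
have sec : spans d (x, z) (Y l) by rewrite spansE (ltW xl) (le_trans ly yz).
have le1 := edges_nocross up lc eE sg se (spans_bot up lc) sec lt_eg.
rewrite (edge_bot up lc) /= in le1.
have nX : X (x, z) (Y l) != xpos d l.
  apply/eqP => eqX; case: (vertex_on up eE lG sec eqX) => /= ez.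
    by rewrite ez ltxx in xl.
  have yE : y = Y l by apply/eqP; rewrite eq_le ly ez yz.
  by move: lt_eg; rewrite yE eqX (edge_bot up lc) ltxx.
case/lastP: p @l wp IH lc sg xl lG xwp lwp sec le1 lt_eg nX ly => [|p c'] l wp IH lc sg xl lG xwp lwp sec le1 lt_eg nX ly.
  by move: xl; rewrite ltNge wx.
have gE : (last w p, l) \in zip (w :: rcons p c') (rcons p c').
  rewrite /l last_rcons; elim: (p) (w) => [|a q IHq] b /=; first by rewrite mem_head.
  by rewrite inE IHq orbT.
have [lE _ _] := path_edge wp gE.
have := IH (last w p, l) (Y l) wp xwp wx gE (spans_top up lE) sec.
by rewrite (edge_top up lE) /= leNgt lt_neqAle eq_sym nX le1.
Qed.
End Stay.

Section NoArc.
Local Open Scope classical_set_scope.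
Local Open Scope ring_scope.
Variables (R : realType) (n : nat) (d : drawing R n) (G H : digraph n) (u v : 'I_n).
Variables (p q : seq 'I_n).
Hypothesis up : upward_planar d G.
Hypothesis wf : wf_digraph G.
Hypothesis sub : sub_digraph H G.
Hypothesis st : st_digraph H u v.
Hypotheses (up_ : path (arc H) u p) (uq : path (arc H) u q).
Hypotheses (lp : last u p = v) (lq : last u q = v).
Hypothesis pq : forall x x' y, path_trace d (u :: p) (x, y) -> path_trace d (u :: q) (x', y) -> x <= x'.
Hypothesis np : inner u v (u :: p) <> [::].
Hypothesis nq : inner u v (u :: q) <> [::].
Hypothesis disj : forall a b, a \in inner u v (u :: p) -> b \in inner u v (u :: q) ->
  [/\ a <> b, ~~ arc H a b & ~~ arc H b a].
Local Notation X := (xcurve d).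
Local Notation Y := (ypos d).
Let upH := sub_upward_planar sub up.

Lemma inner_neq r : inner u v (u :: r) <> [::] -> last u r = v -> r <> [::].
Proof. by case: r => //= h uv; rewrite uv eqxx in h. Qed.

Lemma inner_mem r w : (w \in inner u v (u :: r)) = [&& w != u, w != v & w \in u :: r].
Proof. by rewrite mem_filter andbA. Qed.

Lemma side_vert r w : path (arc H) u r -> w \in u :: r -> w \in verts H.
Proof.
have wfH : wf_digraph H by case: st.
suff K x : x \in verts H -> path (arc H) x r -> w \in x :: r -> w \in verts H.
  by apply: K; exact: s_vert st.
elim: r x => [|c r IH] x xH /=; first by rewrite inE => _ /eqP ->.
case/andP=> xc cr; rewrite inE => /orP[/eqP -> //|]; apply: IH => //.
by case: (wfH x c xc).
Qed.

Lemma side_Y w : w \in verts H -> Y u <= Y w <= Y v.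
Proof. by move=> wH; rewrite (Ys_le upH st wH) (Yt_ge upH st wH). Qed.

(** The right side of [H] does not pass to the left of [a]. If [a] were a right vertex of [G], that
    side would run through [a], an inner vertex of both sides. *)
Lemma left_inner_notR a : a \in inner u v (u :: p) -> ~ rightV d G a.
Proof.
move=> ai aR; have := ai; rewrite inner_mem => /and3P[au av ap].
have aH := side_vert up_ ap; have aY := side_Y aH.
have [|g gq sg] := path_span (d := d) (y := Y a) uq (inner_neq nq lq); first by rewrite lq.
have [gH g1 g2] := path_edge uq gq; have gG := sub_edge sub gH.
have le1 : xpos d a <= X g (Y a).
  by apply: (pq (y := Y a)); [left; exists a|right; exists g].
have eqX : X g (Y a) = xpos d a by apply/eqP; rewrite eq_le le1 aR.
have aq : a \in u :: q by case: (vertex_on up gG (sub_vert sub aH) sg eqX) => ->.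
have aiq : a \in inner u v (u :: q) by rewrite inner_mem au av aq.
by case: (disj ai aiq).
Qed.

(** At the height of [w] both sides of [H] are squeezed onto [w], which becomes a common inner
    vertex. *)
Lemma inner_both w : Y u < Y w < Y v -> w \in verts G -> leftV d G w -> rightV d G w -> False.
Proof.
move=> /andP[uw wv] wG wL wR.
have aY : Y u <= Y w <= Y v by rewrite !ltW.
have [|g gq sg] := path_span (d := d) (y := Y w) uq (inner_neq nq lq); first by rewrite lq.
have [|f fp sf] := path_span (d := d) (y := Y w) up_ (inner_neq np lp); first by rewrite lp.
have [gH g1 g2] := path_edge uq gq; have gG := sub_edge sub gH.
have [fH f1 f2] := path_edge up_ fp; have fG := sub_edge sub fH.
have le1 : X f (Y w) <= X g (Y w) by apply: (pq (y := Y w)); right; [exists f|exists g].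
have eqf : X f (Y w) = xpos d w.
  by apply/eqP; rewrite eq_le wL // andbT (le_trans le1) // wR.
have eqg : X g (Y w) = xpos d w.
  by apply/eqP; rewrite eq_le wR //= (le_trans _ le1) // wL.
have wp : w \in u :: p by case: (vertex_on up fG wG sf eqf) => ->.
have wq : w \in u :: q by case: (vertex_on up gG wG sg eqg) => ->.
have nu : w != u by apply: contraTneq uw => ->; rewrite ltxx.
have nv : w != v by apply: contraTneq wv => ->; rewrite ltxx.
have [||] := disj (a := w) (b := w); rewrite ?inner_mem ?nu ?nv //.
Qed.

(** By [stay_up] and [stay_down] the arc runs between the sides of [H]. So [x] is on the left side,
    [z] on the right side, and the arc is in the enclosed region; by fullness it belongs to [H],
    where no edge joins the two sides. *)
Lemma no_arc_across x z : (forall e, e \in edges G -> curve d e `<=` ~` external_face d H -> e \in edges H) ->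
  (x, z) \in edges G -> Y u < Y x -> Y z < Y v ->
  leftV d G x -> rightV d G z -> x \notin u :: q -> z \notin u :: p -> False.
Proof.
move=> full eE ux zv xL zR xq zp; have xz := edge_Y up eE; rewrite /= in xz.
have [xG zG] := edge_verts wf eE; rewrite /= in xG zG.
have upG := sub_path sub up_; have uqG := sub_path sub uq.
have A g y : g \in zip (u :: p) p -> spans d g y -> spans d (x, z) y -> X g y <= X (x, z) y.
  by apply: (stay_up up wf eE zR upG zp); rewrite lp ltW.
have B g y : g \in zip (u :: q) q -> spans d g y -> spans d (x, z) y -> X (x, z) y <= X g y.
  by apply: (stay_down up wf eE xL uqG xq); rewrite ltW.
have onp y : Y u <= y <= Y v -> exists2 g, g \in zip (u :: p) p & spans d g y.
  by move=> h; apply: path_span up_ (inner_neq np lp) _; rewrite lp.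
have onq y : Y u <= y <= Y v -> exists2 g, g \in zip (u :: q) q & spans d g y.
  by move=> h; apply: path_span uq (inner_neq nq lq) _; rewrite lq.
have xp : x \in u :: p.
  have [|g gp sg] := onp (Y x); first by rewrite (ltW ux) (ltW (lt_trans xz zv)).
  have [gH g1 g2] := path_edge up_ gp; have gG := sub_edge sub gH.
  have le1 := A g (Y x) gp sg (spans_bot up eE); rewrite (edge_bot up eE) /= in le1.
  have eqX : X g (Y x) = xpos d x by apply/eqP; rewrite eq_le le1 xL.
  by case: (vertex_on up gG xG sg eqX) => ->.
have zq : z \in u :: q.
  have [|g gq sg] := onq (Y z); first by rewrite (ltW (lt_trans ux xz)) (ltW zv).
  have [gH g1 g2] := path_edge uq gq; have gG := sub_edge sub gH.
  have le1 := B g (Y z) gq sg (spans_top up eE); rewrite (edge_top up eE) /= in le1.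
  have eqX : X g (Y z) = xpos d z by apply/eqP; rewrite eq_le le1 zR.
  by case: (vertex_on up gG zG sg eqX) => ->.
have nx : x != u by apply: contraTneq ux => ->; rewrite ltxx.
have nx' : x != v by apply: contraTneq (lt_trans xz zv) => ->; rewrite ltxx.
have nz : z != v by apply: contraTneq zv => ->; rewrite ltxx.
have nz' : z != u by apply: contraTneq (lt_trans ux xz) => ->; rewrite ltxx.
have [||_ /negP] := disj (a := x) (b := z); rewrite ?inner_mem ?nx ?nx' ?nz ?nz' //.
case; apply: full => // -[wx wy] [/= sw ->]; rewrite (external_faceE upH st) => -[].
have /andP[/= xw wz] := sw.
have wY : Y u <= wy <= Y v by rewrite (le_trans (ltW ux) xw) (le_trans wz (ltW zv)).
have [g gp sg] := onp _ wY; have [f fq sf] := onq _ wY.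
have [gH _ _] := path_edge up_ gp; have [fH _ _] := path_edge uq fq.
by apply: (hull_edges gH fH) => //=; rewrite A ?B.
Qed.
End NoArc.

Section Interval.
Local Open Scope classical_set_scope.
Local Open Scope ring_scope.
Variables (R : realType) (n : nat) (d : drawing R n) (E : {set 'I_n * 'I_n}).
Variables (outs ins : 'I_n -> seq 'I_n) (s t : 'I_n).
Local Notation G := (([set: 'I_n]%SET, E) : digraph n).
Hypothesis up : upward_planar d G.
Hypothesis st : st_digraph G s t.
Local Notation inL := (inL d E).
Local Notation inR := (inR d E).
Hypothesis W : two_sided (arc G) s t inL inR outs ins.
Local Notation Y := (ypos d).
Local Notation le := (connect (arc G)).
Local Notation lt := (ltc (arc G)).
Local Notation inside := (inside (arc G)).
Local Notation good := (good (arc G) inL inR).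
Let wf : wf_digraph G. Proof. by case: st. Qed.
Let acy := ts_acy W.

Definition interval (u v : 'I_n) : digraph n :=
  ([set w | le u w && le w v]%SET, [set e in E | le u e.1 && le e.2 v]%SET).

Lemma interval_vert u v w : (w \in verts (interval u v)) = le u w && le w v.
Proof. by rewrite inE. Qed.

Lemma interval_arc u v a b : arc (interval u v) a b = [&& arc G a b, le u a & le b v].
Proof. by rewrite /arc inE. Qed.

Lemma interval_sub u v : sub_digraph (interval u v) G.
Proof.
split; first by apply/fintype.subsetP => w _; rewrite inE.
by apply/fintype.subsetP => e; rewrite inE => /andP[].
Qed.

Lemma interval_st u v : le u v -> st_digraph (interval u v) u v.
Proof.
move=> uv; split.
- move=> a b; rewrite interval_arc !interval_vert => /and3P[ab ua bv].
  by rewrite ua bv (connect_trans (connect1 ab) bv) (connect_trans ua (connect1 ab)).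
- move=> a b; rewrite interval_arc => /and3P[ab _ _]; apply: contra (acy ab).
  exact: (sub_connect (interval_sub u v)).
- apply/setP => w; rewrite !inE; apply/andP/eqP => [[/andP[uw wv] /forallP h]|->].
    apply/eqP; rewrite eq_sym; apply: contraT => nuw.
    have [c cw uc] : exists2 c, arc G c w & le u c by apply: last_step; rewrite /ltc nuw.
    by have := h c; rewrite interval_arc cw uc wv.
  rewrite connect0 uv; split=> //; apply/forallP => x; rewrite interval_arc.
  by apply/negP => /and3P[wu uw _]; have := acy wu; rewrite uw.
- apply/setP => w; rewrite !inE; apply/andP/eqP => [[/andP[uw wv] /forallP h]|->].
    apply/eqP; apply: contraT => nuw.
    have [c cw uc] : exists2 c, arc G w c & le c v by apply: first_step; rewrite /ltc nuw.
    by have := h c; rewrite interval_arc cw uw uc.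
  rewrite connect0 uv; split=> //; apply/forallP => x; rewrite interval_arc.
  by apply/negP => /and3P[wu uw vv]; have := acy wu; rewrite vv.
Qed.

Lemma interval_sources u v : le u v -> sources (interval u v) = [set u]%SET.
Proof. by move=> /interval_st[]. Qed.

(** A left and a right vertex of [G] inside the interval that coincide or are adjacent would give
    such a pair on the sides of [H]. An arc from right to left is treated in the mirror image. *)
Lemma polygon_good H : polygon_of d G H ->
  exists u v, good u v /\ sub_digraph H (interval u v).
Proof.
case=> sub [[_ upH clH] [u [v [p [q [stH [dp dq _ pq] [np nq] disj]]]]]] _ full.
case: dp dq => p' [ep pp lp] [q' [eq qq lq]]; rewrite {p}ep {q}eq in pq np nq disj.
have upm := mir_upward_planar up.
have trm (r : seq 'I_n) z : path_trace (mir d) r z -> path_trace d r (- z.1, z.2) by move/trace_mir.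
have pqm : forall x x' y, path_trace (mir d) (u :: q') (x, y) ->
    path_trace (mir d) (u :: p') (x', y) -> x <= x'.
  by move=> x x' y /trm /= h1 /trm /= h2; rewrite -lerN2; exact: pq h2 h1.
have disjm a b : a \in inner u v (u :: q') -> b \in inner u v (u :: p') ->
    [/\ a <> b, ~~ arc H a b & ~~ arc H b a].
  by move=> h1 h2; have [n1 n2 n3] := disj _ _ h2 h1; split=> // ab; apply: n1.
have vertsub w : w \in verts H -> le u w && le w v.
  move=> wH; have h1 := from_s upH stH wH; have h2 := to_t upH stH wH.
  by rewrite (sub_connect sub h1) (sub_connect sub h2).
have wfH : wf_digraph H by case: stH.
have subI : sub_digraph H (interval u v).
  split; first by apply/fintype.subsetP => w wH; rewrite interval_vert; exact: vertsub.
  apply/fintype.subsetP => e eH; rewrite inE (sub_edge sub eH) /=.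
  have [e1 e2] := edge_verts wfH eH.
  by case/andP: (vertsub _ e1) => -> _; case/andP: (vertsub _ e2) => _ ->.
have leftN a : a \in inner u v (u :: p') -> ~~ inR a.
  by move=> ai; apply/inRP; exact: (left_inner_notR up sub stH pp qq lq pq nq disj ai).
have rightN a : a \in inner u v (u :: q') -> ~~ inL a.
  move=> ai; apply/inLP => aL.
  by apply: (left_inner_notR upm sub stH qq pp lp pqm np disjm ai); exact/mir_leftV.
have inn r w : path (arc H) u r -> w \in inner u v (u :: r) -> inside u v w.
  move=> ur; rewrite inner_mem => /and3P[wu wv wr].
  have /andP[h1 h2] := vertsub _ (side_vert stH ur wr).
  by rewrite /inside /ltc h1 h2 eq_sym wu wv.
have insY w : inside u v w -> Y u < Y w < Y v.
  by case/andP=> /(ltc_Y up) h1 /(ltc_Y up) h2; rewrite h1 h2.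
have both w : inside u v w -> inL w -> inR w -> False.
  move=> /insY wY /inLP wL /inRP wR.
  exact: (inner_both up sub pp qq lp lq pq np nq disj wY (vertT E w) wL wR).
have hasL : exists a, a \in inner u v (u :: p').
  by case: (inner u v (u :: p')) np => // a l _; exists a; rewrite mem_head.
have hasR : exists a, a \in inner u v (u :: q').
  by case: (inner u v (u :: q')) nq => // a l _; exists a; rewrite mem_head.
have inside_notin r w : inside u v w -> w \notin inner u v (u :: r) -> w \notin u :: r.
  move=> /andP[h1 h2]; rewrite inner_mem (ltc_neq h2) /= eq_sym (ltc_neq h1) //.
exists u, v; split=> //; split.
- have [a ai] := hasL; exists a; first exact: inn pp ai.
  exact: (notR_L W (leftN _ ai)).
- have [a ai] := hasR; exists a; first exact: inn qq ai.
  exact: (notL_R W (rightN _ ai)).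
move=> a b ai aL bi bR.
have anq : a \notin u :: q'.
  by apply: inside_notin => //; apply/negP => /rightN; rewrite aL.
have bnp : b \notin u :: p'.
  by apply: inside_notin => //; apply/negP => /leftN; rewrite bR.
have /andP[ua av] := insY a ai; have /andP[ub bv] := insY b bi.
split.
- by move=> eab; apply: (both a) => //; rewrite eab.
- apply/negP => ab.
  exact: (no_arc_across up wf sub stH pp qq lp lq np nq disj full ab ua bv (elimT (inLP _ _ _) aL) (elimT (inRP _ _ _) bR) anq bnp).
- apply/negP => ba.
  have fullm : forall e, e \in edges G -> curve (mir d) e `<=` ~` external_face (mir d) H -> e \in edges H.
    move=> e eE ce; apply: full => // -[x y] [se xe].
    rewrite (external_faceE upH stH) => nh.
    have upHm := mir_upward_planar upH.
    have := ce (- x, y); rewrite (external_faceE upHm stH); apply.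
      by split=> //=; move: xe => /= ->.
    by move=> /hull_mir /=; rewrite opprK.
  apply: (no_arc_across upm wf sub stH qq pp lq lp nq np disjm fullm ba ub av _ _ bnp anq).
    by apply/mir_rightV; exact/inRP.
  by apply/mir_leftV; exact/inLP.
Qed.

(** The interval might expose new vertices on its left, but its left side is a chain through [lo u],
    and inner vertices comparable with [lo u] are on the left in [G]. *)
Lemma interval_leftV u v w : good u v -> inside u v w ->
  leftV d (interval u v) w <-> inL w.
Proof.
move=> g wi; split; last by move=> /inLP h; exact: (sub_leftV (interval_sub u v) h).
have [ua aL ai _ _] := good_ends W g.
have IG := interval_sub u v; have upI := sub_upward_planar IG up.
have vert x : inside u v x -> x \in verts (interval u v).
  by case/andP=> /ltcW ux /ltcW xv; rewrite interval_vert ux xv.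
have uv : le u v by case/andP: wi => h1 h2; exact: connect_trans (ltcW h1) (ltcW h2).
have [p [q [[pp lp pL] _ _]]] := st_sides upI (interval_st uv) => wl.
have wp : w \in u :: p by apply/pL => //; exact: vert.
have ap : fst_nbr outs u \in u :: p.
  by apply/pL; [exact: vert|apply: (sub_leftV IG); exact/inLP].
case/orP: (path_chain (sub_path IG pp) wp ap) => h.
  by rewrite (goodL_chain W g wi ai h).
by rewrite -(goodL_chain W g ai wi h).
Qed.

Lemma interval_rightV u v w : good u v -> inside u v w ->
  rightV d (interval u v) w <-> inR w.
Proof.
move=> g wi; split; last by move=> /inRP h; exact: (sub_rightV (interval_sub u v) h).
have [_ _ _ ua [aR ai]] := good_ends W g.
have IG := interval_sub u v; have upI := sub_upward_planar IG up.
have vert x : inside u v x -> x \in verts (interval u v).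
  by case/andP=> /ltcW ux /ltcW xv; rewrite interval_vert ux xv.
have uv : le u v by case/andP: wi => h1 h2; exact: connect_trans (ltcW h1) (ltcW h2).
have [p [q [_ [pp lp pR] _]]] := st_sides upI (interval_st uv) => wr.
have wp : w \in u :: q by apply/pR => //; exact: vert.
have ap : lst_nbr outs u \in u :: q.
  by apply/pR; [exact: vert|apply: (sub_rightV IG); exact/inRP].
have gm := good_mirror g.
case/orP: (path_chain (sub_path IG pp) wp ap) => h.
  by rewrite (goodL_chain (ts_mirror W) gm wi ai h).
by rewrite -(goodL_chain (ts_mirror W) gm ai wi h).
Qed.

(** [S] is left or right with respect to the interval and [P] with respect to [G], so that one proof
    serves both sides. *)
Lemma interval_side u v p (P : pred 'I_n) (S : 'I_n -> Prop) : lt u v ->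
  path (arc (interval u v)) u p -> last u p = v ->
  (forall w, w \in verts (interval u v) -> S w <-> w \in u :: p) ->
  (forall w, inside u v w -> S w <-> P w) ->
  forall w, (w \in p) = (w == v) || (inside u v w && P w).
Proof.
move=> uv pp lp pS SP w; have ppG := sub_path (interval_sub u v) pp.
have /= /andP[up_ _] := path_uniq W ppG.
have vp : v \in p.
  have := mem_last u p; rewrite lp inE eq_sym => /orP[/eqP vu|//].
  by move: uv; rewrite vu /ltc eqxx.
have pe : p <> [::] by move=> e; rewrite e in vp.
have [->|nwv] /= := eqVneq w v; first by [].
apply/idP/andP => [wp|[wi wP]].
  have wp' : w \in u :: p by rewrite inE wp orbT.
  have wV := side_vert (interval_st (ltcW uv)) pp wp'.
  have wi : inside u v w.
    have := wV; rewrite interval_vert /inside /ltc => /andP[-> ->].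
    by rewrite nwv !andbT; apply: contraNneq up_ => ->.
  by split=> //; apply/SP => //; apply/pS.
have /andP[h1 h2] := wi.
have : w \in u :: p by apply/pS; [rewrite interval_vert !ltcW|apply/SP].
by rewrite inE eq_sym (negbTE (ltc_neq h1)).
Qed.

Lemma interval_paths u v : good u v -> exists p q,
  [/\ path (arc (interval u v)) u p /\ last u p = v,
      path (arc (interval u v)) u q /\ last u q = v,
      forall w, (w \in p) = (w == v) || (inside u v w && inL w),
      forall w, (w \in q) = (w == v) || (inside u v w && inR w) &
      sides d (interval u v) u v (u :: p) (u :: q)].
Proof.
move=> g; have [_ _ /andP[h1 h2] _ _] := good_ends W g.
have uv : lt u v := ltc_trans acy h1 h2.
have upI := sub_upward_planar (interval_sub u v) up.
have [p [q [[pp lp pL] [qq lq qR] S]]] := st_sides upI (interval_st (ltcW uv)).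
exists p, q; split=> //.
  by apply: (interval_side uv pp lp pL) => w; exact: interval_leftV.
by apply: (interval_side uv qq lq qR) => w; exact: interval_rightV.
Qed.

Lemma interval_sides u v l r : poly_sides (arc G) inL inR u v l r ->
  sides d (interval u v) u v (u :: rcons l v) (u :: rcons r v).
Proof.
case=> g lpth rpth lE rE; have IG := interval_sub u v.
have [p [q [[pp _] [qq _] pE qE S]]] := interval_paths g.
have -> : rcons l v = p.
  apply: (path_eq_mem W lpth (sub_path IG pp)) => w.
  by rewrite mem_rcons inE pE lE.
have -> // : rcons r v = q.
by apply: (path_eq_mem W rpth (sub_path IG qq)) => w; rewrite mem_rcons inE qE rE.
Qed.

Lemma good_polygon u v : good u v -> polygon_of d G (interval u v).
Proof.
move=> g; have IG := interval_sub u v; have upI := sub_upward_planar IG up.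
have [p [q [[pp lp] [qq lq] pE qE S]]] := interval_paths g.
have [_ _ /andP[h1 h2] _ _] := good_ends W g.
have uv : lt u v := ltc_trans acy h1 h2.
have stI := interval_st (ltcW uv).
have inn w : inside u v w -> (w != u) && (w != v).
  by case/andP => k1 k2; rewrite (ltc_neq k2) eq_sym (ltc_neq k1).
have innP r (P : pred 'I_n) : (forall w, (w \in r) = (w == v) || (inside u v w && P w)) ->
    forall w, (w \in inner u v (u :: r)) = inside u v w && P w.
  move=> rE w; rewrite inner_mem inE rE; apply/and3P/andP => [[/negbTE -> /negbTE ->]|[wi wP]] /=.
    by move/andP.
  by have /andP[-> ->] := inn w wi; rewrite wi wP !orbT.
have mem_in w : w \in verts (interval u v) -> [\/ w = u, w = v | inside u v w].
  rewrite interval_vert /inside /ltc => /andP[uw wv].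
  have [->|nu] := eqVneq w u; first exact: Or31.
  have [->|nv] := eqVneq w v; first exact: Or32.
  by apply: Or33; rewrite uw wv.
have [_ _ Scl _] := S.
(* A vertex in the hull lies between two edges of the interval. Being on a side of [G], it is on one
   of these edges, hence an end of it. *)
have vG w : ~ external_face d (interval u v) (pos d w) -> w \in verts (interval u v).
  rewrite (external_faceE upI stI) => /contrapT.
  case/(hull_cases upI stI) => [e|[e [f [[eI fI] [se sf] /= /andP[k1 k2]]]]].
    have -> : w = u by case: up => inj _ _ _; apply: inj; rewrite ?inE.
    by rewrite interval_vert connect0 ltcW.
  have wfI : wf_digraph (interval u v) by case: stI.
  have eG := sub_edge IG eI; have fG := sub_edge IG fI.
  have [e1 e2] := edge_verts wfI eI; have [f1 f2] := edge_verts wfI fI.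
  have /orP[/inLP wL|/inRP wR] := ts_cover W w.
    have eqX : xcurve d e (Y w) = xpos d w by apply/eqP; rewrite eq_le k1 wL.
    by case: (vertex_on up eG (vertT E w) se eqX) => ->.
  have eqX : xcurve d f (Y w) = xpos d w by apply/eqP; rewrite eq_le k2 wR.
  by case: (vertex_on up fG (vertT E w) sf eqX) => ->.
split=> //.
- split.
    split; [by exists u, v|exact: upI|].
    move=> w wI.
    suff : (path_trace d (u :: p) `|` path_trace d (u :: q)) (pos d w).
      by rewrite -Scl => -[].
    have [->|->|wi] := mem_in w wI.
    + by left; left; exists u; rewrite ?mem_head.
    + by left; left; exists v; rewrite // inE pE eqxx orbT.
    + have [wL|wR] := orP (ts_cover W w); [left|right]; left; exists w => //.
        by rewrite inE pE wi wL !orbT.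
      by rewrite inE qE wi wR !orbT.
  exists u, v, (u :: p), (u :: q); split=> //.
    have [[a ai aL] [b bi bR] _] := g; split=> e.
      by have := innP p _ pE a; rewrite e ai aL.
    by have := innP q _ qE b; rewrite e bi bR.
  move=> a b; rewrite (innP p _ pE) (innP q _ qE) => /andP[ai aL] /andP[bi bR].
  have [_ _ /(_ a b ai aL bi bR)[nab n1 n2]] := g.
  split=> //; first by apply: contra n1; rewrite interval_arc => /andP[].
  by apply: contra n2; rewrite interval_arc => /andP[].
- by move=> w _; exact: vG.
- move=> e eG ce; have e1 := spans_bot up eG; have e2 := spans_top up eG.
  have k1 : e.1 \in verts (interval u v).
    by apply: vG; apply: ce; split=> //=; rewrite (edge_bot up eG).
  have k2 : e.2 \in verts (interval u v).
    by apply: vG; apply: ce; split=> //=; rewrite (edge_top up eG).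
  move: k1 k2 eG; rewrite !interval_vert inE /edges /= => /andP[-> _] /andP[_ ->] ->.
  by [].
Qed.

Lemma good_le u v : good u v -> le u v.
Proof. by case=> -[a /andP[h1 h2] _] _ _; exact: connect_trans (ltcW h1) (ltcW h2). Qed.

Lemma sub_interval u v u' v' : le u v -> sub_digraph (interval u v) (interval u' v') ->
  le u' u && le v v'.
Proof.
move=> uv sub; have h w : w \in verts (interval u v) -> le u' w && le w v'.
  by case: sub => /fintype.subsetP k _ /k; rewrite interval_vert.
have /andP[-> _] := h u ltac:(by rewrite interval_vert connect0).
by have /andP[_ ->] := h v ltac:(by rewrite interval_vert connect0 andbT).
Qed.

Lemma maximal_polygonP H : maximal_polygon d G H <->
  exists u v, good u v /\ H = interval u v.
Proof.
split=> [[pH mx]|[u [v [g ->]]]].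
  have [u [v [g HI]]] := polygon_good pH; exists u, v; split=> //.
  by rewrite (mx _ (good_polygon g) HI).
split=> [|H' pH' sub]; first exact: good_polygon.
have [u' [v' [g' sub']]] := polygon_good pH'.
have : sub_digraph (interval u v) (interval u' v').
  by case: sub sub' => a1 a2 [b1 b2]; split; apply: fintype.subset_trans; eauto.
move=> /(sub_interval (good_le g)) /andP[le1 le2].
have [e1 e2] := good_antichain W g g' le1 le2; rewrite -e1 -e2 in sub'.
case: H' sub sub' {pH'} => VH EH [/= a1 a2] [/= b1 b2].
by congr (_, _); apply/eqP; rewrite finset.eqEsubset ?a1 ?a2 ?b1 ?b2.
Qed.

Lemma free_vertexP w : free_vertex d G w <-> ~ covered (arc G) inL inR w.
Proof.
split=> [[_ h] [u [v [g [uw wv]]]]|h].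
  have /maximal_polygonP/h : exists u0 v0, good u0 v0 /\ interval u v = interval u0 v0 by exists u, v.
  by rewrite interval_vert uw wv.
split=> [|H /maximal_polygonP[u [v [g ->]]]]; first by rewrite inE.
by rewrite interval_vert; apply/negP => /andP[uw wv]; apply: h; exists u, v.
Qed.
End Interval.

(** * The decomposition and its output *)

Lemma pairwise_pmap (T T' : eqType) (f : T -> option T') (r : rel T) (r' : rel T') s :
  (forall u v x y, r u v -> f u = Some x -> f v = Some y -> r' x y) ->
  pairwise r s -> pairwise r' (pmap f s).
Proof.
move=> h; elim: s => //= u s IH /andP[/allP us /IH]; case fu: (f u) => [x|] //= ->.
rewrite andbT; apply/allP => y; rewrite mem_pmap => /mapP[v vs /esym fv].
exact: h (us v vs) fu fv.
Qed.

Lemma output_word_cat (R : realType) n (d : drawing R n) D1 D2 o1 o2 :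
  output_word d D1 o1 -> output_word d D2 o2 -> output_word d (D1 ++ D2) (o1 ++ o2).
Proof.
move=> + h; elim: D1 o1 => [|x D1 IH] o1 /= => [->//|[w1 [w2 [xw /IH h2 ->]]]].
by exists w1, (w2 ++ o2); rewrite catA.
Qed.

Section Elements.
Variables (R : realType) (n : nat) (d : drawing R n) (E : {set 'I_n * 'I_n}).
Variables (outs ins : 'I_n -> seq 'I_n) (s t : 'I_n).
Local Notation G := (([set: 'I_n]%SET, E) : digraph n).
Hypothesis up : upward_planar d G.
Hypothesis st : st_digraph G s t.
Local Notation inL := (inL d E).
Local Notation inR := (inR d E).
Hypothesis W : two_sided (arc G) s t inL inR outs ins.
Local Notation le := (connect (arc G)).
Local Notation good := (good (arc G) inL inR).
Local Notation covered := (covered (arc G) inL inR).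
Local Notation interval := (interval E).

(** Elements are indexed by their representatives, which turns the order of treatment of the
    vertices into the decomposition. *)
Definition elem (u : 'I_n) : option (element n) :=
  if [pick v | `[< good u v >]] is Some v then Some (inl (interval u v))
  else if `[< covered u >] then None else Some (inr u).

Variant elem_spec u : option (element n) -> Prop :=
| ElemPolygon v of good u v : elem_spec u (Some (inl (interval u v)))
| ElemFree of ~ covered u : elem_spec u (Some (inr u))
| ElemNone of covered u & (forall v, ~ good u v) : elem_spec u None.

Lemma elemP u : elem_spec u (elem u).
Proof.
rewrite /elem; case: pickP => [v /asboolP g|h]; first exact: ElemPolygon.
case: asboolP => c; last exact: ElemFree.
by apply: ElemNone => // v g; have /asboolP := h v; apply.
Qed.

Lemma good_covered u v : good u v -> covered u.
Proof. by move=> g; exists u, v; rewrite connect0 (good_le g). Qed.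

Lemma elem_good u v : good u v -> elem u = Some (inl (interval u v)).
Proof.
move=> g; case: elemP => [v' g'|/(_ (good_covered g)) //|_ /(_ v) //].
by rewrite (good_snk_uniq W g g').
Qed.

Lemma elem_free u : ~ covered u -> elem u = Some (inr u).
Proof. by move=> nc; case: elemP => // v /good_covered. Qed.

Lemma elem_representative u x : elem u = Some x -> representative x u.
Proof. by case: elemP => [v g|nc|//] [<-] //=; apply: (interval_sources W); exact: good_le g. Qed.

Lemma representative_inj (x : element n) u v : representative x u -> representative x v -> u = v.
Proof. by case: x => [H|w] /= -> // /set1_inj. Qed.

Lemma is_elementP x : is_element d G x <-> exists u, elem u = Some x.
Proof.
split.
  case: x => [H /(maximal_polygonP up st W)[u [v [g ->]]]|w /(free_vertexP up st W)/elem_free ?].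
    by exists u; exact: elem_good.
  by exists w.
case=> u; case: elemP => [v g|nc|//] [<-] /=.
  by apply/(maximal_polygonP up st W); exists u, v.
exact/(free_vertexP up st W).
Qed.

(** A representative that is incomparable with another vertex lies inside a good interval, hence is
    not free. If two representatives were incomparable, both would be sources of good intervals, and
    these are comparable. *)
Lemma elem_comparable u v x y : elem u = Some x -> elem v = Some y -> le u v || le v u.
Proof.
have K a b z : elem a = Some z -> parallel (arc G) a b -> exists c, good a c.
  case: elemP => // [c g|nc] _ /(parallel_inside W)[c' [e' [g' i']]]; first by exists c.
  by case: nc; exists c', e'; case/andP: i' => /ltcW -> /ltcW ->.
move=> ux vy; apply: contraT; rewrite negb_or => /andP[n1 n2].
have [|c g] := K _ v _ ux; first by rewrite /parallel n1 n2.
have [|e g'] := K _ u _ vy; first by rewrite /parallel n1 n2.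
by have := good_src_comparable W g g'; rewrite (negbTE n1) (negbTE n2).
Qed.

Lemma decomposition_pmap Q : uniq Q -> (forall v, v \in Q) -> pairwise (fun a b => ~~ le b a) Q ->
  st_polygon_decomposition d G (pmap elem Q).
Proof.
move=> UQ inQ ord; split.
- rewrite -(map_inj_uniq (f := Some)); last by move=> x y [].
  rewrite pmapS_filter map_inj_in_uniq ?filter_uniq // => u v.
  rewrite !mem_filter => /andP[ux _] /andP[vx _] e.
  case eu : (elem u) ux => [x|//] _; rewrite eu in e.
  exact: representative_inj (elem_representative eu) (elem_representative (esym e)).
- move=> x; rewrite is_elementP mem_pmap; split=> [/mapP[u _ e]|[u e]]; first by exists u.
  by apply/mapP; exists u.
- apply: pairwise_pmap ord => u v x y nvu ux vy; apply/asboolP; exists u, v; split.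
  + exact: elem_representative.
  + exact: elem_representative.
  + by have := elem_comparable ux vy; rewrite (negbTE nvu) orbF.
Qed.

Lemma emitted_output Q o : emitted (arc G) inL inR Q o -> output_word d (pmap elem Q) o.
Proof.
elim=> // {}Q {}o u w _ IH uw; rewrite -cats1 pmap_cat; apply: output_word_cat => //=.
case: uw => [[v [l [r [S ->]]]]|[nc ->]|[c ng ->]].
- have [g _ _ _ _] := S; rewrite (elem_good g) /=; exists (polygon_word u v l r), [::].
  split; rewrite ?cats0 //; exists u, v, (u :: rcons l v), (u :: rcons r v); split=> //.
    exact: interval_st W _ _ (good_le g).
  exact: (interval_sides up W S).
- by rewrite (elem_free nc) /=; exists [:: 0; val u], [::].
- by case: elemP => // v g; case: (ng v).
Qed.
End Elements.

Theorem theorem3 :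
  exists (P : com) (K : nat),
    forall (R : realType) (n : nat) (E : {set 'I_n * 'I_n}) (d : drawing R n)
           (outs ins : 'I_n -> seq 'I_n),
      outerplanar_st d ([set: 'I_n]%SET, E) ->
      rotation d ([set: 'I_n]%SET, E) outs ins ->
      exists (D : seq (element n)) (k : nat) (st : state),
        [/\ st_polygon_decomposition d ([set: 'I_n]%SET, E) D,
            exec P (init_state (input_word outs ins)) k st,
            output_word d D (out st) &
            (k <= K * n)%N].
Proof.
exists program, 4000 => R n E d outs ins [[s [t st]] up cl] rot.
have cov v : leftV d ([set: 'I_n]%SET, E) v \/ rightV d ([set: 'I_n]%SET, E) v.
  by apply: (closure_face_side up st); apply: cl; rewrite inE.
have W := planar_two_sided up st cov rot.
have [k [st' [Q [run kn em UQ [inQ ord]]]]] := run_program W.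
exists (pmap (elem d E) Q), k, st'; split=> //.
  exact: decomposition_pmap up st W _ UQ inQ ord.
exact: (emitted_output up W em).
Qed.
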